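(* For every positive integer $n$ and every finite subgroup $\Gamma$ of $SU(2)$, $$N(\Gamma,Sp(n))=N(\Gamma,SO(2n+1)).$$
   Context: For a finite group $\Gamma$ and a compact Lie group $G$, $N(\Gamma,G)$ denotes the number of homomorphisms $f:\Gamma\to G$ up to conjugation by $G$ (i.e. $f_1\sim f_2$ iff there is $g\in G$ with $f_2(\gamma)=gf_1(\gamma)g^{-1}$ for all $\gamma\in\Gamma$). $Sp(n)$ is the compact symplectic group acting on $\mathbb{H}^n$ (so $Sp(1)\cong SU(2)$). *)

(* Defs.v *)
From HB Require Import structures.
From mathcomp Require Import all_boot all_order all_algebra.
From mathcomp Require Import finmap complex ring.
From mathcomp Require Import classical_sets cardinality boolp reals.

Set Implicit Arguments.
Unset Strict Implicit.
Unset Printing Implicit Defensive.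

Import GRing.Theory Num.Theory.
Local Open Scope ring_scope.
Local Open Scope complex_scope.
Local Open Scope sesquilinear_scope.

(* a + bi + cj + dk *)
Record quaternion (R : Type) : Type :=
  Quaternion { quat_re : R; quat_i : R; quat_j : R; quat_k : R }.

Section QuaternionChoice.
Variable R : choiceType.

Definition tuple_of_quaternion (q : quaternion R) : R * R * R * R :=
  (quat_re q, quat_i q, quat_j q, quat_k q).
Definition quaternion_of_tuple (t : R * R * R * R) : quaternion R :=
  let: (a, b, c, d) := t in Quaternion a b c d.

Fact tuple_of_quaternionK : cancel tuple_of_quaternion quaternion_of_tuple.
Proof. by case. Qed.

HB.instance Definition _ :=
  Choice.copy (quaternion R) (can_type tuple_of_quaternionK).
End QuaternionChoice.

Section QuaternionRing.
Variable R : realType.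
Implicit Types p q r : quaternion R.

Definition quat_add p q : quaternion R :=
  let: Quaternion a b c d := p in let: Quaternion a' b' c' d' := q in
  Quaternion (a + a') (b + b') (c + c') (d + d').
Definition quat_opp q : quaternion R :=
  let: Quaternion a b c d := q in Quaternion (- a) (- b) (- c) (- d).

(* Hamilton's product: i^2 = j^2 = k^2 = ijk = -1. *)
Definition quat_mul p q : quaternion R :=
  let: Quaternion a b c d := p in let: Quaternion a' b' c' d' := q in
  Quaternion
    (a * a' - b * b' - c * c' - d * d')
    (a * b' + b * a' + c * d' - d * c')
    (a * c' - b * d' + c * a' + d * b')
    (a * d' + b * c' - c * b' + d * a').

Fact quat_addA : associative quat_add.
Proof.
by case=> ? ? ? ? [? ? ? ?] [? ? ? ?]; congr Quaternion; exact: addrA.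
Qed.
Fact quat_addC : commutative quat_add.
Proof. by case=> ? ? ? ? [? ? ? ?]; congr Quaternion; rewrite /= addrC. Qed.
Fact quat_add0 : left_id (Quaternion 0 0 0 0) quat_add.
Proof. by case=> ? ? ? ?; congr Quaternion; rewrite /= add0r. Qed.
Fact quat_addN : left_inverse (Quaternion 0 0 0 0) quat_opp quat_add.
Proof. by case=> ? ? ? ?; congr Quaternion; rewrite /= addNr. Qed.

HB.instance Definition _ :=
  GRing.isZmodule.Build (quaternion R) quat_addA quat_addC quat_add0 quat_addN.

Fact quat_mulA : associative quat_mul.
Proof. by case=> ? ? ? ? [? ? ? ?] [? ? ? ?]; congr Quaternion => /=; ring. Qed.
Fact quat_mul1l : left_id (Quaternion 1 0 0 0) quat_mul.
Proof. by case=> ? ? ? ?; congr Quaternion => /=; ring. Qed.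
Fact quat_mul1r : right_id (Quaternion 1 0 0 0) quat_mul.
Proof. by case=> ? ? ? ?; congr Quaternion => /=; ring. Qed.
Fact quat_mulDl : left_distributive quat_mul quat_add.
Proof. by case=> ? ? ? ? [? ? ? ?] [? ? ? ?]; congr Quaternion => /=; ring. Qed.
Fact quat_mulDr : right_distributive quat_mul quat_add.
Proof. by case=> ? ? ? ? [? ? ? ?] [? ? ? ?]; congr Quaternion => /=; ring. Qed.
Fact quat_one_neq0 : Quaternion 1 0 0 0 != 0 :> quaternion R.
Proof. by apply/eqP => -[] /eqP; rewrite oner_eq0. Qed.

HB.instance Definition _ := GRing.Zmodule_isNzRing.Build (quaternion R)
  quat_mulA quat_mul1l quat_mul1r quat_mulDl quat_mulDr quat_one_neq0.

Definition conj_quat q : quaternion R :=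
  let: Quaternion a b c d := q in Quaternion a (- b) (- c) (- d).

Fact conj_quatM p q : conj_quat (p * q) = conj_quat q * conj_quat p.
Proof. by case: p q => ? ? ? ? [? ? ? ?]; congr Quaternion => /=; ring. Qed.
Fact conj_quatD p q : conj_quat (p + q) = conj_quat p + conj_quat q.
Proof. by case: p q => ? ? ? ? [? ? ? ?]; congr Quaternion => /=; ring. Qed.
Fact conj_quat0 : conj_quat 0 = 0.
Proof. by congr Quaternion => /=; ring. Qed.
Fact conj_quat1 : conj_quat 1 = 1.
Proof. by congr Quaternion => /=; ring. Qed.
Fact conj_quatK : involutive conj_quat.
Proof. by case=> ? ? ? ?; congr Quaternion => /=; ring. Qed.

Definition adj_quat m n (A : 'M[quaternion R]_(m, n)) :
    'M[quaternion R]_(n, m) :=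
  \matrix_(i, j) conj_quat (A j i).

Fact adj_quatM m n l (A : 'M_(m, n)) (B : 'M_(n, l)) :
  adj_quat (A *m B) = adj_quat B *m adj_quat A.
Proof.
apply/matrixP => i j; rewrite !mxE (big_morph conj_quat conj_quatD conj_quat0).
by apply: eq_bigr => k _; rewrite !mxE conj_quatM.
Qed.
Fact adj_quat1 n : adj_quat 1%:M = 1%:M :> 'M_n.
Proof.
apply/matrixP => i j; rewrite !mxE eq_sym.
by case: eqP => _; rewrite ?conj_quat1 ?conj_quat0.
Qed.
Fact adj_quatK m n : cancel (@adj_quat m n) (@adj_quat n m).
Proof. by move=> A; apply/matrixP => i j; rewrite !mxE conj_quatK. Qed.
End QuaternionRing.

(* Either equation in is_Sp implies the other; requiring both makes closure
   under adj_quat, which is the inverse, immediate. *)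
Section Sp.
Variables (R : realType) (n : nat).

Definition is_Sp (A : 'M[quaternion R]_n) : bool :=
  (adj_quat A *m A == 1%:M) && (A *m adj_quat A == 1%:M).

Record Sp : Type := MkSp { Sp_mx :> 'M[quaternion R]_n; _ : is_Sp Sp_mx }.
HB.instance Definition _ := [isSub for Sp_mx].
HB.instance Definition _ := [Choice of Sp by <:].

Fact is_Sp1 : is_Sp 1%:M.
Proof. by rewrite /is_Sp adj_quat1 mulmx1 eqxx. Qed.
Fact is_SpM (A B : Sp) : is_Sp (A *m B).
Proof.
case: A B => A /andP[/eqP A1 /eqP A2] [B /andP[/eqP B1 /eqP B2]] /=.
rewrite /is_Sp adj_quatM; apply/andP; split; apply/eqP.
  by rewrite mulmxA -(mulmxA (adj_quat B)) A1 mulmx1.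
by rewrite mulmxA -(mulmxA A) B2 mulmx1.
Qed.
Fact is_SpV (A : Sp) : is_Sp (adj_quat A).
Proof. by case: A => A /= hA; rewrite /is_Sp adj_quatK andbC. Qed.

Definition Sp_one : Sp := MkSp is_Sp1.
Definition Sp_mul (A B : Sp) : Sp := MkSp (is_SpM A B).
Definition Sp_inv (A : Sp) : Sp := MkSp (is_SpV A).

Fact Sp_mulA : associative Sp_mul.
Proof. by move=> A B C; apply/val_inj; rewrite /= mulmxA. Qed.
Fact Sp_mul1 : left_id Sp_one Sp_mul.
Proof. by move=> A; apply/val_inj; rewrite /= mul1mx. Qed.
Fact Sp_mulr1 : right_id Sp_one Sp_mul.
Proof. by move=> A; apply/val_inj; rewrite /= mulmx1. Qed.
Fact Sp_mulV : left_inverse Sp_one Sp_inv Sp_mul.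
Proof. by case=> A /[dup] /andP[/eqP hA _] ?; apply/val_inj. Qed.
Fact Sp_mulrV : right_inverse Sp_one Sp_inv Sp_mul.
Proof. by case=> A /[dup] /andP[_ /eqP hA] ?; apply/val_inj. Qed.

HB.instance Definition _ :=
  isGroup.Build Sp Sp_mulA Sp_mul1 Sp_mulr1 Sp_mulV Sp_mulrV.
End Sp.

Section SU.
Variables (R : realType) (n : nat).

Definition is_SU (A : 'M[R[i]]_n) : bool := (A \is unitarymx) && (\det A == 1).

Record SU : Type := MkSU { SU_mx :> 'M[R[i]]_n; _ : is_SU SU_mx }.
HB.instance Definition _ := [isSub for SU_mx].
HB.instance Definition _ := [Choice of SU by <:].

Fact is_SU1 : is_SU 1%:M.
Proof. by rewrite /is_SU det1 eqxx qualifE trmx1 map_mx1 mulmx1 eqxx. Qed.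
Fact is_SUM (A B : SU) : is_SU (A *m B).
Proof.
case: A B => A /andP[A1 /eqP A2] [B /andP[B1 /eqP B2]] /=.
by rewrite /is_SU mul_unitarymx // det_mulmx A2 B2 mulr1 eqxx.
Qed.
Fact is_SUV (A : SU) : is_SU (A^t*).
Proof.
case: A => A /andP[A1 /eqP A2] /=.
by rewrite /is_SU trmxC_unitary A1 det_map_mx det_tr A2 rmorph1 eqxx.
Qed.

Definition SU_one : SU := MkSU is_SU1.
Definition SU_mul (A B : SU) : SU := MkSU (is_SUM A B).
Definition SU_inv (A : SU) : SU := MkSU (is_SUV A).

Fact SU_mulA : associative SU_mul.
Proof. by move=> A B C; apply/val_inj; rewrite /= mulmxA. Qed.
Fact SU_mul1 : left_id SU_one SU_mul.
Proof. by move=> A; apply/val_inj; rewrite /= mul1mx. Qed.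
Fact SU_mulr1 : right_id SU_one SU_mul.
Proof. by move=> A; apply/val_inj; rewrite /= mulmx1. Qed.
Fact SU_mulrV : right_inverse SU_one SU_inv SU_mul.
Proof. by case=> A /[dup] /andP[/unitarymxP hA _] ?; apply/val_inj. Qed.
Fact SU_mulV : left_inverse SU_one SU_inv SU_mul.
Proof.
by case=> A /[dup] /andP[/unitarymxP hA _] ?; apply/val_inj/mulmx1C.
Qed.

HB.instance Definition _ :=
  isGroup.Build SU SU_mulA SU_mul1 SU_mulr1 SU_mulV SU_mulrV.
End SU.

Section SO.
Variables (R : realType) (n : nat).

Definition is_SO (A : 'M[R]_n) : bool := (A *m A^T == 1%:M) && (\det A == 1).

Record SO : Type := MkSO { SO_mx :> 'M[R]_n; _ : is_SO SO_mx }.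
HB.instance Definition _ := [isSub for SO_mx].
HB.instance Definition _ := [Choice of SO by <:].

Fact is_SO1 : is_SO 1%:M.
Proof. by rewrite /is_SO det1 trmx1 mulmx1 !eqxx. Qed.
Fact is_SOM (A B : SO) : is_SO (A *m B).
Proof.
case: A B => A /andP[/eqP A1 /eqP A2] [B /andP[/eqP B1 /eqP B2]] /=.
rewrite /is_SO det_mulmx A2 B2 mulr1 eqxx andbT trmx_mul.
by rewrite mulmxA -(mulmxA A) B1 mulmx1 A1.
Qed.
Fact is_SOV (A : SO) : is_SO (A^T).
Proof.
case: A => A /andP[/eqP A1 /eqP A2] /=.
by rewrite /is_SO det_tr A2 trmxK (mulmx1C A1) !eqxx.
Qed.

Definition SO_one : SO := MkSO is_SO1.
Definition SO_mul (A B : SO) : SO := MkSO (is_SOM A B).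
Definition SO_inv (A : SO) : SO := MkSO (is_SOV A).

Fact SO_mulA : associative SO_mul.
Proof. by move=> A B C; apply/val_inj; rewrite /= mulmxA. Qed.
Fact SO_mul1 : left_id SO_one SO_mul.
Proof. by move=> A; apply/val_inj; rewrite /= mul1mx. Qed.
Fact SO_mulr1 : right_id SO_one SO_mul.
Proof. by move=> A; apply/val_inj; rewrite /= mulmx1. Qed.
Fact SO_mulrV : right_inverse SO_one SO_inv SO_mul.
Proof. by case=> A /[dup] /andP[/eqP hA _] ?; apply/val_inj. Qed.
Fact SO_mulV : left_inverse SO_one SO_inv SO_mul.
Proof. by case=> A /[dup] /andP[/eqP hA _] ?; apply/val_inj/mulmx1C. Qed.

HB.instance Definition _ :=
  isGroup.Build SO SO_mulA SO_mul1 SO_mulr1 SO_mulV SO_mulrV.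
End SO.

(* A homomorphism Gamma -> G is represented by a function on the ambient group
   H, of which only the values on Gamma matter: two functions that agree on
   Gamma are conjugate (by 1), so when Gamma is a subgroup the classes below
   are in bijection with Hom(Gamma, G)/G. *)
Section HomClasses.
Local Open Scope group_scope.
Local Open Scope classical_set_scope.
Variables (H : groupType) (Gamma : {fset H}) (G : groupType).
Implicit Types f : H -> G.

Definition is_hom f : Prop :=
  {in Gamma &, forall x y : H, f (x * y) = f x * f y}.

Definition hom_conj f1 f2 : Prop :=
  exists g : G, {in Gamma, forall x : H, f2 x = g * f1 x * g^-1}.

Definition hom_class f : set (H -> G) := [set f' | is_hom f' /\ hom_conj f f'].

Definition hom_classes : set (set (H -> G)) := hom_class @` [set f | is_hom f].

(* This is 0 when there are infinitely many classes. *)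
Definition nb_hom : nat := #|` fset_set hom_classes|%fset.
End HomClasses.
Arguments hom_classes {H} Gamma G.
Arguments nb_hom {H} Gamma G.

(* Main.v *)
(* Both numbers count characters.  Let a structure of sign e = +1 (orthogonal) or
   e = -1 (symplectic) on a unitary representation be an intertwiner J with its
   conjugate such that J conj(J) = e.  Two representations with structures of the
   same sign are isometric as soon as they have the same character: a generic
   intertwiner can be made compatible with the structures, and its polar part is
   then an isometry.  A character sum_i m_i chi_i carries a structure of sign e if
   and only if m is invariant under duality and m_i is even whenever chi_i has
   sign -e.  Write m = c + 1_E, where c is even on self-dual characters and E is a
   set of irreducible characters of sign e; the part c is the same on both sides.
   In odd dimension, twisting by the r real linear characters reduces the
   condition det = 1 to a division by r, and the theorem becomes the identity
     F(X) - F(-X) = 2 r X G(X),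
   F and G being the products of 1 + X^(chi 1) over the orthogonal, respectively
   the symplectic, irreducible characters chi.
   Let Q be the tautological representation of Gamma in SU(2), and let Gamma be
   nonabelian, so that Q is irreducible.  If Q^2 contains a nontrivial linear
   character, its kernel is abelian of index 2, all degrees are at most 2, and the
   identity follows from the Frobenius-Schur count
     sum of the signed degrees = number of g with g^2 = 1,
   as it also does for abelian Gamma.  Otherwise one walks along the symmetric
   powers of Q in the McKay graph; the first reducible one has two constituents,
   and additivity of the degrees leaves only the three exceptional graphs. *)

(* The part c uses an even amount of the dimension and has determinant 1. So for each c separately
   the theorem compares sets E of orthogonal characters of total degree 2s+1 and determinant 1 with
   sets of symplectic characters of total degree 2s. This is the coefficient of X^(2s+1) in the
   identity. The factor r disappears because a real linear character l multiplies an odd-dimensional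
   determinant by l, so each orbit of twists contains exactly one set of determinant 1. Odd
   dimension matters once more for conjugacy: an isometry of determinant -1 becomes special after a
   change of sign, which conjugation does not see. Both target groups are realised as unitary
   matrices compatible with an antilinear map v -> J conj(v), so that one counting argument serves
   both. The spectral theorem and square roots of positive elements suffice for polar parts; no
   topology enters. Walking along the McKay graph requires the signs as well as the degrees. They
   propagate because a product with the symplectic Q reverses the sign, and a self-dual constituent
   of odd multiplicity must carry that reversed sign. *)
From HB Require Import structures.
Require Import Defs.
From mathcomp Require Import all_boot all_order all_algebra.
From mathcomp Require Import finmap classical_sets cardinality reals.
From mathcomp Require Import all_fingroup complex boolp zify ring.
From mathcomp Require mxtens.

Set Implicit Arguments.
Unset Strict Implicit.
Unset Printing Implicit Defensive.

Import Order.TTheory GRing.Theory Num.Theory.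

(** * Trees carrying the McKay relation *)

(* [d], [nb], [st] stand for the degrees, the neighbours (with multiplicity) in the
   McKay graph and the duality of the irreducible characters; [Re] and [Qu] select
   the orthogonal and the symplectic ones. *)
Section McKay.
Variables (I : finType) (d : I -> nat) (nb : I -> seq I) (st : I -> I).
Variables (Re Qu : pred I) (v0 q : I) (c : nat).

Hypothesis d_gt0 : forall i, 0 < d i.
Hypothesis d_v0 : d v0 = 1.
Hypothesis nb_sym : forall i j, count_mem j (nb i) = count_mem i (nb j).
Hypothesis nb_sum : forall i, sumn (map d (nb i)) = 2 * d i.
Hypothesis nb_v0 : perm_eq (nb v0) [:: q].
Hypothesis nb_conn : forall S : {pred I}, v0 \in S ->
  (forall i j, i \in S -> j \in nb i -> j \in S) -> forall i, i \in S.
Hypothesis st_d : forall i, d (st i) = d i.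
Hypothesis st_nb : forall i j, j \in nb i -> st j \in nb (st i).
Hypothesis stK : involutive st.
Hypothesis st_fix : forall i, (st i == i) = Re i || Qu i.
Hypothesis ReQu : forall i, Re i -> Qu i -> False.
Hypothesis Re_v0 : Re v0.
Hypothesis flipR : forall i j, Re i -> st j = j -> odd (count_mem j (nb i)) -> Qu j.
Hypothesis flipQ : forall i j, Qu i -> st j = j -> odd (count_mem j (nb i)) -> Re j.
Hypothesis fs_sum : \sum_(i | Re i) d i = \sum_(i | Qu i) d i + c.
Hypothesis c_gt0 : 0 < c.
Hypothesis no_lin : forall a, a \in nb q -> d a = 1 -> a = v0.

Definition nb_real_lin := #|[pred i | Re i && (d i == 1)]|.

Lemma nb_symm i j : (j \in nb i) = (i \in nb j).
Proof. by rewrite -!has_pred1 !has_count nb_sym. Qed.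

Lemma nb_count i j : count_mem j (nb i) * d j <= 2 * d i.
Proof.
rewrite -nb_sum; elim: (nb i) => //= x s IHs; rewrite mulnDl leq_add //.
by case: eqP => [->|_]; rewrite ?mul1n ?mul0n.
Qed.

Lemma nb_le i j : j \in nb i -> d j <= 2 * d i.
Proof.
move=> ji; apply: leq_trans (nb_count i j).
by rewrite leq_pmull // -has_count has_pred1.
Qed.

Lemma nb_peel i j : j \in nb i -> exists t, perm_eq (nb i) (j :: t) /\
  d j + sumn (map d t) = 2 * d i.
Proof.
move=> ji; exists (rem j (nb i)); have p := perm_to_rem ji; split=> //.
by have := perm_sumn (perm_map d p); rewrite nb_sum /= => ->.
Qed.

Lemma sumd0 t : sumn (map d t) = 0 -> t = [::].
Proof. by case: t => //= x t; have := d_gt0 x; lia. Qed.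

Lemma sumd1 t : sumn (map d t) = 1 -> exists2 l, t = [:: l] & d l = 1.
Proof.
case: t => //= l t; have := d_gt0 l => l0 e.
have t0 : sumn (map d t) = 0 by lia.
by exists l; [rewrite (sumd0 t0)|rewrite t0 in e; lia].
Qed.

Lemma sumd2 t : (forall z, z \in t -> 1 < d z) -> sumn (map d t) = 2 ->
  exists2 l, t = [:: l] & d l = 2.
Proof.
case: t => //= l t /(_ l (mem_head _ _)) l0 e.
have t0 : sumn (map d t) = 0 by lia.
by exists l; [rewrite (sumd0 t0)|rewrite t0 in e; lia].
Qed.

(** The neighbour [i] already exhausts the degree sum [2 * d l], and degrees are positive. *)
Lemma nb_leaf i l : l \in nb i -> 2 * d l = d i -> perm_eq (nb l) [:: i].
Proof.
rewrite nb_symm => /nb_peel[t [p e]] dl.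
by rewrite (sumd0 (t := t)) // in p; lia.
Qed.

Lemma st_Re i : Re i -> st i = i.
Proof. by move=> h; apply/eqP; rewrite st_fix h. Qed.
Lemma st_Qu i : Qu i -> st i = i.
Proof. by move=> h; apply/eqP; rewrite st_fix h orbT. Qed.

Lemma Re_Qu i : Re i -> Qu i = false.
Proof. by move=> h; apply/negP => /(ReQu h). Qed.
Lemma Qu_Re i : Qu i -> Re i = false.
Proof. by move=> h; apply/negP => /ReQu; apply. Qed.
Lemma st_neq i : st i != i -> (Re i = false) /\ (Qu i = false).
Proof. by rewrite st_fix negb_or => /andP[/negPf-> /negPf->]. Qed.

Local Open Scope ring_scope.

Definition realprod (A : comNzRingType) (x : A) := \prod_(i | Re i) (1 + x ^+ d i).
Definition quatprod (A : comNzRingType) (x : A) := \prod_(i | Qu i) (1 + x ^+ d i).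
(** Quantified over all commutative rings so that it can be evaluated at the indeterminate of
    [{poly int}], where comparing coefficients counts sets of characters. *)
Definition odd_part_identity := forall (A : comNzRingType) (x : A),
  realprod x - realprod (- x) = 2 * nb_real_lin%:R * x * quatprod x.

Local Close Scope ring_scope.

(** Once the graph is exhausted, [s] lists every vertex exactly once; sums and products over [I]
    then become explicit enough for [lia] and [ring]. *)
Lemma big_list (T : Type) (idx : T) (op : Monoid.com_law idx) (s : seq I)
  (P : pred I) (F : I -> T) : uniq s -> (forall i, i \in s) ->
  \big[op/idx]_(i | P i) F i = \big[op/idx]_(i <- s | P i) F i.
Proof.
move=> us sI; apply: perm_big; apply: uniq_perm => //; first exact: index_enum_uniq.
by move=> i; rewrite mem_index_enum sI.
Qed.

(* The characters [v 0], ..., [v k] of the first symmetric powers of [q]. *)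
Record chain (k : nat) (v : nat -> I) : Prop := Chain {
  chain0 : v 0 = v0;
  chain_d : forall j, j <= k -> d (v j) = j.+1;
  chain_Re : forall j, j <= k -> ~~ odd j -> Re (v j);
  chain_Qu : forall j, j <= k -> odd j -> Qu (v j);
  chain_nb0 : perm_eq (nb (v 0)) [:: v 1];
  chain_nb : forall j, 0 < j < k -> perm_eq (nb (v j)) [:: v j.-1; v j.+1] }.

Lemma chain_neq k v i j : chain k v -> i <= k -> j <= k -> i != j ->
  (v i == v j) = false.
Proof.
move=> h ik jk ij; apply/eqP => /(congr1 d).
by rewrite !(chain_d h) // => -[]; apply/eqP.
Qed.

Lemma neq_of_dim x y : d x != d y -> (x == y) = false.
Proof. by apply: contraNF => /eqP->. Qed.

Lemma perm_count (s t : seq I) x : perm_eq s t -> count_mem x s = count_mem x t.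
Proof. by move/seq.permP; apply. Qed.

Lemma chain_st k v j : chain k v -> j <= k -> st (v j) = v j.
Proof.
move=> h jk; case: (boolP (odd j)) => oj; first by rewrite st_Qu // (chain_Qu h).
by rewrite st_Re // (chain_Re h).
Qed.

Lemma q_nb_v0 : v0 \in nb q.
Proof. by rewrite nb_symm (perm_mem nb_v0) mem_head. Qed.

Lemma d_q : d q = 2.
Proof. by have := nb_sum v0; rewrite (perm_sumn (perm_map d nb_v0)) /= d_v0;
  lia. Qed.

(** The neighbours of [q] other than [v0] have total degree 3 and none is linear by [no_lin], so
    there is just one. Duality fixes it because of its degree, and the flip hypotheses give the
    signs. *)
Lemma chain_start : exists v, chain 2 v.
Proof.
have [t [p e]] := nb_peel q_nb_v0; rewrite d_v0 d_q in e.
have nv0 : v0 \notin t.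
  have := perm_count v0 p; rewrite nb_sym (perm_count _ nb_v0) /= !eqxx => h.
  by apply/count_memPn/esym; exact: (addnI h).
have d2 z : z \in t -> 1 < d z.
  move=> zt; rewrite ltn_neqAle d_gt0 andbT; apply/eqP => z1.
  case/negP: nv0; rewrite -(@no_lin z) //.
  by rewrite (perm_mem p) inE zt orbT.
have [x tE dx] : exists2 x, t = [:: x] & d x = 3.
  case: t p e nv0 d2 => [|x [|y t]] p e nv0 d2; first by [].
  - by exists x => //; move: e => /=; lia.
  - have := d2 x (mem_head _ _); have := d2 y; rewrite !inE eqxx orbT => /(_ isT).
    by move: e => /=; lia.
rewrite {}tE in p nv0 e d2 *.
have stq : st q = q.
  have := st_nb q_nb_v0; rewrite (st_Re Re_v0) nb_symm (perm_mem nb_v0) inE.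
  by move/eqP.
have Qq : Qu q.
  by apply: (flipR Re_v0) => //; rewrite (perm_count _ nb_v0) /= eqxx.
have xq : x \in nb q by rewrite (perm_mem p) !inE eqxx orbT.
have stx : st x = x.
  have := st_nb xq; rewrite stq (perm_mem p) !inE => /orP[/eqP h|/eqP//].
  by have := st_d x; rewrite h d_v0 dx.
have v0x : (v0 == x) = false by apply: neq_of_dim; rewrite d_v0 dx.
have Rx : Re x.
  by apply: (flipQ Qq) => //; rewrite (perm_count _ p) /= v0x eqxx.
exists (fun j => if j is 0 then v0 else if j is 1 then q else x); split=> //.
- by case=> [|[|[|]]] // _; rewrite ?d_v0 ?d_q ?dx.
- by case=> [|[|[|]]].
- by case=> [|[|[|]]].
- by case=> [|[|[|]]].
Qed.

(** * How a chain continues or splits at its end *)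

Section Branch.
Variables (k : nat) (v : nat -> I).
Hypotheses (k2 : 1 < k) (ch : chain k v).

Lemma chain_pred_nb : count_mem (v k.-1) (nb (v k)) = 1.
Proof.
have k1 : 0 < k.-1 < k by lia.
rewrite nb_sym (perm_count _ (chain_nb ch k1)) /=.
by rewrite prednK ?eqxx ?(chain_neq ch) //; lia.
Qed.

(** The degree left beside [v k.-1] is 2(k+1) - k = k+2, and every neighbour has at least half the
    degree k+1 of [v k]. As 3(k+1) > 2(k+2) for k > 1, at most two neighbours remain: the chain
    either continues or splits in two. *)
Lemma chain_peel : exists t, perm_eq (nb (v k)) (v k.-1 :: t) /\
  [/\ v k.-1 \notin t, sumn (map d t) = k.+2 & forall z, z \in t -> k.+1 <= 2 * d z].
Proof.
have h : v k.-1 \in nb (v k) by rewrite -has_pred1 has_count chain_pred_nb.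
have [t [p e]] := nb_peel h; exists t; split=> //; split.
- have := perm_count (v k.-1) p; rewrite chain_pred_nb /= eqxx => hc.
  by apply/count_memPn/esym; exact: (@addnI 1 _ _ hc).
- by move: e; rewrite !(chain_d ch) ?prednK //; lia.
- move=> z zt; rewrite -(chain_d ch (leqnn k)); apply: nb_le.
  by rewrite nb_symm (perm_mem p) inE zt orbT.
Qed.

(** Duality fixes [v k], permutes its neighbours and preserves degrees, hence fixes [x]; the simple
    edge then forces the opposite sign. *)
Lemma chain_extend x : perm_eq (nb (v k)) [:: v k.-1; x] -> d x = k.+2 ->
  exists v', chain k.+1 v'.
Proof.
move=> p dx; have xk : x \in nb (v k) by rewrite (perm_mem p) !inE eqxx orbT.
have vx : (v k.-1 == x) = false by apply: neq_of_dim; rewrite dx (chain_d ch); lia.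
have stx : st x = x.
  have := st_nb xk; rewrite (chain_st ch) // (perm_mem p) !inE.
  move=> /orP[/eqP h|/eqP//].
  by have := st_d x; rewrite h dx (chain_d ch); lia.
have cx : odd (count_mem x (nb (v k))) by rewrite (perm_count _ p) /= vx eqxx.
pose v' j := if j <= k then v j else x.
have v'E j : j <= k -> v' j = v j by rewrite /v' => ->.
have v'k : v' k.+1 = x by rewrite /v' ltnn.
exists v'; split.
- by rewrite v'E ?(chain0 ch).
- move=> j; rewrite leq_eqVlt => /orP[/eqP->|jk]; first by rewrite v'k.
  by rewrite v'E ?(chain_d ch).
- move=> j; rewrite leq_eqVlt => /orP[/eqP->|jk] oj; last first.
    by rewrite v'E ?(chain_Re ch).
  rewrite v'k; apply: (flipQ _ stx cx); apply: (chain_Qu ch) => //.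
  by move: oj; rewrite /= negbK.
- move=> j; rewrite leq_eqVlt => /orP[/eqP->|jk] oj; last first.
    by rewrite v'E ?(chain_Qu ch).
  by rewrite v'k; apply: (flipR _ stx cx); apply: (chain_Re ch).
- by rewrite !v'E ?(chain_nb0 ch) //; lia.
- move=> j /andP[j0]; rewrite ltnS leq_eqVlt => /orP[/eqP->|jk].
    by rewrite v'k !v'E ?leq_pred.
  by rewrite !v'E ?(chain_nb ch) //; lia.
Qed.

Section Split.
Variables x y : I.
Hypothesis nbk : perm_eq (nb (v k)) [:: v k.-1; x; y].
Hypothesis dxy : d x + d y = k.+2.
Hypothesis dx_ge : k.+1 <= 2 * d x.
Hypothesis dy_ge : k.+1 <= 2 * d y.

Lemma split_mem : (x \in nb (v k)) /\ (y \in nb (v k)).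
Proof. by rewrite !(perm_mem nbk) !inE !eqxx !orbT. Qed.

(** A double edge would give 2(k+1) <= 2 d(x) = k+2 by the degree bound at [x], which is impossible
    for k > 1. *)
Lemma split_xy : (x == y) = false.
Proof.
clear dx_ge dy_ge.
apply/eqP => xy; have := nb_count x (v k).
rewrite nb_sym (perm_count _ nbk) /= -xy eqxx (chain_d ch) //.
by move: dxy; rewrite -xy; case: eqP => _; lia.
Qed.

Lemma split_px : (v k.-1 == x) = false.
Proof.
clear dxy dx_ge dy_ge.
apply/eqP => vx; have := perm_count (v k.-1) nbk.
by rewrite chain_pred_nb /= vx eqxx; case: eqP; lia.
Qed.

Lemma split_py : (v k.-1 == y) = false.
Proof.
clear dxy dx_ge dy_ge.
apply/eqP => vx; have := perm_count (v k.-1) nbk.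
by rewrite chain_pred_nb /= vx eqxx; case: eqP; lia.
Qed.

Lemma nb_split_x : exists t, perm_eq (nb x) (v k :: t) /\
  k.+1 + sumn (map d t) = 2 * d x.
Proof.
have [xk _] := split_mem; rewrite nb_symm in xk.
have [t [p e]] := nb_peel xk; exists t; split=> //.
by rewrite -e (chain_d ch).
Qed.

Lemma nb_split_y : exists t, perm_eq (nb y) (v k :: t) /\
  k.+1 + sumn (map d t) = 2 * d y.
Proof.
have [_ xk] := split_mem; rewrite nb_symm in xk.
have [t [p e]] := nb_peel xk; exists t; split=> //.
by rewrite -e (chain_d ch).
Qed.

Lemma split_Re z : ~~ odd k -> st z = z -> z \in [:: x; y] -> Qu z.
Proof.
move=> ok stz zxy; apply: (@flipR (v k)) => //; first exact: (chain_Re ch).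
rewrite (perm_count _ nbk); move: zxy; rewrite !inE => /orP[] /eqP->.
  by rewrite /= split_px eqxx eq_sym split_xy.
by rewrite /= split_py eqxx split_xy.
Qed.

Lemma split_Qu z : odd k -> st z = z -> z \in [:: x; y] -> Re z.
Proof.
move=> ok stz zxy; apply: (@flipQ (v k)) => //; first exact: (chain_Qu ch).
rewrite (perm_count _ nbk); move: zxy; rewrite !inE => /orP[] /eqP->.
  by rewrite /= split_px eqxx eq_sym split_xy.
by rewrite /= split_py eqxx split_xy.
Qed.

Lemma split_st z : z \in [:: x; y] -> st z \in [:: x; y].
Proof.
move=> zxy; have zk : z \in nb (v k) by rewrite (perm_mem nbk) inE zxy orbT.
have := st_nb zk; rewrite (chain_st ch) // (perm_mem nbk) inE => /orP[/eqP h|//].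
have zv : z = v k.-1 by rewrite -[z]stK h (chain_st ch) // leq_pred.
by move: zxy; rewrite zv !inE split_px split_py.
Qed.

(** The sum k+2 and the two lower bounds leave only 2 d(x) = k+1 when the degrees differ. Duality
    permutes [x] and [y] and preserves degrees, so it fixes both. *)
Lemma split_E7E8 : d x < d y -> [/\ st x = x, st y = y & 2 * d x = k.+1].
Proof.
move=> lxy; split; last by lia.
  have := split_st (mem_head x _); rewrite !inE => /orP[/eqP//|/eqP h].
  by have := st_d x; rewrite h; lia.
have := @split_st y; rewrite !inE eqxx orbT => /(_ isT)/orP[/eqP h|/eqP//].
by have := st_d y; rewrite h; lia.
Qed.

End Split.
End Branch.

(** * The three exceptional graphs: affine E6, E7 and E8 *)

Lemma case_E6 v x y : chain 2 v -> perm_eq (nb (v 2)) [:: v 1; x; y] ->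
  d x = 2 -> d y = 2 -> odd_part_identity.
Proof.
move=> ch nb2 dx dy; have k2 : 1 < 2 by [].
have dxy : d x + d y = 4 by rewrite dx dy.
have gx : 3 <= 2 * d x by rewrite dx.
have gy : 3 <= 2 * d y by rewrite dy.
have xy := split_xy k2 ch nb2 dxy.
have vx := split_px k2 ch nb2; have vy := split_py k2 ch nb2.
have [tx [px ex]] := nb_split_x ch nb2; have [ty [py ey]] := nb_split_y ch nb2.
have [l tl dl] : exists2 l, tx = [:: l] & d l = 1.
  by apply: sumd1; move: ex; rewrite dx; clear; lia.
have [m tm dm] : exists2 m, ty = [:: m] & d m = 1.
  by apply: sumd1; move: ey; rewrite dy; clear; lia.
rewrite {}tl {}tm {ex ey} in px py.
have pl : perm_eq (nb l) [:: x].
  by apply: nb_leaf; rewrite ?(perm_mem px) ?inE ?inE ?eqxx ?orbT // dl dx.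
have pm : perm_eq (nb m) [:: y].
  by apply: nb_leaf; rewrite ?(perm_mem py) ?inE ?inE ?eqxx ?orbT // dm dy.
have lm : (l == m) = false.
  apply/eqP=> lm; have := perm_mem pl y.
  by rewrite lm (perm_mem pm) !inE eqxx eq_sym xy.
have v0E := chain0 ch.
have v0l : (v0 == l) = false.
  apply/eqP=> h; have := perm_mem pl (v 1).
  by rewrite -h -v0E (perm_mem (chain_nb0 ch)) !inE eqxx vx.
have v0m : (v0 == m) = false.
  apply/eqP=> h; have := perm_mem pm (v 1).
  by rewrite -h -v0E (perm_mem (chain_nb0 ch)) !inE eqxx vy.
pose s := [:: v0; v 1; v 2; x; y; l; m].
have sI i : i \in s.
  apply: nb_conn => [|{}i j]; first by rewrite inE eqxx.
  rewrite !inE -v0E => is_ ji; move: is_ ji.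
  case/or4P=> [|||/or4P[]] /eqP->;
   rewrite ?(perm_mem (chain_nb0 ch)) ?(perm_mem (chain_nb ch (isT : 0 < 1 < 2)))
     ?(perm_mem nb2) ?(perm_mem px) ?(perm_mem py) ?(perm_mem pl) ?(perm_mem pm);
   rewrite !inE v0E /=; do ?[case/orP] => /eqP->; rewrite eqxx ?orbT //.
have us : uniq s.
  rewrite /s /= !inE !negb_or -v0E !(chain_neq ch) // lm xy.
  have dv := chain_d ch; rewrite v0E.
  by rewrite ?v0l ?v0m ?vx ?vy !neq_of_dim // ?dx ?dy ?dl ?dm ?d_v0 ?dv.
have Rv2 : Re (v 2) by apply: (chain_Re ch).
have Qv1 : Qu (v 1) by apply: (chain_Qu ch).
have lx : l \in nb x by rewrite (perm_mem px) !inE eqxx orbT.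
have my : m \in nb y by rewrite (perm_mem py) !inE eqxx orbT.
have v2l : (v 2 == l) = false by apply: neq_of_dim; rewrite dl (chain_d ch).
have v2m : (v 2 == m) = false by apply: neq_of_dim; rewrite dm (chain_d ch).
have RP (T : Type) (idx : T) (op : Monoid.com_law idx) (P : pred I) (F : I -> T) :=
  @big_list T idx op s P F us sI.
(* If duality fixed [x] and [y], all seven characters would have a sign: degrees 1, 3, 1, 1
   orthogonal and 2, 2, 2 symplectic. Both sums would be 6, against [c_gt0]. So the two branches are
   exchanged, and only [v 0], [v 1], [v 2] carry a sign. *)
have stxy : st x = y.
  have := split_st k2 ch nb2 (mem_head x _); rewrite !inE => /orP[/eqP stx|/eqP//].
  have sty : st y = y.
    have := @split_st _ _ k2 ch x y nb2 y; rewrite !inE eqxx orbT => /(_ isT).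
    case/orP=> /eqP // h; have yx : y = x by rewrite -[y]stK h stx.
    by rewrite yx eqxx in xy.
  have Qx : Qu x by apply: (split_Re k2 ch nb2 dxy) => //; rewrite !inE eqxx.
  have Qy : Qu y by apply: (split_Re k2 ch nb2 dxy) => //; rewrite !inE eqxx orbT.
  have stl : st l = l.
    have := st_nb lx; rewrite stx (perm_mem px) !inE => /orP[/eqP h|/eqP//].
    by have := st_d l; rewrite h dl (chain_d ch).
  have stm : st m = m.
    have := st_nb my; rewrite sty (perm_mem py) !inE => /orP[/eqP h|/eqP//].
    by have := st_d m; rewrite h dm (chain_d ch).
  have Rl : Re l.
    by apply: (flipQ Qx stl); rewrite (perm_count _ px) /= v2l eqxx.
  have Rm : Re m.
    by apply: (flipQ Qy stm); rewrite (perm_count _ py) /= v2m eqxx.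
  move: fs_sum; rewrite !RP /s !big_cons !big_nil Re_v0 Rv2 Rl Rm Qv1 Qx Qy.
  rewrite (Re_Qu Re_v0) (Re_Qu Rv2) (Re_Qu Rl) (Re_Qu Rm) (Qu_Re Qv1).
  rewrite (Qu_Re Qx) (Qu_Re Qy) d_v0 dx dy dl dm !(chain_d ch) //.
  by move=> /= h; have := c_gt0; move: h; clear; lia.
have styx : st y = x by rewrite -stxy stK.
have stlm : st l = m.
  have := st_nb lx; rewrite stxy (perm_mem py) !inE => /orP[/eqP h|/eqP//].
  by have := st_d l; rewrite h dl (chain_d ch).
have stml : st m = l by rewrite -stlm stK.
have [Rx Qx] : (Re x = false) /\ (Qu x = false).
  by apply: st_neq; rewrite stxy eq_sym xy.
have [Ry Qy] : (Re y = false) /\ (Qu y = false).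
  by apply: st_neq; rewrite styx xy.
have [Rl Ql] : (Re l = false) /\ (Qu l = false).
  by apply: st_neq; rewrite stlm eq_sym lm.
have [Rm Qm] : (Re m = false) /\ (Qu m = false).
  by apply: st_neq; rewrite stml lm.
have rE : nb_real_lin = 1.
  rewrite /nb_real_lin -sum1_card RP /s !big_cons big_nil !inE.
  by rewrite Re_v0 (Qu_Re Qv1) Rv2 Rx Ry Rl Rm d_v0 !(chain_d ch).
(* The identity is (1 + z)(1 + z^3) - (1 - z)(1 - z^3) = 2 z (1 + z^2). *)
move=> A z; rewrite rE /realprod /quatprod !RP /s !big_cons !big_nil.
rewrite Re_v0 (Qu_Re Qv1) Rv2 Rx Ry Rl Rm (Re_Qu Re_v0) (Re_Qu Rv2) Qv1 Qx Qy Ql Qm.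
rewrite d_v0 !(chain_d ch) //=; ring.
Qed.

Section E78.
Variables (k : nat) (v : nat -> I) (x y : I).
Hypotheses (k3 : 2 < k) (ch : chain k v).
Hypothesis nbk : perm_eq (nb (v k)) [:: v k.-1; x; y].
Hypothesis dxy : d x + d y = k.+2.
Hypothesis dx_ge : k.+1 <= 2 * d x.
Hypothesis dy_ge : k.+1 <= 2 * d y.
Hypothesis lxy : d x < d y.

(** From 2 d(x) = k+1 it follows that k is odd and that [x] is a leaf. The degree left at [y] is 2
    d(y) - (k+1) = 2; a linear neighbour would force d(y) <= 2, whereas d(y) >= 3 here, so it
    belongs to a single vertex. *)
Lemma split_E78 : odd k /\ exists z, [/\ perm_eq (nb x) [:: v k],
   perm_eq (nb y) [:: v k; z], d z = 2, st z = z & Qu z].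
Proof.
have k2 : 1 < k by lia.
have [stx sty e] := split_E7E8 k2 ch nbk dxy dx_ge dy_ge lxy.
have xk : x \in nb (v k) by rewrite (perm_mem nbk) !inE eqxx orbT.
have ok : odd k by have := oddS k; rewrite -e mul2n odd_double; case: odd.
split=> //.
have [ty [py ey]] := nb_split_y ch nbk.
have [z tz dz] : exists2 z, ty = [:: z] & d z = 2.
  apply: sumd2; last by lia.
  move=> z zt; have zy : z \in nb y by rewrite (perm_mem py) inE zt orbT.
  by rewrite nb_symm in zy; have := nb_le zy; lia.
rewrite tz in py; exists z.
have Ry : Re y by apply: (split_Qu k2 ch nbk dxy) => //; rewrite !inE eqxx orbT.
have zy : z \in nb y by rewrite (perm_mem py) !inE eqxx orbT.
have vz : (v k == z) = false by apply: neq_of_dim; rewrite (chain_d ch) // dz; lia.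
have stz : st z = z.
  have := st_nb zy; rewrite sty (perm_mem py) !inE => /orP[/eqP h|/eqP//].
  by have := st_d z; rewrite h dz (chain_d ch) //; move: k3; clear; lia.
split=> //.
  by apply: (nb_leaf xk); rewrite (chain_d ch).
by apply: (flipR Ry stz); rewrite (perm_count _ py) /= vz eqxx.
Qed.

End E78.

(** The graph of the binary octahedral group: orthogonal degrees 1, 3, 2, 3, 1 and symplectic
    degrees 2, 4, 2, with the two real linear characters [v 0] and [w]. *)
Lemma case_E7 v x y : chain 3 v -> perm_eq (nb (v 3)) [:: v 2; x; y] ->
  d x = 2 -> d y = 3 -> odd_part_identity.
Proof.
move=> ch nb3 dx dy; have k2 : 1 < 3 by []; have k3 : 2 < 3 by [].
have dxy : d x + d y = 5 by rewrite dx dy.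
have gx : 4 <= 2 * d x by rewrite dx.
have gy : 4 <= 2 * d y by rewrite dy.
have lxy : d x < d y by rewrite dx dy.
have [stx sty _] := split_E7E8 k2 ch nb3 dxy gx gy lxy.
have [_ [z [px py dz stz Qz]]] := split_E78 k3 ch nb3 dxy gx gy lxy.
have Rx : Re x by apply: (split_Qu k2 ch nb3 dxy) => //; rewrite !inE eqxx.
have Ry : Re y by apply: (split_Qu k2 ch nb3 dxy) => //; rewrite !inE eqxx orbT.
have vy := split_py k2 ch nb3.
have yz : y \in nb z by rewrite nb_symm (perm_mem py) !inE eqxx orbT.
have [t [pz ez]] := nb_peel yz.
have [w tw dw] : exists2 w, t = [:: w] & d w = 1.
  by apply: sumd1; move: ez; rewrite dy dz; clear; lia.
rewrite {}tw {ez} in pz.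
have wz : w \in nb z by rewrite (perm_mem pz) !inE eqxx orbT.
have pw : perm_eq (nb w) [:: z] by apply: (nb_leaf wz); rewrite dw dz.
have yw : (y == w) = false by apply: neq_of_dim; rewrite dy dw.
have stw : st w = w.
  have := st_nb wz; rewrite stz (perm_mem pz) !inE => /orP[/eqP h|/eqP//].
  by have := st_d w; rewrite h dw dy.
have Rw : Re w by apply: (flipQ Qz stw); rewrite (perm_count _ pz) /= yw eqxx.
have v0E := chain0 ch; have dv := chain_d ch.
have x3 : x \in nb (v 3) by rewrite (perm_mem nb3) !inE eqxx orbT.
have v1x : (v 1 == x) = false.
  apply/eqP=> h; move: x3; rewrite nb_symm -h (perm_mem (chain_nb ch (isT :
    0 < 1 < 3))).
  by rewrite !inE !(chain_neq ch).
have v1z : (v 1 == z) = false.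
  apply/eqP=> h; move: yz; rewrite -h (perm_mem (chain_nb ch (isT : 0 < 1 < 3))).
  by rewrite !inE orbC eq_sym vy /= neq_of_dim // dy dv.
have xz : (x == z) = false.
  apply/eqP=> h; move: yz; rewrite -h (perm_mem px) inE.
  by rewrite neq_of_dim // dy dv.
have v0w : (v 0 == w) = false.
  apply/eqP=> h; have := perm_mem pw (v 1).
  by rewrite -h (perm_mem (chain_nb0 ch)) !inE eqxx v1z.
pose s := [:: v 0; v 1; v 2; v 3; x; y; z; w].
have sI i : i \in s.
  apply: nb_conn => [|{}i j]; first by rewrite inE v0E eqxx.
  rewrite !inE => is_ ji; move: is_ ji.
  case/or4P=> [|||/or4P[|||/orP[]]] /eqP->;
   rewrite ?(perm_mem (chain_nb0 ch)) ?(perm_mem (chain_nb ch (isT : 0 < 1 < 3)))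
     ?(perm_mem (chain_nb ch (isT : 0 < 2 < 3)))
     ?(perm_mem nb3) ?(perm_mem px) ?(perm_mem py) ?(perm_mem pz) ?(perm_mem pw);
   rewrite !inE /=; do ?[case/orP] => /eqP->; rewrite eqxx ?orbT //.
have us : uniq s.
  rewrite /s /= !inE !negb_or !(chain_neq ch) //.
  by rewrite v1x v1z xz v0w vy yw !neq_of_dim // ?dx ?dy ?dz ?dw ?dv.
have RP (T : Type) (idx : T) (op : Monoid.com_law idx) (P : pred I) (F : I -> T) :=
  @big_list T idx op s P F us sI.
have R0 : Re (v 0) by apply: (chain_Re ch).
have R2 : Re (v 2) by apply: (chain_Re ch).
have Q1 : Qu (v 1) by apply: (chain_Qu ch).
have Q3 : Qu (v 3) by apply: (chain_Qu ch).
have rE : nb_real_lin = 2.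
  rewrite /nb_real_lin -sum1_card RP /s !big_cons big_nil !inE.
  by rewrite R0 R2 (Qu_Re Q1) (Qu_Re Q3) Rx Ry (Qu_Re Qz) Rw dx dy dw !dv.
move=> A a; rewrite rE /realprod /quatprod !RP /s !big_cons !big_nil.
rewrite R0 R2 (Qu_Re Q1) (Qu_Re Q3) Rx Ry (Qu_Re Qz) Rw.
rewrite (Re_Qu R0) (Re_Qu R2) Q1 Q3 (Re_Qu Rx) (Re_Qu Ry) Qz (Re_Qu Rw).
rewrite dx dy dz dw !dv //=; ring.
Qed.

(** The graph of the binary icosahedral group: orthogonal degrees 1, 3, 5, 3, 4 and symplectic
    degrees 2, 4, 6, 2; only [v 0] is linear. *)
Lemma case_E8 v x y : chain 5 v -> perm_eq (nb (v 5)) [:: v 4; x; y] ->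
  d x = 3 -> d y = 4 -> odd_part_identity.
Proof.
move=> ch nb5 dx dy; have k2 : 1 < 5 by []; have k3 : 2 < 5 by [].
have dxy : d x + d y = 7 by rewrite dx dy.
have gx : 6 <= 2 * d x by rewrite dx.
have gy : 6 <= 2 * d y by rewrite dy.
have lxy : d x < d y by rewrite dx dy.
have [stx sty _] := split_E7E8 k2 ch nb5 dxy gx gy lxy.
have [_ [z [px py dz stz Qz]]] := split_E78 k3 ch nb5 dxy gx gy lxy.
have Rx : Re x by apply: (split_Qu k2 ch nb5 dxy) => //; rewrite !inE eqxx.
have Ry : Re y by apply: (split_Qu k2 ch nb5 dxy) => //; rewrite !inE eqxx orbT.
have yz : y \in nb z by rewrite nb_symm (perm_mem py) !inE eqxx orbT.
have pz : perm_eq (nb z) [:: y].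
  by apply: (@nb_leaf y z); rewrite ?dz ?dy // nb_symm.
have dv := chain_d ch; have v0E := chain0 ch.
have nb1 := chain_nb ch (isT : 0 < 1 < 5); have nb2 := chain_nb ch (isT : 0 < 2 < 5).
have nb3 := chain_nb ch (isT : 0 < 3 < 5); have nb4 := chain_nb ch (isT : 0 < 4 < 5).
have [x5 y5] := @split_mem 5 v x y nb5.
have v2x : (v 2 == x) = false.
  apply/eqP=> h; move: x5; rewrite nb_symm -h (perm_mem nb2).
  by rewrite !inE !(chain_neq ch).
have v3y : (v 3 == y) = false.
  apply/eqP=> h; move: y5; rewrite nb_symm -h (perm_mem nb3).
  by rewrite !inE !(chain_neq ch).
have v1z : (v 1 == z) = false.
  apply/eqP=> h; move: yz; rewrite -h (perm_mem nb1).
  by rewrite !inE !neq_of_dim // dy dv.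
pose s := [:: v 0; v 1; v 2; v 3; v 4; v 5; x; y; z].
have sI i : i \in s.
  apply: nb_conn => [|{}i j]; first by rewrite inE v0E eqxx.
  rewrite !inE => is_ ji; move: is_ ji.
  case/or4P=> [|||/or4P[|||/or3P[]]] /eqP->;
   rewrite ?(perm_mem (chain_nb0 ch)) ?(perm_mem nb1) ?(perm_mem nb2)
     ?(perm_mem nb3) ?(perm_mem nb4) ?(perm_mem nb5) ?(perm_mem px)
     ?(perm_mem py) ?(perm_mem pz);
   rewrite !inE /=; do ?[case/orP] => /eqP->; rewrite eqxx ?orbT //.
have us : uniq s.
  rewrite /s /= !inE !negb_or !(chain_neq ch) //.
  by rewrite v2x v3y v1z !neq_of_dim // ?dx ?dy ?dz ?dv.
have RP (T : Type) (idx : T) (op : Monoid.com_law idx) (P : pred I) (F : I -> T) :=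
  @big_list T idx op s P F us sI.
have R0 : Re (v 0) by apply: (chain_Re ch).
have R2 : Re (v 2) by apply: (chain_Re ch).
have R4 : Re (v 4) by apply: (chain_Re ch).
have Q1 : Qu (v 1) by apply: (chain_Qu ch).
have Q3 : Qu (v 3) by apply: (chain_Qu ch).
have Q5 : Qu (v 5) by apply: (chain_Qu ch).
have rE : nb_real_lin = 1.
  rewrite /nb_real_lin -sum1_card RP /s !big_cons big_nil !inE.
  by rewrite R0 R2 R4 (Qu_Re Q1) (Qu_Re Q3) (Qu_Re Q5) Rx Ry (Qu_Re Qz) dx dy !dv.
move=> A a; rewrite rE /realprod /quatprod !RP /s !big_cons !big_nil.
rewrite R0 R2 R4 (Qu_Re Q1) (Qu_Re Q3) (Qu_Re Q5) Rx Ry (Qu_Re Qz).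
rewrite (Re_Qu R0) (Re_Qu R2) (Re_Qu R4) Q1 Q3 Q5 (Re_Qu Rx) (Re_Qu Ry) Qz.
rewrite dx dy dz !dv //=; ring.
Qed.

(** If the degrees agree, the degree left at [x] is 1, and this linear neighbour bounds d(x) by 2,
    whence k = 2. Otherwise d(y) = (k+3)/2 is at most 2 d(z) = 4 with k odd, so that k is 3 or 5. *)
Lemma chain_split_odd_part k v x y : 1 < k -> chain k v ->
  perm_eq (nb (v k)) [:: v k.-1; x; y] -> d x + d y = k.+2 ->
  k.+1 <= 2 * d x -> k.+1 <= 2 * d y -> d x <= d y -> odd_part_identity.
Proof.
move=> k2 ch nbk dxy gx gy; rewrite leq_eqVlt => /orP[/eqP exy|lxy].
  have kE : k = 2.
    have [tx [px ex]] := nb_split_x ch nbk.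
    have [l tl dl] : exists2 l, tx = [:: l] & d l = 1 by apply: sumd1; lia.
    rewrite tl in px; have lx : l \in nb x by rewrite (perm_mem px) !inE eqxx orbT.
    by rewrite nb_symm in lx; have := nb_le lx; lia.
  by subst k; apply: (case_E6 ch nbk); move: dxy exy; clear; lia.
have [_ _ e] := split_E7E8 k2 ch nbk dxy gx gy lxy.
have k3 : 2 < k by lia.
have [ok [z [px py dz stz Qz]]] := split_E78 k3 ch nbk dxy gx gy lxy.
have yz : y \in nb z by rewrite nb_symm (perm_mem py) !inE eqxx orbT.
have := nb_le yz => dyz.
have [kE|kE] : k = 3 \/ k = 5.
  by move: dxy e dyz ok dz k3; clear; lia.
  by subst k; apply: (case_E7 ch nbk); move: dxy e; clear; lia.
by subst k; apply: (case_E8 ch nbk); move: dxy e; clear; lia.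
Qed.

Lemma chain_bound k v : chain k v -> k < \max_i d i.
Proof. by move=> ch; rewrite -(chain_d ch (leqnn k)) leq_bigmax. Qed.

(** Induction on how far the chain can still grow: [d (v k) = k.+1] is bounded by the largest
    degree, so some chain splits. *)
Theorem mckay_odd_part : odd_part_identity.
Proof.
suff main m : forall k v, 1 < k -> chain k v -> \max_i d i - k < m ->
  odd_part_identity.
  by have [v ch] := chain_start; apply: (main _ 2 v) => //; exact: ltnSn.
elim: m => // m IHm k v k2 ch km.
have [t [p [vt e gt]]] := chain_peel k2 ch.
case: t p vt e gt => [|x [|y t]] p vt e gt; first by move: e.
- have dx : d x = k.+2 by move: e => /=; lia.
  have [v' ch'] := chain_extend k2 ch p dx.
  apply: (IHm k.+1 v') => //; first exact: leqW.
  by move: (chain_bound ch') km; clear; lia.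
- have gx := gt x (mem_head _ _).
  have gy : k.+1 <= 2 * d y by apply: gt; rewrite !inE eqxx orbT.
  case: t p vt e gt => [|z t] p vt e gt; last first.
    have gz : k.+1 <= 2 * d z by apply: gt; rewrite !inE eqxx !orbT.
    by move: e => /=; lia.
  have dxy : d x + d y = k.+2 by move: e => /=; lia.
  have [le|le] := leqP (d x) (d y); first exact: (chain_split_odd_part k2 ch p).
  apply: (chain_split_odd_part (x := y) (y := x) k2 ch) => //; try lia.
  by rewrite (perm_trans p) // perm_cons; apply/permPl/(perm_catC [:: x] [:: y]).
Qed.

End McKay.

Local Open Scope ring_scope.

(** * Hermitian matrices *)

Local Notation "A ^cj" := (map_mx Num.conj A) (at level 2, format "A ^cj").
Local Notation "A ^h" := ((A^T)^cj) (at level 2, format "A ^h").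

Section Matrices.
Variable C : numClosedFieldType.

Lemma conjmxM m n p (A : 'M[C]_(m, n)) (B : 'M_(n, p)) :
  (A *m B)^cj = A^cj *m B^cj.
Proof. exact: map_mxM. Qed.
Lemma conjmxK m n (A : 'M[C]_(m, n)) : A^cj^cj = A.
Proof. by apply/matrixP=> i j; rewrite !mxE conjCK. Qed.
Lemma adjmxE m n (A : 'M[C]_(m, n)) : A^h = A^cj^T.
Proof. by rewrite map_trmx. Qed.
Lemma adjmxM m n p (A : 'M[C]_(m, n)) (B : 'M_(n, p)) : (A *m B)^h = B^h *m A^h.
Proof. by rewrite trmx_mul conjmxM. Qed.
Lemma adjmxK m n (A : 'M[C]_(m, n)) : A^h^h = A.
Proof. by rewrite -map_trmx conjmxK trmxK. Qed.
Lemma adjmx1 n : (1%:M : 'M[C]_n)^h = 1%:M.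
Proof. by rewrite trmx1 map_mx1. Qed.
Lemma conjmx1 n : (1%:M : 'M[C]_n)^cj = 1%:M.
Proof. exact: map_mx1. Qed.
Lemma adjmxD m n (A B : 'M[C]_(m, n)) : (A + B)^h = A^h + B^h.
Proof. by rewrite linearD map_mxD. Qed.
Lemma adjmxZ m n a (A : 'M[C]_(m, n)) : (a *: A)^h = a^* *: A^h.
Proof. by rewrite linearZ map_mxZ. Qed.

Lemma herm_sq_eq0 m n (A : 'M[C]_(m, n)) : A^h *m A = 0 -> A = 0.
Proof.
move=> A0; apply/matrixP=> i j; rewrite mxE.
have /matrixP/(_ j j) := A0; rewrite !mxE => /eqP.
under eq_bigr do rewrite !mxE mulrC -normCK.
rewrite psumr_eq0; last by move=> k _; rewrite exprn_ge0.
by move/allP/(_ i (mem_index_enum i)); rewrite sqrf_eq0 normr_eq0 => /eqP.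
Qed.

(* Functional calculus on the normal matrix with unitary eigenbasis [V] and
   eigenvalues [d]. *)
Definition diagf n (V : 'M[C]_n) (d : 'rV[C]_n) (f : C -> C) : 'M_n :=
  V^h *m diag_mx (map_mx f d) *m V.

(** In the eigenbases the hypothesis says that the entries of [Y] satisfy d_i Y_ij = Y_ij e_j. Hence
    d_i = e_j wherever Y_ij is nonzero, and [f] may be applied to both. *)
Lemma diagf_comm m n (V : 'M[C]_m) (W : 'M_n) d e (f : C -> C) (X : 'M_(m, n)) :
  V *m V^h = 1%:M -> W *m W^h = 1%:M ->
  diagf V d id *m X = X *m diagf W e id ->
  diagf V d f *m X = X *m diagf W e f.
Proof.
move=> V1 W1 HX; have V2 := mulmx1C V1; have W2 := mulmx1C W1.
have [Y YE] : {Y | Y = V *m X *m W^h} by exists (V *m X *m W^h).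
have XE : X = V^h *m Y *m W.
  by rewrite YE !mulmxA V2 mul1mx -mulmxA W2 mulmx1.
have fE (g : C -> C) : (diagf V d g *m X = X *m diagf W e g) <->
   (diag_mx (map_mx g d) *m Y = Y *m diag_mx (map_mx g e)).
  split=> [|gY].
    rewrite YE /diagf => /(congr1 (fun Z => V *m Z *m W^h)).
    by rewrite !mulmxA V1 mul1mx -(mulmxA _ W W^h) W1 mulmx1.
  rewrite XE /diagf !mulmxA -(mulmxA _ V V^h) V1 mulmx1.
  rewrite -(mulmxA _ W W^h) W1 mulmx1 -(mulmxA V^h _ Y) gY.
  by rewrite !mulmxA.
apply/fE; move/fE: HX => /matrixP H; apply/matrixP=> i j.
have := H i j; rewrite !mul_diag_mx !mul_mx_diag !mxE.
have [->|/eqP nz /eqP] := eqVneq (Y i j) 0; first by rewrite !mulr0 !mul0r.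
rewrite mulrC -subr_eq0 -mulrBr mulf_eq0 => /orP[/eqP//|].
by rewrite subr_eq0 => /eqP->; rewrite mulrC.
Qed.

Lemma diagfM n (V : 'M[C]_n) (d : 'rV[C]_n) (f g : C -> C) : V *m V^h = 1%:M ->
  diagf V d f *m diagf V d g = diagf V d (fun x => f x * g x).
Proof.
move=> V1; rewrite /diagf !mulmxA -(mulmxA _ V V^h) V1 mulmx1.
rewrite -(mulmxA V^h) mulmx_diag.
by congr (_ *m diag_mx _ *m _); apply/rowP=> j; rewrite !mxE.
Qed.

Lemma diagf_adj n (V : 'M[C]_n) (d : 'rV[C]_n) (f : C -> C) :
  (diagf V d f)^h = diagf V d (fun x => (f x)^*).
Proof.
rewrite /diagf !adjmxM adjmxK mulmxA tr_diag_mx map_diag_mx.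
by congr (_ *m diag_mx _ *m _); apply/rowP=> j; rewrite !mxE.
Qed.

Lemma diagf_conj n (V : 'M[C]_n) (d : 'rV[C]_n) (f : C -> C) :
  (diagf V d f)^cj = diagf V^cj d (fun x => (f x)^*).
Proof.
rewrite /diagf !conjmxM adjmxE map_diag_mx.
rewrite map_trmx; congr (_ *m diag_mx _ *m _).
by apply/rowP=> j; rewrite !mxE.
Qed.

Lemma eq_diagf n (V : 'M[C]_n) (d : 'rV[C]_n) (f g : C -> C) :
  (forall i, f (d 0 i) = g (d 0 i)) -> diagf V d f = diagf V d g.
Proof.
by move=> fg; congr (_ *m diag_mx _ *m _); apply/rowP=> j; rewrite !mxE fg.
Qed.

Lemma diagf_cst n (V : 'M[C]_n) (d : 'rV[C]_n) a : V *m V^h = 1%:M ->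
  diagf V d (fun=> a) = a%:M.
Proof.
move=> V1; rewrite /diagf (_ : diag_mx _ = a%:M); last first.
  by rewrite -diag_const_mx; congr diag_mx; apply/rowP=> j; rewrite !mxE.
by rewrite mul_mx_scalar -scalemxAl (mulmx1C V1) scalemx1.
Qed.

Lemma spectral_herm n (H : 'M[C]_n) : H^h = H ->
  exists V d, [/\ V *m V^h = 1%:M, H = diagf V d id &
                  forall i, d 0 i \is Num.real].
Proof.
move=> Hh; have Hs : H \is hermsymmx.
  by apply/is_hermitianmxP; rewrite expr0 scale1r Hh.
exists (spectralmx H), (spectral_diag H); split.
- exact/unitarymxP/spectral_unitarymx.
- have /orthomx_spectralP E := hermitian_normalmx Hs.
  rewrite [LHS]E /diagf invmx_unitary ?spectral_unitarymx //.
  by congr (_ *m diag_mx _ *m _); apply/rowP=> j; rewrite !mxE.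
- move=> i; have /mxOverP := hermitian_spectral_diag_real Hs; exact.
Qed.

(** [K] is the inverse square root of [H], whose eigenvalues are positive. Both commutation clauses
    are functional calculus; for the second, [H^cj] has eigenbasis [V^cj] and the same real
    eigenvalues. *)
Lemma inv_sqrt_herm n m (S : 'M[C]_(m, n)) (H := S^h *m S) : H \in unitmx ->
  exists K : 'M[C]_n, [/\ K^h = K, K *m H *m K = 1%:M,
    forall X : 'M_n, H *m X = X *m H -> K *m X = X *m K
  & forall X : 'M_n, H *m X = X *m H^cj -> K *m X = X *m K^cj].
Proof.
move=> Hu; have Hh : H^h = H by rewrite adjmxM adjmxK.
have [V [d [V1 HE dr]]] := spectral_herm Hh.
have d_gt0 i : 0 < d 0 i.
  have dE : V *m H *m V^h = diag_mx d.
    rewrite HE /diagf !mulmxA V1 mul1mx -mulmxA V1 mulmx1.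
    by congr diag_mx; apply/rowP=> j; rewrite !mxE.
  have dE2 : d 0 i = ((S *m V^h)^h *m (S *m V^h)) i i.
    rewrite adjmxM adjmxK !mulmxA -(mulmxA V) dE !mxE eqxx mulr1n //.
  rewrite lt_neqAle; apply/andP; split; last first.
    rewrite dE2 mxE sumr_ge0 // => k _.
    by rewrite !mxE mulrC mul_conjC_ge0.
  have Du : diag_mx d \in unitmx.
    rewrite -dE !unitmx_mul Hu andbT (mulmx1_unit V1).1 /=.
    exact: (mulmx1_unit V1).2.
  rewrite eq_sym; move: Du; rewrite unitmxE det_diag unitfE.
  by move/prodf_neq0/(_ i isT).
have sr i : (sqrtC (d 0 i))^-1 ^* = (sqrtC (d 0 i))^-1.
  apply: CrealP; rewrite realV ger0_real // sqrtC_ge0 ltW //.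
pose f x : C := (sqrtC x)^-1.
exists (diagf V d f); split.
- by rewrite diagf_adj; apply: eq_diagf => i; exact: sr.
- rewrite HE !diagfM // -(diagf_cst d 1 V1); apply: eq_diagf => i.
  rewrite /f mulrAC -invfM -expr2 sqrtCK mulVf //.
  by rewrite gt_eqF.
- by move=> X; rewrite {1 2}HE => /(diagf_comm f V1 V1).
- move=> X; rewrite {1 2}HE !diagf_conj.
  rewrite (@eq_diagf _ _ _ (fun x => x^*) id); last first.
    by move=> i; exact/CrealP.
  rewrite (@eq_diagf _ _ _ (fun x => (f x)^*) f); last exact: sr.
  apply: diagf_comm => //.
  by rewrite -(adjmxE V) -conjmxM V1 conjmx1.
Qed.

(** Gram-Schmidt on a basis of the row space of [E] gives an isometric embedding of its range. *)
Lemma proj_factor n (E : 'M[C]_n) : E^h = E -> E *m E = E ->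
  exists k (V : 'M[C]_(n, k)), V^h *m V = 1%:M /\ V *m V^h = E.
Proof.
move=> Eh E2; pose B := schmidt (row_base E).
have Bu : B *m B^h = 1%:M.
  by apply/unitarymxP/schmidt_unitarymx; rewrite rank_leq_col.
have BE : (B :=: E)%MS.
  apply: eqmx_trans (eq_row_base E).
  by apply: eqmx_schmidt_free; rewrite row_base_free.
have /submxP[X BX] : (B <= E)%MS by rewrite BE.
have /submxP[Y EY] : (E <= B)%MS by rewrite BE.
have B1 : B *m E = B by rewrite BX -mulmxA E2.
have E1 : E *m (B^h *m B) = E.
  by apply: etrans (congr1 (mulmx^~ _) EY) _; rewrite -!mulmxA (mulmxA B) Bu mul1mx.
exists (\rank E), B^h; rewrite adjmxK; split => //.
have := congr1 (fun A : 'M_n => A^h) E1.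
by rewrite !adjmxM adjmxK Eh -mulmxA B1.
Qed.

End Matrices.

(** * Unitary representations and their characters *)

Section UnitaryRep.
Variables (C : numClosedFieldType) (gT : finGroupType).

Definition urep n (r : gT -> 'M[C]_n) : Prop :=
  (forall g h, r (g * h)%g = r g *m r h) /\ (forall g, r g *m (r g)^h = 1%:M).

Definition intertwines n m (r : gT -> 'M[C]_n) (s : gT -> 'M[C]_m) (P : 'M_(m, n)) :=
  forall g, P *m r g = s g *m P.

(** Simplicity is encoded by the conclusion of Schur's lemma. Dimension 0 satisfies it too, hence
    the separate conditions [0 < n]. *)
Definition simple_rep n (r : gT -> 'M[C]_n) : Prop :=
  forall X : 'M_n, intertwines r r X -> exists a, X = a%:M.

Definition character n (r : gT -> 'M[C]_n) : {ffun gT -> C} :=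
  [ffun g => \tr (r g)].

(** The compression of [r] to the range of [V]; it is a representation when [V] is an isometry and
    [V *m V^h] commutes with [r]. *)
Definition subrep n k (r : gT -> 'M[C]_n) (V : 'M_(n, k)) :=
  fun g => V^h *m r g *m V.

Definition cfdot (phi psi : {ffun gT -> C}) : C :=
  #|gT|%:R^-1 * \sum_g phi g * (psi g)^*.

Lemma card_neq0 : #|gT|%:R != 0 :> C.
Proof. by rewrite pnatr_eq0 -lt0n; apply/card_gt0P; exists 1%g. Qed.

Lemma urep1 n (r : gT -> 'M_n) : urep r -> r 1%g = 1%:M.
Proof.
case=> rM rU; have /(congr1 (mulmx^~ (r 1%g)^h)) := rM 1%g 1%g.
by rewrite mulg1 -mulmxA rU mulmx1.
Qed.

Lemma urepV n (r : gT -> 'M_n) g : urep r -> r g^-1%g = (r g)^h.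
Proof.
move=> ur; have [rM rU] := ur.
by rewrite -[LHS]mulmx1 -(rU g) mulmxA -rM mulVg urep1 // mul1mx.
Qed.

Lemma urepVr n (r : gT -> 'M_n) g : urep r -> (r g)^h *m r g = 1%:M.
Proof. by case=> _ rU; apply: mulmx1C. Qed.

Lemma intertwines_adj n m (r : gT -> 'M_n) (s : gT -> 'M_m) P :
  urep r -> urep s -> intertwines r s P -> intertwines s r P^h.
Proof.
move=> ur us rsP g; rewrite -[LHS]adjmxK -[RHS]adjmxK; congr (_^h).
by rewrite !adjmxM !adjmxK -!urepV // rsP.
Qed.

Lemma intertwines_comp n m p (r : gT -> 'M_n) (s : gT -> 'M_m) (t : gT -> 'M_p) P Q :
  intertwines r s P -> intertwines s t Q -> intertwines r t (Q *m P).
Proof. by move=> rsP stQ g; rewrite -mulmxA rsP mulmxA stQ mulmxA. Qed.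

Lemma intertwines_sum n m (r : gT -> 'M_n) (s : gT -> 'M_m) (X : 'M_(m, n)) :
  urep r -> urep s -> intertwines r s (\sum_g s g *m X *m (r g)^h).
Proof.
move=> ur us h; rewrite mulmx_suml mulmx_sumr.
rewrite (reindex_inj (mulgI h)) /=; apply: eq_bigr => g _.
rewrite (proj1 us) -!mulmxA; do 3 congr (_ *m _).
by rewrite -!urepV // -(proj1 ur) invMg mulgKV.
Qed.

Lemma subrep_urep n k (r : gT -> 'M_n) (V : 'M_(n, k)) :
  urep r -> V^h *m V = 1%:M -> intertwines r r (V *m V^h) ->
  urep (subrep r V) /\ intertwines (subrep r V) r V.
Proof.
move=> ur V1 VVr; have VrV : intertwines (subrep r V) r V.
  by move=> g; rewrite /subrep !mulmxA VVr -!mulmxA V1 mulmx1.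
split=> //; split=> [g h|g].
  by rewrite {1}/subrep (proj1 ur) -!mulmxA -VrV !mulmxA.
rewrite /subrep !adjmxM adjmxK !mulmxA -(mulmxA _ V V^h).
rewrite -(mulmxA V^h (r g) (V *m V^h)) -VVr !mulmxA V1 mul1mx.
by rewrite -(mulmxA _ (r g)) (proj2 ur) mulmx1.
Qed.

Lemma character_subrep n k (r : gT -> 'M_n) (V : 'M_(n, k)) g :
  character (subrep r V) g = \tr (r g *m (V *m V^h)).
Proof. by rewrite ffunE /subrep -mulmxA mxtrace_mulC mulmxA. Qed.

Lemma character1 n (r : gT -> 'M_n) : urep r -> character r 1%g = n%:R.
Proof. by move=> ur; rewrite ffunE urep1 // mxtrace1. Qed.

Lemma characterV n (r : gT -> 'M_n) g : urep r ->
  character r g^-1%g = (character r g)^*.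
Proof.
by move=> ur; rewrite !ffunE urepV // /character trace_map_mx mxtrace_tr.
Qed.

Lemma isom_le n k (V : 'M[C]_(n, k)) : V^h *m V = 1%:M -> (k <= n)%N.
Proof.
move=> V1; rewrite -(@mxrank1 C k) -V1.
by apply: leq_trans (mxrankM_maxr _ _) (rank_leq_row _).
Qed.

Lemma intertwines_iso_char n m (r : gT -> 'M_n) (s : gT -> 'M_m) P :
  P^h *m P = 1%:M -> P *m P^h = 1%:M -> intertwines r s P ->
    character r = character s.
Proof.
move=> P1 P2 rsP; apply/ffunP=> g; rewrite !ffunE.
by rewrite -[r g]mul1mx -P1 -mulmxA rsP mxtrace_mulC -mulmxA P2 mulmx1.
Qed.

(** A nonscalar intertwiner has a nonscalar hermitian or skew-hermitian part. The spectral
    projection of a nonscalar hermitian intertwiner at one eigenvalue is again an intertwiner,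
    different from 0 and 1. *)
Lemma not_simple_projection n (r : gT -> 'M_n) : urep r -> ~ simple_rep r ->
  exists E : 'M_n, [/\ E^h = E, E *m E = E, intertwines r r E, E != 0 & E != 1%:M].
Proof.
move=> ur nsr.
have [H [Hh Hr Hns]] : exists H : 'M_n,
    [/\ H^h = H, intertwines r r H & ~ exists a, H = a%:M].
  apply: contrapT => noH; apply: nsr => X Xr.
  have herm_scal (H : 'M_n) : H^h = H -> intertwines r r H -> exists a, H = a%:M.
    by move=> Hh Hr; apply: contrapT => Hn; apply: noH; exists H.
  have Xhr := intertwines_adj ur ur Xr.
  have [a Ha] : exists a, X + X^h = a%:M.
    by apply: herm_scal => [|g]; rewrite ?adjmxD ?adjmxK 1?addrC //
       mulmxDl mulmxDr Xr Xhr.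
  have [b Hb] : exists b, 'i *: (X - X^h) = b%:M.
    apply: herm_scal => [|g].
      by rewrite adjmxZ linearB map_mxB /= adjmxK conjCi scaleNr -scalerN opprB.
    by rewrite -scalemxAl -scalemxAr mulmxBl mulmxBr Xr Xhr.
  exists ((a - 'i * b) / 2).
  have -> : X = 2^-1 *: ((X + X^h) - 'i *: ('i *: (X - X^h))).
    rewrite scalerA -expr2 sqrCi scaleN1r opprK addrACA subrr addr0.
    by rewrite -mulr2n -scaler_nat scalerA mulVf ?scale1r // pnatr_eq0.
  rewrite Ha Hb !scale_scalar_mx -raddfB /= scale_scalar_mx.
  by rewrite mulrC.
have [V [d [V1 HE dr]]] := spectral_herm Hh.
case: n => [|n] in r ur nsr H Hh Hr Hns V d V1 HE dr *.
  by case: Hns; exists 0; apply/matrixP=> -[].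
pose f x : C := (x == d 0 0)%:R.
exists (diagf V d f); split.
- by rewrite diagf_adj; apply: eq_diagf => i; rewrite conjC_nat.
- rewrite diagfM //; apply: eq_diagf => i.
  by rewrite /f -natrM mulnb andbb.
- by move=> g; apply: diagf_comm => //; rewrite -HE Hr.
- apply/eqP => /(congr1 (fun M => V *m M *m V^h)).
  rewrite /diagf !mulmxA V1 mul1mx -mulmxA V1 mulmx1 mulmx0 mul0mx.
  move/matrixP/(_ 0 0)/eqP; rewrite !mxE eqxx /f eqxx mulr1n.
  by rewrite oner_eq0.
- apply/eqP => /(congr1 (fun M => V *m M *m V^h)).
  rewrite /diagf !mulmxA V1 mul1mx -mulmxA V1 !mulmx1 V1 => /matrixP D1.
  apply: Hns; exists (d 0 0); rewrite HE -(diagf_cst d _ V1).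
  apply: eq_diagf => i; have /eqP := D1 i i; rewrite !mxE eqxx !mulr1n.
  by rewrite pnatr_eq1 eqb1 => /eqP.
Qed.

Lemma simple_subrep n (r : gT -> 'M_n) : urep r -> (0 < n)%N ->
  exists k (V : 'M_(n, k)),
    [/\ (0 < k)%N, V^h *m V = 1%:M,
      intertwines r r (V *m V^h) & simple_rep (subrep r V)].
Proof.
elim/ltn_ind: n r => n IHn r ur n0.
have [sr|nsr] := pselect (simple_rep r).
  exists n, 1%:M; rewrite adjmx1 mulmx1; split=> // [g|X Xr].
    by rewrite mul1mx mulmx1.
  by apply: sr => g; have := Xr g; rewrite /subrep adjmx1 mul1mx mulmx1.
have [E [Eh E2 Er E0 E1]] := not_simple_projection ur nsr.
have [k [V [V1 VE]]] := proj_factor Eh E2.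
have k0 : (0 < k)%N.
  case: k V V1 VE => // V _ VE; case/eqP: E0.
  by rewrite -VE [V]thinmx0 mul0mx.
have kn : (k < n)%N.
  rewrite ltn_neqAle (isom_le V1) andbT; apply/eqP => kn.
  subst k.
  by case/eqP: E1; rewrite -VE (mulmx1C V1).
rewrite -VE in Er; have [uV Vr] := subrep_urep ur V1 Er.
have [l [W [l0 W1 Wr sW]]] := IHn k kn _ uV k0.
exists l, (V *m W); split=> //.
- by rewrite adjmxM -mulmxA (mulmxA V^h) V1 mul1mx.
- rewrite adjmxM mulmxA -(mulmxA V W);
  apply: intertwines_comp (intertwines_adj _ _ Vr) _ => //.
  exact: intertwines_comp Wr Vr.
- move=> X Xr; apply: sW => g; have := Xr g.
  by rewrite /subrep adjmxM !mulmxA.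
Qed.

(** Each inner sum over the group is an intertwiner built from a matrix unit, so the orthogonality
    relations reduce to Schur's lemma. *)
Lemma cfdotE n m (r : gT -> 'M_n) (s : gT -> 'M_m) :
  cfdot (character s) (character r) = #|gT|%:R^-1 *
    \sum_a \sum_b (\sum_g s g *m delta_mx a b *m (r g)^h) a b.
Proof.
congr (_ * _); apply/esym; under eq_bigr do under eq_bigr do rewrite summxE.
under eq_bigr do rewrite exchange_big /=.
rewrite exchange_big; apply: eq_bigr => g _ /=.
rewrite !ffunE rmorph_sum mulr_suml; apply: eq_bigr => a _.
rewrite mulr_sumr; apply: eq_bigr => b _.
rewrite -mulmxA mxE (bigD1 a) //= big1 ?addr0 => [|c /negPf ca].
  rewrite mxE (bigD1 b) //= big1 ?addr0 => [|c /negPf cb].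
    by rewrite !mxE !eqxx mul1r.
  by rewrite !mxE eqxx cb mul0r.
by rewrite mxE big1 ?mulr0 // => e _; rewrite !mxE ca mul0r.
Qed.

(** [W^h *m W] is a scalar because [r] is simple, and it is positive because [W != 0]; dividing [W]
    by its square root gives the isometry. *)
Lemma intertwines_isom n m (r : gT -> 'M_n) (s : gT -> 'M_m) (W : 'M_(m, n)) :
  urep r -> urep s -> simple_rep r -> intertwines r s W -> W != 0 ->
  exists V : 'M_(m, n), V^h *m V = 1%:M /\ intertwines r s V.
Proof.
move=> ur us sr Wrs W0.
have [c Wc] := sr _ (intertwines_comp Wrs (intertwines_adj ur us Wrs)).
have n0 : (0 < n)%N by case: n W W0 {r ur sr Wrs Wc} => // W; rewrite thinmx0 eqxx.
have c0 : 0 < c.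
  rewrite lt_neqAle; apply/andP; split.
    apply/eqP=> cE; move: Wc; rewrite -cE raddf0 => /herm_sq_eq0 W00.
    by rewrite W00 eqxx in W0.
  have := congr1 (fun M : 'M_n => M (Ordinal n0) (Ordinal n0)) Wc.
  rewrite !mxE eqxx mulr1n => <-; rewrite sumr_ge0 // => k _.
  by rewrite !mxE mulrC mul_conjC_ge0.
have q : (sqrtC c)^-1 ^* = (sqrtC c)^-1.
  by apply: CrealP; rewrite realV ger0_real // sqrtC_ge0 ltW.
exists ((sqrtC c)^-1 *: W); split.
  rewrite adjmxZ -scalemxAl -scalemxAr scalerA Wc q -expr2 exprVn sqrtCK.
  by rewrite scale_scalar_mx mulVf // gt_eqF.
by move=> g; rewrite -scalemxAl -scalemxAr Wrs.
Qed.

Lemma schur_isom n m (r : gT -> 'M_n) (s : gT -> 'M_m) :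
  urep r -> urep s -> simple_rep r -> cfdot (character s) (character r) != 0 ->
  exists V : 'M_(m, n), V^h *m V = 1%:M /\ intertwines r s V.
Proof.
move=> ur us sr; rewrite cfdotE => nz.
have [W [Wrs W0]] : exists W : 'M_(m, n), intertwines r s W /\ W != 0.
  apply: contrapT => noW; case/eqP: nz.
  rewrite big1 ?mulr0 // => a _; rewrite big1 // => b _.
  have [->|X0] := eqVneq (\sum_g s g *m delta_mx a b *m (r g)^h) 0.
    by rewrite mxE.
  by case: noW; eexists; split; last exact: X0; exact: intertwines_sum.
exact: intertwines_isom ur us sr Wrs W0.
Qed.

Lemma simple_intertwines_char n m (r : gT -> 'M_n) (s : gT -> 'M_m) (W : 'M_(m, n)) :
  urep r -> urep s -> simple_rep r -> simple_rep s -> intertwines r s W -> W != 0 ->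
  character r = character s.
Proof.
move=> ur us sr ss Wi W0; have [V [V1 Vi]] := intertwines_isom ur us sr Wi W0.
have [c cE] := ss _ (intertwines_comp (intertwines_adj ur us Vi) Vi).
have VcV : V = c *: V by rewrite -{1}[V]mulmx1 -V1 mulmxA cE mul_scalar_mx.
have V0 : V != 0.
  apply: contraNneq W0 => V0; move: V1; rewrite V0 mulmx0 => z.
  by rewrite -[W]mulmx1 -z mulmx0.
have : (c - 1) *: V == 0 by rewrite scalerBl scale1r -VcV subrr.
rewrite scaler_eq0 (negPf V0) orbF subr_eq0 => /eqP c1.
by rewrite (intertwines_iso_char V1 _ Vi) // cE c1.
Qed.

(** Each sum over the group is a scalar matrix, determined by its trace; that trace is zero unless
    the matrix unit is diagonal. *)
Lemma cfdot_simple n (r : gT -> 'M_n) :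
  urep r -> simple_rep r -> (0 < n)%N -> cfdot (character r) (character r) = 1.
Proof.
move=> ur sr n0; rewrite cfdotE.
have n0' : n%:R != 0 :> C by rewrite pnatr_eq0 -lt0n.
have E a b : (\sum_g r g *m delta_mx a b *m (r g)^h) a b =
   (a == b)%:R * (#|gT|%:R / n%:R).
  have [c cE] := sr _ (intertwines_sum (delta_mx a b) ur ur).
  have := congr1 mxtrace cE; rewrite mxtrace_scalar raddf_sum /=.
  under eq_bigr do rewrite mxtrace_mulC mulmxA urepVr // mul1mx.
  have -> : \tr (delta_mx a b : 'M[C]_n) = (a == b)%:R.
    rewrite /mxtrace (bigD1 a) //= big1 ?addr0 => [|e /negPf ea].
      by rewrite mxE eqxx.
    by rewrite mxE ea.
  rewrite sumr_const => trE.
  have [ab|ab] := eqVneq a b; last by rewrite cE mul0r !mxE (negPf ab).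
  rewrite cE !mxE ab eqxx mulr1n mul1r.
  by apply: (mulIf n0'); rewrite mulfVK // mulr_natr -trE ab eqxx.
under eq_bigr do under eq_bigr do rewrite E.
rewrite (eq_bigr (fun=> #|gT|%:R / n%:R)) => [|a _]; last first.
  rewrite (bigD1 a) //= eqxx mul1r big1 ?addr0 // => b ba.
  by rewrite eq_sym (negPf ba) mul0r.
by rewrite sumr_const card_ord -[_ / _ *+ n]mulr_natr mulfVK // mulVf // card_neq0.
Qed.

Lemma character_split n m (r : gT -> 'M_n) (s : gT -> 'M_m) (V : 'M_(m, n)) :
  urep r -> urep s -> V^h *m V = 1%:M -> intertwines r s V ->
  exists k (W : 'M_(m, k)), [/\ W^h *m W = 1%:M /\ W *m W^h = 1%:M - V *m V^h,
    m = (n + k)%N, urep (subrep s W), intertwines (subrep s W) s W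
  & character s = character r + character (subrep s W)].
Proof.
move=> ur us V1 Vi; have VVi := intertwines_comp (intertwines_adj ur us Vi) Vi.
have [||k [W [W1 WE]]] := @proj_factor _ _ (1%:M - V *m V^h).
- by rewrite linearB map_mxB /= adjmxM adjmxK adjmx1.
- rewrite mulmxBr mulmxBl !mul1mx mulmx1 mulmxBl mul1mx.
  by rewrite mulmxA -(mulmxA V) V1 mulmx1 subrr subr0.
have WWi : intertwines s s (W *m W^h).
  by move=> g; rewrite WE mulmxBl mulmxBr mul1mx mulmx1 VVi.
have [uW Wi] := subrep_urep us W1 WWi.
exists k, W; split=> //.
  apply/eqP; rewrite -(@eqr_nat C) natrD -(@mxtrace1 C k) -W1 mxtrace_mulC WE.
  by rewrite linearB /= !mxtrace1 mxtrace_mulC V1 mxtrace1 addrC subrK.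
apply/ffunP=> g; rewrite [RHS]ffunE character_subrep WE mulmxBr mulmx1 linearB /=.
rewrite !ffunE mulmxA -Vi mxtrace_mulC mulmxA V1 mul1mx.
by rewrite addrC subrK.
Qed.

Definition is_char (phi : {ffun gT -> C}) : Prop :=
  exists n (r : gT -> 'M_n), urep r /\ phi = character r.

Definition is_irr (phi : {ffun gT -> C}) : Prop :=
  exists n (r : gT -> 'M_n), [/\ (0 < n)%N, urep r,
    simple_rep r & phi = character r].

Lemma is_irr_char phi : is_irr phi -> is_char phi.
Proof. by case=> n [r [_ ? _ ?]]; exists n, r. Qed.

Lemma cfdotDl phi psi xi : cfdot (phi + psi) xi = cfdot phi xi + cfdot psi xi.
Proof.
rewrite /cfdot -mulrDr -big_split /=; congr (_ * _).
by apply: eq_bigr => g _; rewrite ffunE mulrDl.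
Qed.

Lemma cfdot_sumDl I (s : seq I) (P : pred I) (F : I -> {ffun gT -> C}) xi :
  cfdot (\sum_(i <- s | P i) F i) xi = \sum_(i <- s | P i) cfdot (F i) xi.
Proof.
have c0 : cfdot 0 xi = 0 by rewrite /cfdot big1 ?mulr0 // => g _;
  rewrite ffunE mul0r.
exact: (big_morph (cfdot^~ xi) (fun x y => cfdotDl x y xi) c0).
Qed.

Lemma cfdot_conj phi psi : cfdot psi phi = (cfdot phi psi)^*.
Proof.
rewrite /cfdot rmorphM fmorphV rmorph_nat rmorph_sum; congr (_ * _).
by apply: eq_bigr => g _; rewrite rmorphM /= conjCK mulrC.
Qed.

Lemma cfdot_irr phi psi : is_irr phi -> is_irr psi ->
  cfdot phi psi = (phi == psi)%:R.
Proof.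
move=> [m [s [m0 us ss ->]]] [n [r [n0 ur sr ->]]].
have [->|ne] := eqVneq; first by rewrite cfdot_simple.
have [//|] := eqVneq (cfdot (character s) (character r)) 0.
move/(schur_isom ur us sr) => [V [V1 Vi]]; case/eqP: ne.
rewrite (simple_intertwines_char ur us sr ss Vi) //.
apply: contraTneq n0 => V0; rewrite V0 mulmx0 in V1.
by rewrite -eqn0Ngt -(@eqr_nat C) -mxtrace1 -V1 raddf0.
Qed.

Lemma char_sum_irr phi : is_char phi ->
  exists2 s : seq {ffun gT -> C}, (forall x, x \in s -> is_irr x)
                                & phi = \sum_(x <- s) x.
Proof.
move=> [n [r [ur ->]]]; elim/ltn_ind: n r ur => n IHn r ur.
have [n0|n0] := posnP n.
  exists [::] => //; rewrite big_nil; apply/ffunP=> g; rewrite !ffunE.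
  by rewrite n0 in r ur *; rewrite /mxtrace big_ord0.
have [k [V [k0 V1 Vr sV]]] := simple_subrep ur n0.
have [uV Vi] := subrep_urep ur V1 Vr.
have [l [W [[W1 WE] nE uW Wi ->]]] := character_split uV ur V1 Vi.
have [|s sirr ->] := IHn l _ _ uW; first by rewrite nE -[ltnLHS]add0n ltn_add2r.
exists (character (subrep r V) :: s); last by rewrite big_cons.
move=> x; rewrite inE => /orP[/eqP->|/sirr//].
by exists k, (subrep r V).
Qed.

Lemma cfdot_char_irr phi chi : is_char phi -> is_irr chi ->
  exists m : nat, cfdot phi chi = m%:R.
Proof.
move=> /char_sum_irr[s sirr ->] ichi; exists (count_mem chi s).
rewrite cfdot_sumDl -sum1_count natr_sum big_mkcond [RHS]big_mkcond /=.
rewrite big_seq [RHS]big_seq; apply: eq_bigr => x /sirr ix.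
by rewrite cfdot_irr //; case: eqP.
Qed.

(** A simple constituent of [r1] also occurs in [r2], since the inner products agree. The
    complements again have equal characters, and the isometry between them is glued to the one
    between the two copies. *)
Lemma same_character_iso n1 (r1 : gT -> 'M_n1) n2 (r2 : gT -> 'M_n2) :
  urep r1 -> urep r2 -> character r1 = character r2 ->
  exists P : 'M_(n2, n1),
    [/\ P^h *m P = 1%:M, P *m P^h = 1%:M & intertwines r1 r2 P].
Proof.
elim/ltn_ind: n1 r1 n2 r2 => n1 IHn r1 n2 r2 ur1 ur2 e12.
have n12 : n1 = n2.
  by apply/eqP; rewrite -(@eqr_nat C) -(character1 ur1) e12 character1.
have [n0|n0] := posnP n1.
  rewrite n0 in n12 r1 ur1 e12 {IHn} *.
  exists 0; split=> [||g]; last by rewrite mul0mx mulmx0.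
    by apply/matrixP=> -[].
  by apply/matrixP=> -[i hi]; exfalso; rewrite -n12 in hi.
have [k [V [k0 V1 Vr sV]]] := simple_subrep ur1 n0.
have [uV Vi] := subrep_urep ur1 V1 Vr; set t := subrep r1 V in sV uV Vi.
have [l [W [[W1 WE] nE uW Wi cE]]] := character_split uV ur1 V1 Vi.
have nz : cfdot (character r2) (character t) != 0.
  rewrite -e12 cE cfdotDl cfdot_simple //.
  have [||m ->] := @cfdot_char_irr (character (subrep r1 W)) (character t).
  - by exists l, (subrep r1 W).
  - by exists k, t.
  - by rewrite -mulrS pnatr_eq0.
have [V' [V1' Vi']] := schur_isom uV ur2 sV nz.
have [l' [W' [[W1' WE'] nE' uW' Wi' cE']]] := character_split uV ur2 V1' Vi'.
have ltl : (l < n1)%N by rewrite nE -[ltnLHS]add0n ltn_add2r.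
have [|P [P1 P2 Pi]] := IHn l ltl _ l' _ uW uW'.
  by move: e12; rewrite cE cE' => /addrI.
have VW : V^h *m W = 0.
  rewrite -[W]mulmx1 -W1 !mulmxA -(mulmxA V^h W) WE mulmxBr mulmx1.
  by rewrite mulmxA V1 mul1mx subrr mul0mx.
have VW' : V'^h *m W' = 0.
  rewrite -[W']mulmx1 -W1' !mulmxA -(mulmxA V'^h W') WE' mulmxBr mulmx1.
  by rewrite mulmxA V1' mul1mx subrr mul0mx.
have WV : W^h *m V = 0 by rewrite -[LHS]adjmxK adjmxM adjmxK VW linear0 map_mx0.
have WV' : W'^h *m V' = 0 by rewrite -[LHS]adjmxK adjmxM adjmxK VW' linear0 map_mx0.
exists (V' *m V^h + W' *m P *m W^h).
rewrite adjmxD !adjmxM !adjmxK; split.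
- rewrite mulmxDr !mulmxDl !mulmxA.
  rewrite -(mulmxA V V'^h) V1' mulmx1 -(mulmxA _ W'^h V') WV' mulmx0 mul0mx.
  rewrite -(mulmxA V V'^h W') VW' mulmx0 !mul0mx addr0 add0r.
  rewrite -(mulmxA _ W'^h W') W1' mulmx1 -(mulmxA W P^h) P1 mulmx1 WE.
  by rewrite addrC subrK.
- rewrite mulmxDr !mulmxDl !mulmxA.
  rewrite -(mulmxA V' V^h) V1 mulmx1 -(mulmxA _ W^h V) WV mulmx0 mul0mx.
  rewrite -(mulmxA V' V^h W) VW mulmx0 !mul0mx addr0 add0r.
  rewrite -(mulmxA _ W^h W) W1 mulmx1 -(mulmxA W' P) P2 mulmx1 WE'.
  by rewrite addrC subrK.
- move=> g; have Vh := intertwines_adj uV ur1 Vi;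
  have Wh := intertwines_adj uW ur1 Wi.
  rewrite mulmxDl mulmxDr; congr (_ + _).
    exact: (intertwines_comp Vh Vi').
  exact: (intertwines_comp Wh (intertwines_comp Pi Wi')).
Qed.

(** * The regular representation and the finite set of irreducible characters *)

Definition regrep (g : gT) : 'M[C]_#|gT| :=
  \matrix_(x, y) (enum_val x == g * enum_val y)%g%:R.

Lemma regrep_urep : urep regrep.
Proof.
have sumE (F : gT -> C) (g x : gT) :
    \sum_(k < #|gT|) (x == g * enum_val k)%g%:R * F (enum_val k) =
    F (g^-1 * x)%g.
  rewrite (bigD1 (enum_rank (g^-1 * x)%g)) //= enum_rankK mulKVg eqxx mul1r.
  rewrite big1 ?addr0 // => k nk; case: eqP => [xk|]; last by rewrite mul0r.
  by rewrite xk mulKg enum_valK eqxx in nk.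
split=> [g h|g]; apply/matrixP=> x y; rewrite !mxE.
  under [RHS]eq_bigr do rewrite !mxE.
  rewrite (sumE (fun z => (z == h * enum_val y)%g%:R)).
  by rewrite -[in RHS](inj_eq (mulgI g)) mulKVg mulgA.
under eq_bigr do rewrite !mxE conjC_nat.
rewrite (sumE (fun z => (enum_val y == g * z)%g%:R)) mulKVg.
by rewrite (inj_eq enum_val_inj) eq_sym.
Qed.

Lemma character_regrep g : character regrep g = (g == 1%g)%:R * #|gT|%:R.
Proof.
rewrite ffunE /mxtrace (eq_bigr (fun=> (g == 1%g)%:R)) => [|x _].
  by rewrite sumr_const card_ord mulr_natr.
by rewrite mxE -{1}[enum_val x]mul1g (inj_eq (mulIg _)) eq_sym.
Qed.

Lemma cfdot_regrep phi : cfdot (character regrep) phi = (phi 1%g)^*.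
Proof.
rewrite /cfdot (bigD1 1%g) //= character_regrep eqxx mul1r big1 ?addr0.
  by rewrite mulKf // card_neq0.
by move=> g /negPf g1; rewrite character_regrep g1 !mul0r.
Qed.

(** The multiplicity of an irreducible character in the regular one is its degree, which is not
    zero; the constituents of the regular character therefore form a complete list. *)
Lemma irr_list_exists : exists s : seq {ffun gT -> C},
  forall chi, (chi \in s) <-> is_irr chi.
Proof.
have [|s sirr sE] := @char_sum_irr (character regrep).
  by exists #|gT|, regrep; split; first exact: regrep_urep.
exists s => chi; split=> [/sirr//|ichi].
have [n [r [n0 ur sr cE]]] := ichi.
apply: contraTT n0 => nchi; rewrite -eqn0Ngt -(@eqr_nat C).
rewrite -(character1 ur) -cE -[chi _]conjCK -cfdot_regrep sE cfdot_sumDl.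
rewrite big_seq big1 ?rmorph0 // => x xs.
rewrite cfdot_irr //; last exact: sirr.
by case: eqP xs nchi => // -> ->.
Qed.

Definition irr_list : seq {ffun gT -> C} := projT1 (cid irr_list_exists).

Lemma irr_listP chi : (chi \in irr_list) <-> is_irr chi.
Proof. by rewrite /irr_list; case: cid. Qed.

Definition Irr := seq_sub irr_list.
HB.instance Definition _ := Finite.on Irr.
Definition chi (i : Irr) : {ffun gT -> C} := val i.

Lemma chi_irr i : is_irr (chi i).
Proof. by apply/irr_listP; apply: valP. Qed.

Lemma irr_chi phi : is_irr phi -> exists i : Irr, phi = chi i.
Proof. by move/irr_listP=> h; exists (SeqSub h). Qed.

Lemma chi_inj : injective chi.
Proof. exact: val_inj. Qed.

Lemma cfdot_chi i j : cfdot (chi i) (chi j) = (i == j)%:R.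
Proof. by rewrite (cfdot_irr (chi_irr i) (chi_irr j)) (inj_eq chi_inj). Qed.

Lemma deg_exists i : exists d : nat, (0 < d)%N /\ exists r : gT -> 'M[C]_d,
  [/\ urep r, simple_rep r & chi i = character r].
Proof. by have [d [r [? ? ? ?]]] := chi_irr i; exists d; split=> //; exists r. Qed.

Definition deg i : nat := projT1 (cid (deg_exists i)).
Lemma deg_gt0 i : (0 < deg i)%N.
Proof. by rewrite /deg; case: cid => d []. Qed.
Lemma irr_rep_exists i : exists r : gT -> 'M[C]_(deg i),
  [/\ urep r, simple_rep r & chi i = character r].
Proof. by rewrite /deg; case: cid => d []. Qed.
Definition irr_rep i := projT1 (cid (irr_rep_exists i)).
Lemma irr_rep_urep i : urep (irr_rep i).
Proof. by rewrite /irr_rep; case: cid => d []. Qed.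
Lemma irr_rep_simple i : simple_rep (irr_rep i).
Proof. by rewrite /irr_rep; case: cid => d []. Qed.
Lemma chiE i : chi i = character (irr_rep i).
Proof. by rewrite /irr_rep; case: cid => d []. Qed.
Lemma chi1 i : chi i 1%g = (deg i)%:R.
Proof. by rewrite chiE character1 //; exact: irr_rep_urep. Qed.

Lemma character_decomp phi : is_char phi ->
  exists m : Irr -> nat, phi = \sum_i chi i *+ m i.
Proof.
case/char_sum_irr => s sirr ->; elim: s sirr => [|x s IHs] sirr.
  by exists (fun=> 0%N); rewrite big_nil big1.
have [|m mE] := IHs; first by move=> y ys; apply: sirr; rewrite inE ys orbT.
have [i ->] := irr_chi (sirr x (mem_head _ _)).
exists (fun j => (j == i) + m j)%N; rewrite big_cons mE.
under [RHS]eq_bigr do rewrite mulrnDr; rewrite big_split /=; congr (_ + _).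
by rewrite (bigD1 i) //= eqxx big1 ?addr0 // => j /negPf->.
Qed.

Lemma cfdot_sum_chi (m : Irr ->
  nat) i : cfdot (\sum_j chi j *+ m j) (chi i) = (m i)%:R.
Proof.
have mulrn_cf n phi psi : cfdot (phi *+ n) psi = cfdot phi psi *+ n.
  elim: n => [|n IHn]; last by rewrite !mulrS cfdotDl IHn.
  by rewrite !mulr0n /cfdot big1 ?mulr0 // => g _; rewrite ffunE mul0r.
rewrite cfdot_sumDl (bigD1 i) //= mulrn_cf cfdot_chi eqxx big1 ?addr0 //.
by move=> j /negPf ji; rewrite mulrn_cf cfdot_chi ji mul0rn.
Qed.

Lemma sum_deg_chi : \sum_i chi i *+ deg i = character regrep.
Proof.
have [|m mE] := @character_decomp (character regrep).
  by exists #|gT|, regrep; split; first exact: regrep_urep.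
rewrite mE; apply: eq_bigr => i _; congr (_ *+ _); apply/eqP.
by rewrite -(@eqr_nat C) -(cfdot_sum_chi m) -mE cfdot_regrep chi1 conjC_nat.
Qed.

End UnitaryRep.

(** * Orthogonal and symplectic structures *)

Section Forms.
Variables (C : numClosedFieldType) (gT : finGroupType).
Implicit Types (phi psi : {ffun gT -> C}) (e f : bool).
Local Notation sg e := ((-1) ^+ nat_of_bool e : C).

(* [e = false] for orthogonal and [e = true] for symplectic structures. *)
Definition preserves_form e n (r : gT -> 'M[C]_n) (J : 'M[C]_n) : Prop :=
  [/\ urep r, J *m J^h = 1%:M, J *m J^cj = (sg e)%:M
    & forall g, r g *m J = J *m (r g)^cj].

Definition has_form e phi : Prop :=
  exists n (r : gT -> 'M_n) J, preserves_form e r J /\ phi = character r.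

Lemma sgK e : sg e * sg e = 1.
Proof. by rewrite -signr_addb addbb. Qed.

Lemma has_form_char e phi : has_form e phi -> is_char phi.
Proof. by case=> n [r [J [[ur _ _ _] ->]]]; exists n, r. Qed.

(** Passes from the antilinear map v -> J conj(v), whose square is a sign, to the bilinear form with
    matrix [J], which is symmetric or antisymmetric. *)
Lemma form_tr e n (J : 'M[C]_n) :
  J *m J^h = 1%:M -> J *m J^cj = (sg e)%:M -> J^T = sg e *: J.
Proof.
move=> J1 Je; have := congr1 (mulmx^~ J^T) Je.
have -> : J *m J^cj *m J^T = J.
  rewrite -mulmxA (_ : _ *m J^T = 1%:M) ?mulmx1 //.
  by rewrite -[J^T]conjmxK -conjmxM J1 conjmx1.
rewrite mul_scalar_mx => {2}->.
by rewrite scalerA sgK scale1r.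
Qed.

Lemma urep_conj n (r : gT -> 'M[C]_n) : urep r -> urep (fun g => (r g)^cj).
Proof.
move=> ur; split=> [g h|g]; first by rewrite (proj1 ur) conjmxM.
by rewrite -(adjmxE (r g)) -conjmxM (proj2 ur) conjmx1.
Qed.

Lemma form_conj_adj e n (r : gT -> 'M[C]_n) J g : preserves_form e r J ->
  J^h *m r g = (r g)^cj *m J^h.
Proof.
case=> ur J1 Je Jr; rewrite -[LHS]mulmx1 -J1 !mulmxA -(mulmxA J^h) Jr.
by rewrite !mulmxA (mulmx1C J1) mul1mx.
Qed.

(** The determinant of x A + B is a polynomial in x that does not vanish at x = i; a nonzero
    polynomial cannot vanish at all natural numbers. *)
Lemma unit_combination n (A B : 'M[C]_n) : 'i *: A + B \in unitmx ->
  exists a : nat, a%:R *: A + B \in unitmx.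
Proof.
move=> u; pose q := \det ('X *: map_mx polyC A + map_mx polyC B).
have qE x : q.[x] = \det (x *: A + B).
  rewrite -[LHS]/(horner_eval x q) -det_map_mx; congr (\det _).
  apply/matrixP=> i j; rewrite !mxE /= /horner_eval hornerD.
  by rewrite hornerM hornerX !hornerC.
have q0 : q != 0.
  apply: contraTneq u => q0; rewrite unitmxE -qE q0 horner0.
  by rewrite unitr0.
have [[a nra]|H] := pselect (exists a : nat, ~~ root q a%:R).
  by exists a; rewrite unitmxE -qE unitfE.
suff: (size [seq (a%:R : C) | a <- iota 0 (size q)] < size q)%N.
  by rewrite size_map size_iota ltnn.
apply: max_poly_roots => //.
- apply/allP=> x /mapP[a _ ->]; apply: contrapT => /negP na.
  by apply: H; exists a.
- rewrite map_inj_uniq ?iota_uniq // => a b /eqP.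
  by rewrite eqr_nat => /eqP.
Qed.

(* The structures act on intertwiners by the involution P |-> P'.  For real [a] the
   intertwiner a(P + P') + i(P - P') is fixed by it; it is 2iP at [a = i], hence
   invertible for some natural number [a]. *)
Lemma form_isometry e n (r1 r2 : gT -> 'M[C]_n) J1 J2 (P : 'M_n) :
  preserves_form e r1 J1 -> preserves_form e r2 J2 -> P *m P^h = 1%:M ->
    intertwines r1 r2 P ->
  exists U : 'M_n, [/\ U *m U^h = 1%:M, intertwines r1 r2 U & U *m J1 = J2 *m U^cj].
Proof.
move=> F1 F2 PP Pi; have [ur1 J11 J1e Jr1] := F1; have [ur2 J21 J2e Jr2] := F2.
pose P' := J2 *m P^cj *m J1^h.
have P'i : intertwines r1 r2 P'.
  move=> g; rewrite /P' -mulmxA (form_conj_adj g F1) !mulmxA; congr (_ *m _).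
  by rewrite -mulmxA -conjmxM Pi conjmxM !mulmxA Jr2.
have P'J : J2 *m P^cj = P' *m J1.
  by rewrite /P' -[RHS]mulmxA (mulmx1C J11) mulmx1.
have PJ : J2 *m P'^cj = P *m J1.
  rewrite /P' !conjmxM conjmxK conjmxK !mulmxA J2e mul_scalar_mx (form_tr J11 J1e).
  by rewrite -scalemxAl -scalemxAr scalerA sgK scale1r.
pose A := P + P'; pose B := 'i *: (P - P').
have [|a uS] := @unit_combination _ A B.
  rewrite /A /B -scalerDr addrACA subrr addr0 -mulr2n -scaler_nat scalerA.
  rewrite unitmxE detZ unitrM -unitmxE (mulmx1_unit PP).1 andbT unitfE.
  by rewrite expf_neq0 // mulf_neq0 ?neq0Ci ?pnatr_eq0.
set S := a%:R *: A + B in uS.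
have Si : intertwines r1 r2 S.
  move=> g; rewrite /S /A /B mulmxDl mulmxDr -!scalemxAl -!scalemxAr.
  by rewrite mulmxDl mulmxDr mulmxBl mulmxBr Pi P'i.
have SJ : S *m J1 = J2 *m S^cj.
  rewrite /S /A /B map_mxD !map_mxZ map_mxD map_mxB /= rmorph_nat conjCi.
  rewrite mulmxDr -!scalemxAr mulmxDr mulmxBr P'J PJ.
  rewrite mulmxDl -!scalemxAl mulmxDl mulmxBl [P' *m J1 + _]addrC scaleNr -scalerN.
  by rewrite opprB.
(* [S *m K] is the unitary polar part of [S]. Since [S^h *m S] commutes with the action and, up to
   conjugation, with [J1], so does its inverse square root [K]. *)
have [|K [Kh K1 KX KX']] := @inv_sqrt_herm _ _ _ S.
  rewrite unitmx_mul uS andbT.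
  by rewrite -map_trmx unitmx_tr map_unitmx.
have HJ : S^h *m S *m J1 = J1 *m (S^h *m S)^cj.
  have SJ' : J1^h *m S^h = S^T *m J2^h.
    by rewrite -adjmxM SJ adjmxM (adjmxE S^cj) conjmxK.
  have SJh : S^h *m J2 = J1 *m S^T.
    by rewrite -[S^h]mul1mx -J11 -!mulmxA (mulmxA J1^h) SJ' -!mulmxA
       (mulmx1C J21) mulmx1.
  by rewrite -mulmxA SJ mulmxA SJh conjmxM conjmxK mulmxA.
have Ki : intertwines r1 r1 K.
  move=> g; apply: KX; apply: (intertwines_comp Si (intertwines_adj ur1 ur2 Si)).
exists (S *m K); split.
- by apply: mulmx1C; rewrite adjmxM Kh -!mulmxA (mulmxA S^h) mulmxA.
- exact: intertwines_comp Ki Si.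
- by rewrite -mulmxA (KX' _ HJ) mulmxA SJ conjmxM mulmxA.
Qed.

Lemma form_sub e n k (r : gT -> 'M[C]_n) J (V : 'M_(n, k)) :
  preserves_form e r J -> V^h *m V = 1%:M -> intertwines r r (V *m V^h) ->
  V *m V^h *m J = J *m (V *m V^h)^cj ->
  preserves_form e (subrep r V) (V^h *m J *m V^cj).
Proof.
move=> [ur J1 Je Jr] V1 Vr VJ; have [uV Vi] := subrep_urep ur V1 Vr.
have VJ' : V *m V^h *m J = J *m V^cj *m V^T.
  by rewrite VJ conjmxM conjmxK mulmxA.
have Vh := intertwines_adj uV ur Vi.
split=> //.
- rewrite !adjmxM adjmxK (adjmxE V^cj) conjmxK !mulmxA -(mulmxA V^h) -(mulmxA V^h)
  -VJ'.
  by rewrite !mulmxA V1 mul1mx -(mulmxA V^h) J1 mulmx1.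
- rewrite !conjmxM !conjmxK !mulmxA -(mulmxA V^h) -(mulmxA V^h) -VJ'.
  rewrite !mulmxA V1 mul1mx -(mulmxA V^h) Je mul_mx_scalar.
  by rewrite -scalemxAl V1 scalemx1.
- move=> g; rewrite /subrep !conjmxM conjmxK !mulmxA.
  rewrite -(mulmxA V^h J V^cj) -(mulmxA V^h _ V^T) -VJ' !mulmxA V1 mul1mx.
  rewrite -(mulmxA _ V V^h) -(mulmxA V^h (r g)) -Vr !mulmxA V1 mul1mx.
  by rewrite -(mulmxA V^h (r g)) Jr !mulmxA.
Qed.

Lemma block_urep n m (r : gT -> 'M[C]_n) (s : gT -> 'M_m) : urep r -> urep s ->
  urep (fun g => block_mx (r g) 0 0 (s g)).
Proof.
move=> ur us; split=> [g h|g].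
  by rewrite (proj1 ur) (proj1 us) mulmx_block !mul0mx !mulmx0 !addr0 !add0r.
rewrite tr_block_mx map_block_mx !trmx0 !map_mx0 mulmx_block.
by rewrite !mul0mx !mulmx0 !addr0 !add0r (proj2 ur) (proj2 us) -scalar_mx_block.
Qed.

Lemma character_block n m (r : gT -> 'M[C]_n) (s : gT -> 'M_m) :
  character (fun g => block_mx (r g) 0 0 (s g)) = character r + character s.
Proof. by apply/ffunP=> g; rewrite !ffunE mxtrace_block. Qed.

Lemma has_formD e phi psi :
  has_form e phi -> has_form e psi -> has_form e (phi + psi).
Proof.
case=> n [r [J [[ur J1 Je Jr] ->]]] [m [s [K [[us K1 Ke Ks] ->]]]].
rewrite -character_block; exists (n + m)%N, (fun g => block_mx (r g) 0 0 (s g)),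
  (block_mx J 0 0 K).
split=> //; split=> [|||g]; first exact: block_urep.
- rewrite tr_block_mx map_block_mx !trmx0 !map_mx0 mulmx_block.
  by rewrite !mul0mx !mulmx0 !addr0 !add0r J1 K1 -scalar_mx_block.
- rewrite map_block_mx !map_mx0 mulmx_block.
  by rewrite !mul0mx !mulmx0 !addr0 !add0r Je Ke -scalar_mx_block.
- rewrite map_block_mx !map_mx0 !mulmx_block.
  by rewrite !mul0mx !mulmx0 !addr0 !add0r Jr Ks.
Qed.

Lemma has_form0 e : has_form e 0.
Proof.
exists 0%N, (fun=> 0), 0; split; first split=> [|||g].
- by split=> [g h|g]; apply/matrixP=> -[].
- by apply/matrixP=> -[].
- by apply/matrixP=> -[].
- by apply/matrixP=> -[].
- by apply/ffunP=> g; rewrite !ffunE /mxtrace big_ord0.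
Qed.

(** The hyperbolic structure: [J] exchanges the representation with its conjugate, and either sign
    can be placed in one of the two blocks. *)
Lemma has_form_double e phi : is_char phi ->
  has_form e (phi + [ffun g => (phi g)^*]).
Proof.
case=> n [r [ur ->]]; exists (n + n)%N, (fun g => block_mx (r g) 0 0 (r g)^cj).
exists (block_mx 0 1%:M (sg e)%:M 0); split; last first.
  by rewrite character_block; congr (_ + _); apply/ffunP=> g;
    rewrite !ffunE trace_map_mx.
have se : (sg e)^* = sg e by rewrite rmorph_sign.
split=> [|||g]; first by apply: block_urep => //; exact: urep_conj.
- rewrite tr_block_mx map_block_mx !trmx0 !map_mx0 trmx1 tr_scalar_mx map_mx1.
  rewrite map_scalar_mx /= se mulmx_block !mul0mx !mulmx0 !addr0 !add0r mulmx1.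
  by rewrite -scalar_mxM sgK -scalar_mx_block.
- rewrite map_block_mx !map_mx0 map_mx1 map_scalar_mx /= se mulmx_block.
  by rewrite !mul0mx !mulmx0 !addr0 !add0r mulmx1 mul1mx -scalar_mx_block.
- rewrite map_block_mx !map_mx0 conjmxK !mulmx_block !mul0mx !mulmx0 !addr0 !add0r.
  by rewrite mulmx1 mul1mx scalar_mxC.
Qed.

Lemma has_form_real e phi : has_form e phi -> forall g, (phi g)^* = phi g.
Proof.
case=> n [r [J [[ur J1 Je Jr] ->]]] g; rewrite !ffunE -trace_map_mx /=.
rewrite -[(r g)^cj]mul1mx -(mulmx1C J1) -mulmxA -Jr mxtrace_mulC -mulmxA.
by rewrite J1 mulmx1.
Qed.

(** For an isometry [J] from the conjugate representation, [J *m J^cj] is a scalar c by Schur. Then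
    J = c J^T, and transposing gives c^2 = 1. *)
Lemma has_form_self_dual phi : is_irr phi -> (forall g, (phi g)^* = phi g) ->
  exists e, has_form e phi.
Proof.
case=> n [r [n0 ur sr ->]] re.
have [|J [J1 J2 Ji]] := same_character_iso (urep_conj ur) ur.
  by apply/ffunP=> g; rewrite -re !ffunE trace_map_mx.
have [g|c cE] := sr (J *m J^cj).
  rewrite -mulmxA (_ : J^cj *m r g = (r g)^cj *m J^cj) ?mulmxA ?Ji //.
  by rewrite -[J^cj *m _]conjmxK conjmxM conjmxK Ji conjmxM.
have JE : J = c *: J^T.
  rewrite -mul_scalar_mx -cE -mulmxA (_ : _ *m J^T = 1%:M) ?mulmx1 //.
  by rewrite -[J^T]conjmxK -conjmxM J2 conjmx1.
have JTE : J^T = c *: J by rewrite {1}JE linearZ /= trmxK.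
have c2 : c ^+ 2 = 1.
  have : (c ^+ 2 - 1) *: J == 0.
    by rewrite scalerBl scale1r expr2 -scalerA -JTE -JE subrr.
  rewrite scaler_eq0 subr_eq0 => /orP[/eqP//|/eqP J0].
  by move: n0; rewrite lt0n -(@eqr_nat C) -(@mxtrace1 C n) -J2 J0 mul0mx raddf0 eqxx.
have [e ec] : exists e, sg e = c.
  move/eqP: c2; rewrite sqrf_eq1 => /orP[/eqP->|/eqP->].
    by exists false.
  by exists true.
exists e, n, r, J; split=> //; split=> //.
by rewrite ec.
Qed.

Lemma tens1 n m (a b : C) :
  mxtens.tensmx (a%:M : 'M_n) (b%:M : 'M_m) = (a * b)%:M.
Proof.
apply/matrixP=> i j.
case: (mxtens.mxtens_indexP i) => i1 i2; case: (mxtens.mxtens_indexP j) => j1 j2.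
rewrite mxtens.tensmxE !mxE (inj_eq (can_inj (@mxtens.mxtens_indexK _ _))).
by rewrite xpair_eqE; do 2 case: eqP => _; rewrite ?mulr0n ?mulr1n ?mulr0 ?mul0r.
Qed.

Lemma tens_urep n m (r : gT -> 'M[C]_n) (s : gT -> 'M_m) : urep r -> urep s ->
  urep (fun g => mxtens.tensmx (r g) (s g)).
Proof.
move=> ur us; split=> [g h|g].
  by rewrite (proj1 ur) (proj1 us) mxtens.tensmx_mul.
rewrite mxtens.trmx_tens mxtens.map_mxT mxtens.tensmx_mul.
by rewrite (proj2 ur) (proj2 us) tens1 mulr1.
Qed.

Lemma character_tens n m (r : gT -> 'M[C]_n) (s : gT -> 'M_m) :
  character (fun g => mxtens.tensmx (r g) (s g)) = character r * character s.
Proof.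
apply/ffunP=> g; rewrite !ffunE /mxtrace mxtens.mulr_sum.
by apply: eq_bigr => i _; rewrite mxE.
Qed.

Lemma is_charM phi psi : is_char phi -> is_char psi -> is_char (phi * psi).
Proof.
case=> n [r [ur ->]] [m [s [us ->]]]; rewrite -character_tens.
exists (n * m)%N, (fun g => mxtens.tensmx (r g) (s g)).
by split=> //; exact: tens_urep.
Qed.

Lemma has_formM e f phi psi :
  has_form e phi -> has_form f psi -> has_form (e (+) f) (phi * psi).
Proof.
case=> n [r [J [[ur J1 Je Jr] ->]]] [m [s [K [[us K1 Ke Ks] ->]]]].
rewrite -character_tens; exists (n * m)%N, (fun g => mxtens.tensmx (r g) (s g)),
  (mxtens.tensmx J K).
split=> //; split=> [|||g]; first exact: tens_urep.
- by rewrite mxtens.trmx_tens mxtens.map_mxT mxtens.tensmx_mul J1 K1 tens1 mulr1.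
- by rewrite mxtens.map_mxT mxtens.tensmx_mul Je Ke tens1 -signr_addb.
- by rewrite mxtens.map_mxT !mxtens.tensmx_mul Jr Ks.
Qed.


(* If [V] embeds the constituent [s] then [V' = J conj(V) K^*] is a second copy of
   [s]; it is orthogonal to [V] because the signs differ, and the complement of both
   copies is stable under [J]. *)
Lemma form_multiplicity_even n (r : gT -> 'M[C]_n) J e m d (s : gT -> 'M_d) K :
  preserves_form e r J -> (0 < d)%N -> simple_rep s -> preserves_form (~~ e) s K ->
  cfdot (character r) (character s) = m%:R -> ~~ odd m.
Proof.
elim/ltn_ind: n r J m => n IHn r J m F d0 ss Fs mE.
have [ur J1 Je Jr] := F; have [us K1 Ke Ks] := Fs.
have [->//|m0] := posnP m.
have [|V [V1 Vi]] := schur_isom us ur ss; first by rewrite mE pnatr_eq0 -lt0n.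
pose V' := J *m V^cj *m K^h.
have V'i : intertwines s r V'.
  move=> g; rewrite /V' -mulmxA (form_conj_adj g Fs) !mulmxA; congr (_ *m _).
  by rewrite -mulmxA -conjmxM Vi conjmxM !mulmxA Jr.
have V'1 : V'^h *m V' = 1%:M.
  rewrite /V' !adjmxM adjmxK (adjmxE V^cj) conjmxK !mulmxA -(mulmxA _ J^h J)
    (mulmx1C J1) mulmx1.
  by rewrite -(mulmxA K) -[V^T]conjmxK -conjmxM V1 conjmx1 mulmx1.
have seN : sg (~~ e) = - sg e by case: e {F Fs Je Ke IHn};
  rewrite ?expr1 ?expr0 ?opprK.
(* By Schur this product is a scalar [a], and [V^h *m J *m V^cj = a *: K]. Transposition multiplies
   the two sides by opposite signs, whence [a = 0]. *)
have VV' : V^h *m V' = 0.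
  have [a aE] := ss _ (intertwines_comp V'i (intertwines_adj us ur Vi)).
  have aK : V^h *m J *m V^cj = a *: K.
    by rewrite -mul_scalar_mx -aE /V' -!mulmxA (mulmx1C K1) mulmx1.
  have := congr1 trmx aK; rewrite !trmx_mul linearZ /=.
  rewrite (form_tr J1 Je) (form_tr K1 Ke) !map_trmx trmxK seN.
  rewrite -scalemxAl -scalemxAr mulmxA aK !scalerA mulrN scaleNr mulrC => /eqP.
  rewrite -addr_eq0 -mulr2n -scaler_nat scalerA scaler_eq0 !mulf_eq0.
  rewrite pnatr_eq0 signr_eq0 orbF /=.
  move=> /orP[/eqP a0|/eqP K0]; first by rewrite aE a0 raddf0.
  by move: d0; rewrite lt0n -(@eqr_nat C) -(@mxtrace1 C d) -K1 K0 mul0mx raddf0 eqxx.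
have VV'h : V'^h *m V = 0 by rewrite -[LHS]adjmxK adjmxM adjmxK VV' linear0 map_mx0.
pose E := V *m V^h + V' *m V'^h.
have Ei : intertwines r r E.
  move=> g; rewrite /E mulmxDl mulmxDr; congr (_ + _).
    exact: (intertwines_comp (intertwines_adj us ur Vi) Vi).
  exact: (intertwines_comp (intertwines_adj us ur V'i) V'i).
have JV : J *m V^cj = V' *m K by rewrite /V' -mulmxA (mulmx1C K1) mulmx1.
have JV' : J *m V'^cj = - (V *m K).
  rewrite /V' !conjmxM !conjmxK mulmxA (mulmxA J) Je mul_scalar_mx (form_tr K1 Ke).
  by rewrite -scalemxAl -scalemxAr scalerA seN mulrN sgK scaleN1r.
clearbody V'.
have hJ (W : 'M_(n, d)) : W^h *m J = sg e *: (J *m W^cj)^T.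
  by rewrite trmx_mul (form_tr J1 Je) -scalemxAr scalerA sgK scale1r map_trmx.
have EJ : E *m J = J *m E^cj.
  rewrite /E mulmxDl map_mxD mulmxDr -!mulmxA !hJ !conjmxM !mulmxA JV JV'.
  rewrite !trmx_mul linearN /= trmx_mul (form_tr K1 Ke) seN !conjmxK.
  rewrite addrC; congr (_ + _).
    by rewrite -scalemxAl scaleNr opprK scalerA sgK scale1r mulmxA.
  by rewrite -scalemxAl scalerA mulrN sgK scaleN1r mulmxN mulmxA mulNmx.
have [||k [W [W1 WE]]] := @proj_factor _ _ (1%:M - E).
- by rewrite linearB map_mxB /= adjmx1 /E adjmxD !adjmxM !adjmxK.
- have E2 : E *m E = E.
    rewrite /E mulmxDl !mulmxDr !mulmxA -(mulmxA V) V1 -(mulmxA V V^h) VV'.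
    by rewrite -(mulmxA V' _ V) VV'h -(mulmxA V' _ V') V'1 !mulmx1 !mulmx0 !mul0mx
       add0r addr0.
  by rewrite mulmxBr mulmx1 mulmxBl mul1mx E2 subrr subr0.
have Wr : intertwines r r (W *m W^h).
  by move=> g; rewrite WE mulmxBl mulmxBr mul1mx mulmx1 Ei.
have WJ : W *m W^h *m J = J *m (W *m W^h)^cj.
  by rewrite WE mulmxBl map_mxB conjmx1 mulmxBr mul1mx mulmx1 EJ.
have FW := form_sub F W1 Wr WJ.
have cE : character r = character s + character s + character (subrep r W).
  have tE X g : X^h *m X = 1%:M -> intertwines s r X ->
      \tr (r g *m (X *m X^h)) = character s g.
    move=> X1 Xi; rewrite mulmxA -Xi mxtrace_mulC mulmxA X1 mul1mx.
    by rewrite ffunE.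
  apply/ffunP=> g; rewrite [RHS]ffunE [X in X + _]ffunE character_subrep WE mulmxBr.
  rewrite mulmx1 linearB /= mulmxDr linearD /= !tE // ffunE.
  by rewrite addrC subrK.
have kn : (k < n)%N.
  rewrite -(@ltr_nat C) -(@mxtrace1 C k) -W1 mxtrace_mulC WE linearB /=.
  have -> : \tr E = (d + d)%:R.
    by rewrite /E linearD /= mxtrace_mulC V1 [\tr (V' *m _)]mxtrace_mulC V'1
       mxtrace1 natrD.
  by rewrite mxtrace1 ltrBlDr ltrDl ltr0n addn_gt0 d0.
(* Removing both copies lowers the multiplicity by two; in particular it cannot have been 1. *)
case: m => [|[|m]] in mE m0 * => //.
  move: mE; rewrite cE !cfdotDl cfdot_simple //.
  have [||l ->] := @cfdot_char_irr _ _ (character (subrep r W)) (character s).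
  - by exists k, (subrep r W); case: FW.
  - by exists d, s.
  - by rewrite -[1 + 1]/(2%:R) -natrD => /eqP; rewrite eqr_nat.
rewrite /= negbK; apply: (IHn k kn _ _ _ FW d0 ss Fs).
apply: (addrI 2%:R); rewrite -natrD.
by move: mE; rewrite cE !cfdotDl cfdot_simple.
Qed.

(** The structure on [chi] may live on another representation with the same character; it is
    transported to [s] along the isometry [P]. *)
Lemma has_form_even e phi chi m : has_form e phi -> is_irr chi ->
  has_form (~~ e) chi -> cfdot phi chi = m%:R -> ~~ odd m.
Proof.
case=> n [r [J [F ->]]] [d [s [d0 us ss ->]]] [d' [s' [K [F' cE]]]].
have [us' K1 Ke Ks] := F'.
have [P [P1 P2 Pi]] := same_character_iso us us' cE.
have dE : d = d' by apply/eqP; rewrite -(@eqr_nat C) -(character1 us) cE character1.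
subst d'; apply: (form_multiplicity_even F d0 ss (K := P^h *m K *m P^cj)).
have Ph := intertwines_adj us us' Pi.
have PT : P^cj *m P^T = 1%:M by rewrite -[P^T]conjmxK -conjmxM P2 conjmx1.
split=> [//|||g].
- rewrite !adjmxM adjmxK (adjmxE P^cj) conjmxK !mulmxA -(mulmxA _ P^cj P^T).
  rewrite PT mulmx1 -(mulmxA _ K) K1 mulmx1.
  by rewrite P1.
- rewrite !conjmxM !conjmxK !mulmxA -(mulmxA _ P^cj P^T).
  rewrite PT mulmx1 -(mulmxA _ K) Ke mul_mx_scalar.
  by rewrite -scalemxAl P1 scalemx1.
- rewrite !mulmxA -Ph -(mulmxA P^h (s' g)) Ks -!mulmxA; do 2 congr (_ *m _).
  by rewrite -conjmxM -Pi conjmxM.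
Qed.

(** * The Frobenius-Schur indicator *)

Definition fs_indicator phi : C := #|gT|%:R^-1 * \sum_g phi (g * g)%g.

Lemma fs_indicatorE n (r : gT -> 'M[C]_n) : urep r ->
  fs_indicator (character r) = #|gT|%:R^-1 *
  \sum_a \sum_b (\sum_g r g *m delta_mx b a *m (r g)^T) a b.
Proof.
move=> ur; congr (_ * _); apply/esym.
under eq_bigr do under eq_bigr do rewrite summxE.
under eq_bigr do rewrite exchange_big /=.
rewrite exchange_big; apply: eq_bigr => g _ /=.
rewrite ffunE (proj1 ur); apply: eq_bigr => a _.
rewrite mxE; apply: eq_bigr => b _.
rewrite -mulmxA mxE (bigD1 b) //= big1 ?addr0 => [|c /negPf cb].
  rewrite mxE (bigD1 a) //= big1 ?addr0 => [|c /negPf ca].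
    by rewrite !mxE !eqxx mul1r.
  by rewrite !mxE eqxx ca mul0r.
by rewrite mxE big1 ?mulr0 // => c' _; rewrite !mxE cb mul0r.
Qed.

(** With [(r g)^T] in place of [(r g)^h], the sums over the group intertwine the conjugate
    representation with [r]; a nonzero one would make the two characters equal. *)
Lemma fs_indicator_nonreal phi : is_irr phi -> phi != [ffun g => (phi g)^*] ->
  fs_indicator phi = 0.
Proof.
case=> n [r [n0 ur sr ->]] nre; rewrite fs_indicatorE // big1 ?mulr0 // => a _.
rewrite big1 // => b _; set Y := \sum_g _.
have urc := urep_conj ur.
have Yi : intertwines (fun g => (r g)^cj) r Y.
  have := intertwines_sum (delta_mx b a) urc ur.
  by under eq_bigr do rewrite adjmxE conjmxK.
have src : simple_rep (fun g => (r g)^cj).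
  move=> X Xi; have [|c cE] := sr X^cj.
    by move=> g; rewrite -[r g]conjmxK -!conjmxM Xi.
  by exists c^*; rewrite -[X]conjmxK cE map_scalar_mx.
have [->|Y0] := eqVneq Y 0; first by rewrite mxE.
case/eqP: nre; rewrite -{1}(simple_intertwines_char urc ur src sr Yi Y0).
by apply/ffunP=> g; rewrite !ffunE trace_map_mx.
Qed.

(** The structure gives [(r g)^T = J^h *m (r g)^h *m J], which turns the sums over the group into
    the scalar ones of Schur's lemma. There remains the trace of [J^h *m J^T] divided by the
    dimension, which is the sign. *)
Lemma fs_indicator_form e phi : is_irr phi -> has_form e phi ->
  fs_indicator phi = sg e.
Proof.
case=> n0 [r0 [n0_gt0 ur0 sr0 phiE]] [n [r [J [F phiE']]]].
have [ur J1 Je Jr] := F; rewrite phiE'.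
have [|P [P1 P2 Pi]] := same_character_iso ur ur0; first by rewrite -phiE -phiE'.
have n_gt0 : n%:R != 0 :> C by rewrite -(character1 ur) -phiE' phiE character1 //
  pnatr_eq0 -lt0n.
have sr : simple_rep r.
  move=> X Xi; have [|c cE] := sr0 (P *m X *m P^h).
    exact: (intertwines_comp (intertwines_adj ur ur0 Pi) (intertwines_comp Xi Pi)).
  exists c; have := congr1 (fun Z => P^h *m Z *m P) cE.
  rewrite !mulmxA P1 mul1mx -mulmxA P1 mulmx1 => ->.
  by rewrite mul_mx_scalar -scalemxAl P1 scalemx1.
have YE a b : (\sum_g r g *m delta_mx b a *m (r g)^T) a b =
    #|gT|%:R / n%:R * (J^h a b * J a b).
  have -> : \sum_g r g *m delta_mx b a *m (r g)^T =
      (\sum_g r g *m (delta_mx b a *m J^h) *m (r g)^h) *m J.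
    rewrite mulmx_suml; apply: eq_bigr => g _.
    have rc : (r g)^cj = J^h *m r g *m J.
      by rewrite (form_conj_adj g F) -mulmxA (mulmx1C J1) mulmx1.
    have rT : (r g)^T = J^h *m (r g)^h *m J.
      transitivity (r g)^cj^h; first by rewrite (adjmxE (r g)^cj) conjmxK.
      by rewrite rc !adjmxM adjmxK mulmxA.
    by rewrite {1}rT !mulmxA.
  set X := delta_mx b a *m J^h.
  have [c cE] := sr _ (intertwines_sum X ur ur).
  rewrite cE mul_scalar_mx mxE mulrA; congr (_ * _).
  have := congr1 mxtrace cE; rewrite mxtrace_scalar raddf_sum /=.
  under eq_bigr do rewrite mxtrace_mulC mulmxA urepVr // mul1mx.
  rewrite sumr_const.
  have -> : \tr X = J^h a b.
    rewrite /X /mxtrace (bigD1 b) //= big1 ?addr0 => [|x /negPf xb].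
      rewrite mxE (bigD1 a) //= big1 ?addr0 => [|x /negPf xa].
        by rewrite !mxE !eqxx mul1r.
      by rewrite mxE xa andbF mul0r.
    by rewrite mxE big1 // => y _; rewrite mxE xb mul0r.
  rewrite -[c *+ n]mulr_natr => /esym/(canRL (mulfK n_gt0)) ->.
  by rewrite -[_ *+ _]mulr_natl mulrAC.
rewrite fs_indicatorE //; under eq_bigr do under eq_bigr do rewrite YE.
under eq_bigr do rewrite -mulr_sumr; rewrite -mulr_sumr !mulrA.
rewrite mulVf ?card_neq0 // mul1r.
have -> : \sum_i \sum_i0 J^h i i0 * J i i0 = \tr (J^h *m J^T).
  by apply: eq_bigr => i _; rewrite mxE; apply: eq_bigr => j _; rewrite [J^T _ _]mxE.
rewrite [X in _ *m X](form_tr J1 Je) -scalemxAr (mulmx1C J1) mxtraceZ mxtrace1.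
by rewrite mulrCA mulVf // mulr1.
Qed.

Lemma fs_indicator_regrep : fs_indicator (character (@regrep C gT)) = #|[set g : gT
  | (g * g == 1)%g]|%:R.
Proof.
rewrite /fs_indicator -sum1_card natr_sum mulr_sumr big_mkcond [RHS]big_mkcond /=.
apply: eq_bigr => g _; rewrite inE character_regrep.
by case: eqP => _; rewrite ?mul0r ?mulr0 // mul1r mulVf // card_neq0.
Qed.

Definition irr_form e (i : Irr C gT) : bool := `[< has_form e (chi i) >].

Lemma irr_form_excl i : irr_form true i -> irr_form false i -> False.
Proof.
move=> /asboolP iT /asboolP iF.
have := has_form_even iT (chi_irr i) iF (m := 1).
by move=> /(_ _)/negP; apply=> //; rewrite cfdot_chi eqxx.
Qed.

Lemma irr_form_self_dual i :
  (irr_form true i || irr_form false i) = (chi i == [ffun g => (chi i g)^*]).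
Proof.
apply/orP/eqP => [|re].
  by case=> /asboolP /has_form_real re; apply/ffunP=> g; rewrite ffunE re.
have [|[] Fi] := has_form_self_dual (chi_irr i).
- by move=> g; rewrite [in RHS]re ffunE.
- by left; apply/asboolP.
- by right; apply/asboolP.
Qed.

(** The indicator of the regular character is computed twice: on group elements, and through its
    decomposition with multiplicities [deg]. *)
Lemma fs_count : (\sum_(i | irr_form false i) deg i =
  \sum_(i | irr_form true i) deg i + #|[set g : gT | (g * g == 1)%g]|)%N.
Proof.
apply/eqP; rewrite -(@eqr_nat C) natrD -fs_indicator_regrep -sum_deg_chi.
have -> : fs_indicator (\sum_i chi i *+ deg i) = \sum_i fs_indicator (chi i) * (deg
  i)%:R.
  rewrite /fs_indicator; under [RHS]eq_bigr do rewrite -mulrA mulr_suml.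
  rewrite -mulr_sumr exchange_big /=; congr (_ * _); apply: eq_bigr => g _.
  by rewrite sum_ffunE; apply: eq_bigr => i _; rewrite ffunMnE mulr_natr.
rewrite !natr_sum big_mkcond /= [X in _ == X + _]big_mkcond -big_split /=.
apply/eqP; apply: eq_bigr => i _.
have [t|t] := boolP (irr_form true i); have [f|f] := boolP (irr_form false i).
- by case: (irr_form_excl t f).
- by move/asboolP: t => /(fs_indicator_form (chi_irr i)) ->; rewrite mulN1r subrr.
- by move/asboolP: f => /(fs_indicator_form (chi_irr i)) ->; rewrite mul1r add0r.
- rewrite fs_indicator_nonreal ?mul0r ?addr0 //; first exact: chi_irr.
  by rewrite -irr_form_self_dual negb_or t f.
Qed.

End Forms.

(** * Representations of finite subgroups of SU(2) *)

Section Characters.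
Variables (C : numClosedFieldType) (gT : finGroupType).
Implicit Types (i j : Irr C gT).

Lemma chi_char i : is_char (chi i).
Proof. exact/is_irr_char/chi_irr. Qed.

Lemma simple_rep1 (r : gT -> 'M[C]_1) : simple_rep r.
Proof. by move=> X _; exists (X 0 0); rewrite [LHS]mx11_scalar. Qed.

Lemma triv_irr : is_irr (1 : {ffun gT -> C}).
Proof.
exists 1%N, (fun=> 1%:M); split=> //.
- by split=> [g h|g]; rewrite ?adjmx1 mulmx1.
- exact: simple_rep1.
- by apply/ffunP=> g; rewrite !ffunE mxtrace1.
Qed.

Definition triv : Irr C gT := projT1 (cid (irr_chi triv_irr)).
Lemma chi_triv : chi triv = 1.
Proof. by rewrite /triv; case: cid. Qed.
Lemma deg_triv : deg triv = 1%N.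
Proof. by apply/eqP; rewrite -(@eqr_nat C) -chi1 chi_triv ffunE. Qed.

Lemma triv_form : irr_form false triv.
Proof.
apply/asboolP; exists 1%N, (fun=> 1%:M), 1%:M; split.
  split=> [|||g]; rewrite ?adjmx1 ?conjmx1 ?mulmx1 ?expr0 //.
  by split=> [g h|g]; rewrite ?adjmx1 mulmx1.
by rewrite chi_triv; apply/ffunP=> g; rewrite !ffunE mxtrace1.
Qed.

Lemma is_irr_conj phi : is_irr phi -> is_irr ([ffun g => (phi g)^*] : {ffun gT ->
  C}).
Proof.
move=> [n [r [n0 ur sr ->]]]; exists n, (fun g => (r g)^cj); split=> //.
- exact: urep_conj.
- move=> X Xi; have [|c cE] := sr X^cj.
    by move=> g; rewrite -[r g]conjmxK -!conjmxM Xi.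
  by exists c^*; rewrite -[X]conjmxK cE map_scalar_mx.
- by apply/ffunP=> g; rewrite !ffunE trace_map_mx.
Qed.

Definition dual i : Irr C gT := projT1 (cid (irr_chi (is_irr_conj (chi_irr i)))).
Lemma chi_dual i g : chi (dual i) g = (chi i g)^*.
Proof. by rewrite /dual; case: cid => j /= <-; rewrite ffunE. Qed.
Lemma dualK : involutive dual.
Proof. by move=> i; apply/chi_inj/ffunP=> g; rewrite !chi_dual conjCK. Qed.
Lemma deg_dual i : deg (dual i) = deg i.
Proof.
by apply/eqP; rewrite -(@eqr_nat C) -!chi1 chi_dual chi1 conjC_nat.
Qed.

Lemma dual_fix i : (dual i == i) = irr_form false i || irr_form true i.
Proof.
rewrite orbC irr_form_self_dual -(inj_eq (@chi_inj C gT)) eq_sym; congr (_ == _).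
by apply/ffunP=> g; rewrite chi_dual ffunE.
Qed.

(** In size 1 the product [J *m J^cj] is a squared modulus, which cannot be -1. *)
Lemma deg1_not_quat i : deg i = 1%N -> irr_form true i = false.
Proof.
move=> d1; apply/negP => /asboolP[n [r [J [[ur J1 Je Jr] cE]]]].
have n1 : n = 1%N by apply/eqP; rewrite -(@eqr_nat C) -(character1 ur) -cE chi1 d1.
subst n; have := congr1 (fun M : 'M_1 => M 0 0) Je.
rewrite !mxE big_ord1 !mxE eqxx mulr1n expr1 => h.
by have := mul_conjC_ge0 (J 0 0); rewrite h oppr_ge0 ler10.
Qed.

Lemma chi_lin_mul i g h : deg i = 1%N -> chi i (g * h)%g = chi i g * chi i h.
Proof.
rewrite chiE; move: (irr_rep_urep i); move: (irr_rep i).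
move: (deg i) => d r [rM _] d1; subst d.
by rewrite !ffunE rM [r g]mx11_scalar [r h]mx11_scalar -scalar_mxM !mxtrace_scalar
  !mulr1n.
Qed.

Lemma chi_lin_norm i g : deg i = 1%N -> chi i g * (chi i g)^* = 1.
Proof.
rewrite chiE; move: (irr_rep_urep i); move: (irr_rep i).
move: (deg i) => d r [_ rU] d1; subst d.
have := congr1 (fun M : 'M_1 => M 0 0) (rU g).
by rewrite !ffunE /mxtrace !big_ord1 !mxE big_ord1 !mxE.
Qed.

(** All operators of the representation are scalars, so every matrix is an intertwiner; by
    simplicity every matrix is then a scalar. *)
Lemma abelian_deg1 i : (forall g h : gT, g * h = h * g)%g -> deg i = 1%N.
Proof.
move=> ab; have ur := irr_rep_urep i; have sr := @irr_rep_simple _ _ i.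
have scal g : exists a, irr_rep i g = a%:M.
  by apply: sr => h; rewrite -!(proj1 ur) ab.
have all_scal X : exists a, X = a%:M :> 'M[C]_(deg i).
  by apply: sr => g; have [a ->] := scal g; rewrite scalar_mxC.
have := deg_gt0 i; case E: (deg i) => [|[|n]] // _.
have {}all_scal (X : 'M[C]_n.+2) : exists a, X = a%:M by rewrite -E in X *.
have [a /matrixP aE] := all_scal (delta_mx 0 0).
have := aE 0 0; have := aE 1 1; rewrite !mxE !eqxx !mulr1n => <- /eqP.
by rewrite oner_eq0.
Qed.

End Characters.

(** * Finite groups embedded in SU(2) *)

Section SU2.
Variables (C : numClosedFieldType) (gT : finGroupType) (Q : gT -> 'M[C]_2).
Hypothesis uQ : urep Q.
Hypothesis dQ : forall g, \det (Q g) = 1.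
Hypothesis Q_inj : injective Q.
Implicit Types (i j : Irr C gT).

Let qc : {ffun gT -> C} := character Q.

Lemma Q_adj g : (Q g)^h = \adj (Q g).
Proof.
have := mul_mx_adj (Q g); rewrite dQ => H.
by rewrite -[LHS]mulmx1 -H mulmxA urepVr // mul1mx.
Qed.

Lemma adj2E (A : 'M[C]_2) : [/\ (\adj A) 0 0 = A 1 1, (\adj A) 1 1 = A 0 0,
  (\adj A) 0 1 = - A 0 1 & (\adj A) 1 0 = - A 1 0].
Proof.
have L (i : 'I_2) : lift i (0 : 'I_1) = (if i == 0 then 1 else 0).
  by apply/val_inj; case: i => [[|[|]]].
rewrite !mxE /cofactor !det_mx11 !mxE !L /=.
by split; rewrite -signr_odd /= ?expr0 ?expr1 ?mul1r ?mulN1r.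
Qed.

Lemma ord2P (P : 'I_2 -> Prop) : P 0 -> P 1 -> forall k, P k.
Proof.
by move=> P0 P1 [[|[|//]] hi]; [move: P0|move: P1]; congr (P _); apply/val_inj.
Qed.

Lemma mxtrace2 (A : 'M[C]_2) : \tr A = A 0 0 + A 1 1.
Proof.
by rewrite /mxtrace !big_ord_recl big_ord0 addr0; congr (_ + A _ _); apply/val_inj.
Qed.

(** Cayley-Hamilton in size 2 with determinant 1: the inverse is the adjugate, and a matrix plus its
    adjugate is its trace. *)
Lemma Q_add_inv g : Q g + Q g^-1%g = (qc g)%:M.
Proof.
rewrite urepV // Q_adj; have [a00 a11 a01 a10] := adj2E (Q g).
apply/matrixP; apply: ord2P; apply: ord2P;
  rewrite mxE ?a00 ?a11 ?a01 ?a10 !mxE ffunE mxtrace2 ?mulr1n ?mulr0n ?subrr //.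
by rewrite addrC.
Qed.

Lemma qc_real g : (qc g)^* = qc g.
Proof.
have : qc g + qc g^-1%g = qc g *+ 2.
  by have := congr1 mxtrace (Q_add_inv g);
    rewrite mxtraceD mxtrace_scalar /qc !ffunE.
by rewrite /qc characterV // mulr2n => /addrI.
Qed.

Lemma qc1 : qc 1%g = 2.
Proof. exact: character1. Qed.

Lemma qc_form : has_form true qc.
Proof.
exists 2%N, Q; pose J : 'M[C]_2 := \matrix_(i, j)
  (if (i == 0) && (j == 1) then 1 else if (i == 1) && (j == 0) then -1 else 0).
exists J; split=> //.
have J01 : [/\ J 0 0 = 0, J 1 1 = 0, J 0 1 = 1 & J 1 0 = -1] by rewrite !mxE.
have [J00 J11 J1 J10] := J01.
have sum2 (F : 'I_2 -> C) : \sum_i F i = F 0 + F 1.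
  by rewrite !big_ord_recl big_ord0 addr0; congr (_ + F _); apply/val_inj.
split=> //.
- apply/matrixP; apply: ord2P; apply: ord2P;
    rewrite mxE sum2 ![J^h _ _]mxE ![J^T _ _]mxE ?(J00, J11, J1, J10) mxE /=;
    by rewrite ?rmorph0 ?rmorphN ?rmorph1 /=; ring.
- apply/matrixP; apply: ord2P; apply: ord2P;
    rewrite mxE sum2 ![J^cj _ _]mxE ?(J00, J11, J1, J10) mxE /=;
    by rewrite ?rmorph0 ?rmorphN ?rmorph1 /=; ring.
- move=> g; have [a00 a11 a01 a10] := adj2E (Q g).
  have cE (i' j' : 'I_2) : (Q g)^cj i' j' = (\adj (Q g)) j' i' by rewrite -Q_adj
    !mxE.
  apply/matrixP; apply: ord2P; apply: ord2P;
    rewrite mxE sum2 [RHS]mxE sum2 !cE ?(J00, J11, J1, J10) ?(a00, a11, a01, a10);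
    by ring.
Qed.

(** For D = Q(g) - 1 the product of D^h and D is 2 - (Q(g) + Q(g)^-1), that is 2 minus the trace of
    Q(g). *)
Lemma qc_ker g : qc g = 2 -> g = 1%g.
Proof.
move=> q2; apply: Q_inj; rewrite urep1 //; apply/eqP; rewrite -subr_eq0; apply/eqP.
apply: herm_sq_eq0; rewrite [_^T]linearB map_mxB /= adjmx1 mulmxBl !mulmxBr urepVr
  //.
rewrite mul1mx !mulmx1 opprB addrACA -opprD [_ + Q g]addrC -urepV // Q_add_inv q2.
by rewrite -raddfD /= subrr.
Qed.

Lemma qc_eq0 g : qc g = 0 -> Q (g * g)%g = - 1%:M.
Proof.
move=> q0; have := Q_add_inv g; rewrite q0 raddf0 => /eqP;
  rewrite addr_eq0 => /eqP e.
by rewrite (proj1 uQ) {2}e mulmxN -(proj1 uQ) mulgV urep1.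
Qed.

Lemma involution_eq g : (g * g)%g = 1%g -> g = 1%g \/ Q g = - 1%:M.
Proof.
move=> gg; have gV : g^-1%g = g by apply/eqP; rewrite eq_invg_mul gg.
have := Q_add_inv g; rewrite gV -mulr2n => e.
have {}e : Q g = (qc g / 2)%:M.
  rewrite mulrC -scale_scalar_mx -e -scaler_nat scalerA mulVf ?scale1r //.
  by rewrite pnatr_eq0.
have : (qc g / 2) ^+ 2 = 1.
  have := congr1 (fun A : 'M_2 => A 0 0) (proj1 uQ g g).
  by rewrite gg urep1 // e -scalar_mxM !mxE eqxx !mulr1n expr2.
move/eqP; rewrite sqrf_eq1 => /orP[]/eqP h; rewrite h in e; [left|right].
  by apply: Q_inj; rewrite e urep1.
by rewrite e raddfN.
Qed.

Lemma card_involutions : (#|[set g : gT | (g * g == 1)%g]| <= 2)%N.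
Proof.
have [|h] := pselect (exists z, Q z = - 1%:M).
  move=> [z zE]; apply: leq_trans (_ : #|[set 1%g; z]| <= 2)%N; last first.
    by rewrite cards2; case: eqP.
  apply/subset_leq_card/fintype.subsetP=> g;
    rewrite !inE => /eqP /involution_eq[->|e].
    by rewrite eqxx.
  by rewrite orbC (Q_inj (etrans e (esym zE))) eqxx.
apply: leq_trans (_ : #|[set 1%g : gT]| <= 2)%N; last by rewrite cards1.
apply/subset_leq_card/fintype.subsetP=> g;
  rewrite !inE => /eqP /involution_eq[->|e] //.
by case: h; exists g.
Qed.

Lemma card_involutions_gt0 : (0 < #|[set g : gT | (g * g == 1)%g]|)%N.
Proof. by apply/card_gt0P; exists 1%g; rewrite inE mulg1. Qed.

(** A reducible [Q] splits into two orthogonal lines, so its matrices are diagonal in a common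
    basis; injectivity carries commutation back to the group. *)
Lemma not_simple_abelian : ~ simple_rep Q -> forall g h : gT, (g * h = h * g)%g.
Proof.
move=> nsQ g h; have [k [V [k0 V1 Vr sV]]] := simple_subrep uQ isT.
have [uV Vi] := subrep_urep uQ V1 Vr.
have k1 : k = 1%N.
  have := isom_le V1.
  case: k k0 V V1 Vr sV uV Vi => [|[|[|k]]] // _ V V1 Vr sV uV Vi _.
  case: nsQ => X Xi; have V2 := mulmx1C V1.
  have [|c cE] := sV (V^h *m X *m V).
    move=> x; rewrite -mulmxA Vi mulmxA -(mulmxA V^h) Xi !mulmxA.
    by rewrite -(intertwines_adj uV uQ Vi) -!mulmxA.
  exists c; have := congr1 (fun Z => V *m Z *m V^h) cE.
  rewrite !mulmxA V2 mul1mx -mulmxA V2 mulmx1 => ->.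
  by rewrite mul_mx_scalar -scalemxAl V2 scalemx1.
subst k; have [l [W [[W1 WE] kl uW Wi _]]] := character_split uV uQ V1 Vi.
have {kl} l1 : l = 1%N by case: kl => ->.
subst l; have QE x : Q x = V *m subrep Q V x *m V^h + W *m subrep Q W x *m W^h.
  by rewrite Vi Wi -!mulmxA -mulmxDr WE addrC subrK mulmx1.
have s1 (A B : 'M[C]_1) : A *m B = B *m A.
  by rewrite [A]mx11_scalar scalar_mxC.
apply: Q_inj; rewrite QE [RHS]QE (proj1 uV) (proj1 uW).
by rewrite [in RHS](proj1 uV) [in RHS](proj1 uW) (s1 (subrep Q V g)) (s1 (subrep Q W
  g)).
Qed.

Local Notation Re := (@irr_form C gT false).
Local Notation Qu := (@irr_form C gT true).
Local Notation dg := (@deg C gT).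
Let r := nb_real_lin dg Re.

Lemma abelian_real_count : (forall g h : gT, (g * h = h * g)%g) ->
  #|Re| = #|[set g : gT | (g * g == 1)%g]|.
Proof.
move=> ab; have := fs_count C gT.
have -> : (\sum_(i | Qu i) dg i = 0)%N.
  by rewrite big1 // => i; rewrite deg1_not_quat // abelian_deg1.
rewrite add0n => <-; rewrite -sum1_card; apply: eq_bigr => i _.
by rewrite abelian_deg1.
Qed.

(** All degrees are 1 and no character is symplectic, so the claim is (1 + x)^r - (1 - x)^r = 2 r x.
    It holds because r, the number of solutions of g^2 = 1, is 1 or 2. *)
Lemma abelian_odd_part : (forall g h : gT, (g * h = h * g)%g) ->
  odd_part_identity dg Re Qu.
Proof.
move=> ab A x; have d1 i : dg i = 1%N by apply: abelian_deg1.
have rE : r = #|Re| by apply: eq_card => i; rewrite !inE d1 eqxx andbT.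
have RE y : realprod dg Re y = (1 + y) ^+ r.
  rewrite rE /realprod (eq_bigr (fun=> 1 + y)) ?prodr_const // => i _.
  by rewrite d1 expr1.
have -> : quatprod dg Qu x = 1.
  by rewrite /quatprod big1 // => i; rewrite deg1_not_quat.
rewrite !RE -[nb_real_lin _ _]/r; have := card_involutions;
  have := card_involutions_gt0.
rewrite -abelian_real_count // -rE.
by case: r => [|[|[|]]] // _ _; ring.
Qed.

End SU2.

(** * The McKay graph of [Q] *)

Section McKayGraph.
Variables (C : numClosedFieldType) (gT : finGroupType) (Q : gT -> 'M[C]_2).
Hypothesis uQ : urep Q.
Hypothesis dQ : forall g, \det (Q g) = 1.
Hypothesis Q_inj : injective Q.
Implicit Types (i j : Irr C gT).

Local Notation qc := (character Q).

Lemma qc_char : is_char qc. Proof. by exists 2%N, Q. Qed.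

Definition adj_mult i : Irr C gT -> nat :=
  projT1 (cid (character_decomp (is_charM (chi_char i) qc_char))).

Lemma adj_multE i : chi i * qc = \sum_j chi j *+ adj_mult i j.
Proof. by rewrite /adj_mult; case: cid. Qed.

Lemma cfdot_adj i j : cfdot (chi i * qc) (chi j) = (adj_mult i j)%:R.
Proof. by rewrite adj_multE cfdot_sum_chi. Qed.

Lemma cfdot_mulqr phi psi : cfdot phi (psi * qc) = cfdot (phi * qc) psi.
Proof.
congr (_ * _); apply: eq_bigr => g _.
rewrite [(psi * qc) g]ffunE [(phi * qc) g]ffunE rmorphM /= (qc_real uQ dQ).
by rewrite mulrA mulrAC.
Qed.

Lemma adj_mult_sym i j : adj_mult i j = adj_mult j i.
Proof.
apply/eqP; rewrite -(@eqr_nat C) -!cfdot_adj -cfdot_mulqr cfdot_conj cfdot_adj.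
by rewrite conjC_nat.
Qed.

Lemma adj_mult_deg i : (\sum_j deg j * adj_mult i j = 2 * deg i)%N.
Proof.
apply/eqP; rewrite -(@eqr_nat C) natr_sum natrM -chi1.
have := congr1 (fun f : {ffun gT -> C} => f 1%g) (adj_multE i).
rewrite [LHS]ffunE (qc1 uQ) mulrC => ->; rewrite sum_ffunE.
by apply/eqP/eq_bigr => j _; rewrite ffunMnE chi1 natrM mulr_natr.
Qed.

Definition nbr i : seq (Irr C gT) :=
  flatten [seq nseq (adj_mult i j) j | j <- enum {: Irr C gT}].

Lemma count_nbr i j : count_mem j (nbr i) = adj_mult i j.
Proof.
rewrite /nbr count_flatten -map_comp sumnE big_map big_enum /=.
rewrite (bigD1 j) //= count_nseq /= eqxx mul1n big1 ?addn0 // => k /negPf kj.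
by rewrite count_nseq /= kj.
Qed.

Lemma mem_nbr i j : (j \in nbr i) = (adj_mult i j != 0%N).
Proof. by rewrite -has_pred1 has_count count_nbr lt0n. Qed.

Lemma sum_deg_nbr i : sumn (map (@deg C gT) (nbr i)) = (2 * deg i)%N.
Proof.
rewrite -adj_mult_deg /nbr map_flatten sumn_flatten -2!map_comp sumnE big_map.
rewrite big_enum; apply: eq_bigr => j _ /=.
by rewrite map_nseq sumn_nseq.
Qed.

Lemma adj_mult_dual i j : adj_mult (dual i) (dual j) = adj_mult i j.
Proof.
apply/eqP; rewrite -(@eqr_nat C) -!cfdot_adj.
have -> : cfdot (chi (dual i) * qc) (chi (dual j)) = (cfdot (chi i * qc) (chi j))^*.
  rewrite /cfdot rmorphM fmorphV rmorph_nat rmorph_sum; congr (_ * _).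
  apply: eq_bigr => g _; rewrite rmorphM ![(_ * qc) g]ffunE rmorphM /=.
  by rewrite !chi_dual (qc_real uQ dQ).
by rewrite cfdot_adj conjC_nat.
Qed.

Lemma nbr_dual i j : j \in nbr i -> dual j \in nbr (dual i).
Proof. by rewrite !mem_nbr adj_mult_dual. Qed.

(* If S is closed under adjacency then phi = \sum_(j in S) deg j * chi j satisfies
   phi * Q = 2 phi, so it vanishes off 1: it is a multiple of the regular
   character. *)
Lemma nbr_conn (S : {pred Irr C gT}) : triv C gT \in S ->
  (forall i j, i \in S -> j \in nbr i -> j \in S) -> forall i, i \in S.
Proof.
move=> S0 Snb i; pose phi : {ffun gT -> C} := \sum_(j in S) chi j *+ deg j.
have phiq : phi * qc = phi *+ 2.
  have -> : phi * qc = \sum_(j in S) \sum_k chi k *+ (adj_mult j k * deg j).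
    apply/ffunP=> g; rewrite ffunE /phi !sum_ffunE mulr_suml.
    apply: eq_bigr => j _; rewrite ffunMnE mulrnAl.
    have := congr1 (fun f : {ffun gT -> C} => f g) (adj_multE j).
    rewrite ffunE => ->; rewrite !sum_ffunE -sumrMnl; apply: eq_bigr => k _.
    by rewrite !ffunMnE mulrnA.
  rewrite exchange_big /= /phi -sumrMnl [RHS]big_mkcond /=.
  apply: eq_bigr => k _; rewrite sumrMnr; case: ifP => kS.
    rewrite -mulrnA mulnC -adj_mult_deg big_mkcond /=; congr (_ *+ _).
    apply: eq_bigr => j _; rewrite mulnC adj_mult_sym; case: ifP => // jS.
    have := contraFN (@Snb k j kS) jS; rewrite mem_nbr negbK => /eqP->.
    by rewrite muln0.
  rewrite big1 ?mulr0n // => j jS.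
  have := contraFN (@Snb j k jS) kS; rewrite mem_nbr negbK => /eqP->.
  by rewrite mul0n.
have phi0 g : g != 1%g -> phi g = 0.
  move=> g1; have := congr1 (fun f : {ffun gT -> C} => f g) phiq.
  rewrite ffunE ffunMnE -mulr_natr => /eqP; rewrite -subr_eq0 -mulrBr mulf_eq0.
  move=> /orP[/eqP//|]; rewrite subr_eq0 => /eqP /(qc_ker uQ dQ Q_inj) ge.
  by rewrite ge eqxx in g1.
have phi1 : phi 1%g != 0.
  rewrite sum_ffunE; under eq_bigr do rewrite ffunMnE chi1 -mulrnA.
  rewrite -natr_sum pnatr_eq0 (bigD1 (triv C gT)) //= deg_triv.
  by rewrite addn_eq0.
have : cfdot phi (chi i) != 0.
  rewrite /cfdot (bigD1 1%g) //= big1 => [|g g1]; last by rewrite phi0 // mul0r.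
  rewrite addr0 chi1 conjC_nat !mulf_neq0 ?invr_eq0 ?card_neq0 //.
  by rewrite pnatr_eq0 -lt0n deg_gt0.
apply: contraNT => iS; rewrite /phi cfdot_sumDl big1 // => j jS.
have -> : cfdot (chi j *+ deg j) (chi i) = cfdot (chi j) (chi i) *+ deg j.
  rewrite /cfdot -mulrnAr -sumrMnl; congr (_ * _); apply: eq_bigr => g _.
  by rewrite ffunMnE mulrnAl.
rewrite cfdot_chi (_ : j == i = false) ?mul0rn //.
by apply: contraNF iS => /eqP <-.
Qed.

(** The product of [chi i] with the symplectic [Q] has sign [~~ e], and there an irreducible
    character of sign [e] has even multiplicity. Being self-dual, [chi j] has one of the two
    signs. *)
Lemma nbr_flip e i j : irr_form e i -> dual j = j -> odd (count_mem j (nbr i)) ->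
  irr_form (~~ e) j.
Proof.
rewrite count_nbr => /asboolP Fi dj.
have Fq := has_formM Fi (qc_form uQ dQ); rewrite addbT in Fq.
apply: contraLR => nF; have Fj : irr_form e j.
  move/eqP: dj; rewrite dual_fix; case: (e) nF => /= /negPf->; rewrite ?orbF //.
have cE := cfdot_adj i j; move/asboolP: Fj => Fj.
by apply: has_form_even Fq (chi_irr j) _ cE; rewrite negbK.
Qed.

Section Simple.
Hypothesis sQ : simple_rep Q.

Lemma qc_irr : is_irr qc. Proof. by exists 2%N, Q. Qed.
Definition std_irr : Irr C gT := projT1 (cid (irr_chi qc_irr)).
Lemma chi_qi : chi std_irr = qc.
Proof. by rewrite /std_irr; case: cid. Qed.

Lemma nbr_triv : perm_eq (nbr (triv C gT)) [:: std_irr].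
Proof.
apply/allP => i _ /=; rewrite count_nbr addn0; apply/eqP/eqP.
by rewrite -(@eqr_nat C) -cfdot_adj chi_triv mul1r -chi_qi cfdot_chi.
Qed.

Lemma primitive_odd_part :
  (forall a, a \in nbr std_irr -> deg a = 1%N -> a = triv C gT) ->
  odd_part_identity (@deg C gT) (irr_form false) (irr_form true).
Proof.
move=> nolin.
apply: (@mckay_odd_part _ _ nbr (@dual C gT) _ _ (triv C gT) std_irr _ _ _ _ _ _ _ _
  _ _ _ _ _ _ _ (fs_count C gT)).
- exact: deg_gt0.
- exact: deg_triv.
- by move=> i j; rewrite !count_nbr adj_mult_sym.
- exact: sum_deg_nbr.
- exact: nbr_triv.
- exact: nbr_conn.
- exact: deg_dual.
- exact: nbr_dual.
- exact: dualK.
- exact: dual_fix.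
- by move=> i iF iT; apply: irr_form_excl iT iF.
- exact: triv_form.
- by move=> i j; apply: nbr_flip.
- by move=> i j; apply: nbr_flip.
- exact: card_involutions_gt0.
- exact: nolin.
Qed.

End Simple.
End McKayGraph.

(** * Restriction to a subgroup *)

Section Restriction.
Variables (C : numClosedFieldType) (gT : finGroupType) (H : {group gT}).
Local Notation hT := (subg_of H).

Definition res_rep n (r : gT -> 'M[C]_n) (h : hT) := r (sgval h).
Definition res_char (phi : {ffun gT -> C}) : {ffun hT -> C} :=
  [ffun h => phi (sgval h)].

Lemma res_urep n (r : gT -> 'M[C]_n) : urep r -> urep (res_rep r).
Proof. by move=> ur; split=> [g h|g]; [exact: (proj1 ur)|exact: (proj2 ur)]. Qed.

Lemma character_res n (r : gT ->
  'M[C]_n) : character (res_rep r) = res_char (character r).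
Proof. by apply/ffunP=> h; rewrite !ffunE. Qed.

Lemma res_is_char phi : is_char phi -> is_char (res_char phi).
Proof.
by move=> [n [r [ur ->]]]; exists n, (res_rep r); rewrite character_res;
  split=> //; apply: res_urep.
Qed.

Lemma res_form e phi : has_form e phi -> has_form e (res_char phi).
Proof.
move=> [n [r [J [[ur J1 Je Jr] ->]]]]; exists n, (res_rep r), J;
  rewrite character_res.
split=> //; split=> // [|h]; [exact: res_urep|exact: Jr].
Qed.

Lemma sum_subg (V : nmodType) (F : gT -> V) :
  \sum_(h : hT) F (sgval h) = \sum_(g in H) F g.
Proof.
rewrite [RHS](reindex_onto (@sgval gT H) (@subg gT H)) /=; last first.
  by move=> g gH; rewrite subgK.
by apply: eq_bigl => h; rewrite subgP sgvalK eqxx.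
Qed.

Lemma card_subg_of : #|{: hT}| = #|H|.
Proof. by rewrite -!sum1_card; exact: (sum_subg (fun=> 1%N)). Qed.

Lemma cfdot_res (phi psi : {ffun gT -> C}) :
  cfdot (res_char phi) (res_char psi) = #|H|%:R^-1 * \sum_(g in H) phi g * (psi g)^*.
Proof.
rewrite /cfdot card_subg_of -sum_subg; congr (_ * _).
by apply: eq_bigr => h _; rewrite !ffunE.
Qed.

End Restriction.

(** * A nontrivial linear character [a] in the square of [Q] *)

Section Dicyclic.
Variables (C : numClosedFieldType) (gT : finGroupType) (Q : gT -> 'M[C]_2).
Hypothesis uQ : urep Q.
Hypothesis dQ : forall g, \det (Q g) = 1.
Hypothesis Q_inj : injective Q.
Hypothesis sQ : simple_rep Q.
Implicit Types (i j : Irr C gT).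
Variable a : Irr C gT.
Hypothesis a_nb : a \in nbr uQ (std_irr uQ sQ).
Hypothesis da : deg a = 1%N.
Hypothesis a_nt : a != triv C gT.

Local Notation qc := (character Q).
Local Notation q := (std_irr uQ sQ).

(** The product has degree 2 and contains the irreducible [Q], itself of degree 2. *)
Lemma lin_fix_qc : chi a * qc = qc.
Proof.
have aq : adj_mult uQ a q != 0%N by rewrite (adj_mult_sym uQ dQ) -mem_nbr.
have dq : deg q = 2%N.
  by apply/eqP; rewrite -(@eqr_nat C) -chi1 chi_qi qc1.
have := adj_mult_deg uQ a; rewrite da (bigD1 q) //= dq muln1 => e.
have [m1 m0] : adj_mult uQ a q = 1%N /\ (\sum_(i | i != q) deg i * adj_mult uQ a i =
  0)%N.
  by move: aq e; set m := adj_mult uQ a q; set S := (\sum_(i | _) _)%N;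
    clearbody m S; clear; lia.
rewrite adj_multE (bigD1 q) //= m1 mulr1n chi_qi big1 ?addr0 // => i iq.
move/eqP: m0; rewrite sum_nat_eq0 => /forallP/(_ i); rewrite iq muln_eq0.
by rewrite -leqn0 leqNgt deg_gt0 => /eqP->.
Qed.

Lemma lin_eq1 g : qc g != 0 -> chi a g = 1.
Proof.
move=> q0; have := congr1 (fun f : {ffun gT -> C} => f g) lin_fix_qc.
by rewrite ffunE => e; apply: (mulIf q0); rewrite mul1r.
Qed.

(** If the trace of [Q g] is zero then [Q (g * g)] is -1, of nonzero trace, so [chi a] is 1 at
    [g * g]. *)
Lemma lin_val g : chi a g = 1 \/ (chi a g = -1 /\ qc g = 0).
Proof.
have [q0|/lin_eq1] := eqVneq (qc g) 0; last by left.
have : chi a (g * g)%g = 1.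
  apply: lin_eq1; rewrite ffunE (qc_eq0 uQ dQ q0) raddfN /= mxtrace1.
  by rewrite oppr_eq0 pnatr_eq0.
rewrite chi_lin_mul // -expr2 => /eqP; rewrite sqrf_eq1.
by case/orP=> /eqP->; [left|right].
Qed.

Lemma lin_ker_group : group_set [set g | chi a g == 1].
Proof.
apply/group_setP; split=> [|g h]; rewrite !inE.
  by rewrite chi1 da.
by rewrite chi_lin_mul // => /eqP-> /eqP->; rewrite mulr1.
Qed.
Definition lin_ker := group lin_ker_group.
Local Notation H := lin_ker.
Local Notation hT := (subg_of H).

Lemma sum_lin : \sum_g chi a g = 0.
Proof.
have := cfdot_chi a (triv C gT); rewrite (negPf a_nt) /cfdot chi_triv => /eqP.
rewrite mulf_eq0 invr_eq0 (negPf (card_neq0 C gT)) /= => /eqP e; rewrite -[RHS]e.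
by apply: eq_bigr => g _; rewrite ffunE rmorph1 mulr1.
Qed.

Lemma lin_ker_index : #|gT| = (2 * #|H|)%N.
Proof.
have : \sum_g chi a g = #|H|%:R - #|~: H|%:R.
  rewrite (bigID (mem H)) /= -!sum1_card !natr_sum -sumrN; congr (_ + _).
    by apply: eq_bigr => g; rewrite inE => /eqP.
  apply: eq_big => g; first by rewrite !inE.
  by rewrite inE; have [->|[-> _]] := lin_val g; rewrite ?eqxx.
rewrite sum_lin => /esym/eqP; rewrite subr_eq0 eqr_nat => /eqP e.
by rewrite -(cardsC H) -e mul2n addnn.
Qed.

Lemma lin_nonker : exists x, x \notin H.
Proof.
have : (0 < #|~: H|)%N.
  have := cardsC H; rewrite lin_ker_index => h.
  by have := cardG_gt0 H; lia.
by case/card_gt0P=> x; rewrite inE; exists x.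
Qed.

Lemma sum_ker_le i : \sum_(g in H) chi i g * (chi i g)^* <= #|gT|%:R :> C.
Proof.
have e : \sum_g chi i g * (chi i g)^* = #|gT|%:R.
  have h : cfdot (chi i) (chi i) = 1 by rewrite cfdot_chi eqxx.
  apply: (mulfI (invr_neq0 (card_neq0 C gT))).
  by rewrite -[LHS]/(cfdot _ _) h mulVf // card_neq0.
rewrite -[leRHS]e [leRHS](bigID (mem H)) /= lerDl sumr_ge0 // => g _.
exact: mul_conjC_ge0.
Qed.

Let QH := res_rep (H := H) Q.

(** The trace of [Q] vanishes off the kernel, which has index 2. The restricted character thus has
    inner product 2 with itself and is reducible. *)
Lemma QH_abelian : forall g h : hT, (g * h = h * g)%g.
Proof.
apply: (@not_simple_abelian C _ QH).
- exact: res_urep.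
- by move=> g h /Q_inj/val_inj.
- move=> sQH; have := cfdot_simple (res_urep H uQ) sQH isT.
  rewrite character_res cfdot_res.
  have -> : \sum_(g in H) qc g * (qc g)^* = #|gT|%:R.
    apply: (mulfI (invr_neq0 (card_neq0 C gT))); rewrite mulVf ?card_neq0 //.
    have := cfdot_simple uQ sQ isT; rewrite /cfdot (bigID (mem H)) /=.
    rewrite [X in _ * (_ + X)]big1 ?addr0 // => g.
    by rewrite inE; have [->|[_ ->]] := lin_val g; rewrite ?eqxx // mul0r.
  rewrite lin_ker_index natrM mulrCA mulVf ?mulr1 => [/eqP|].
    by rewrite (eqr_nat C 2 1).
  by rewrite pnatr_eq0 -lt0n cardG_gt0.
Qed.

(** On the abelian kernel the character is a sum of linear ones with multiplicities [m j]. The sum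
    of the squares of the [m j] is at most the index 2, and it bounds their sum, the degree. *)
Lemma dicyclic_deg i : (deg i <= 2)%N.
Proof.
have [m mE] := character_decomp (res_is_char H (chi_char i)).
have d1 (j : Irr C hT) : deg j = 1%N by apply: abelian_deg1 QH_abelian.
have degE : deg i = (\sum_j m j)%N.
  apply/eqP; rewrite -(@eqr_nat C) -chi1 natr_sum.
  have := congr1 (fun f : {ffun hT -> C} => f 1%g) mE.
  rewrite ffunE => ->; rewrite sum_ffunE; apply/eqP/eq_bigr => j _.
  by rewrite ffunMnE chi1 d1.
have normE : cfdot (res_char H (chi i)) (res_char H (chi i)) = (\sum_j m j ^ 2)%:R.
  rewrite {1}mE cfdot_sumDl natr_sum; apply: eq_bigr => j _.
  have -> : cfdot (chi j *+ m j) (res_char H (chi i)) = cfdot (chi j) (res_char H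
    (chi i)) *+ m j.
    rewrite /cfdot -mulrnAr -sumrMnl; congr (_ * _); apply: eq_bigr => g _.
    by rewrite ffunMnE mulrnAl.
  by rewrite cfdot_conj mE cfdot_sum_chi conjC_nat -mulrnA mulnn.
have : (\sum_j m j ^ 2 <= 2)%N.
  rewrite -(@ler_nat C) -normE cfdot_res.
  have H0 : 0 < #|H|%:R :> C by rewrite ltr0n cardG_gt0.
  rewrite ler_pdivrMl // mulrC -natrM -lin_ker_index.
  exact: sum_ker_le.
apply: leq_trans; rewrite degE; apply: leq_sum => j _.
by case: (m j) => // n; rewrite -mulnn leq_pmulr.
Qed.

Local Notation Re := (@irr_form C gT false).
Local Notation Qu := (@irr_form C gT true).

(** A real linear character is determined by its restriction to the kernel and its sign at one [x]
    outside. The restrictions are orthogonal characters of an abelian subgroup of SU(2), of which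
    there are at most two. *)
Lemma dicyclic_nb_real_lin : (nb_real_lin (@deg C gT) Re <= 4)%N.
Proof.
have [x xH] := lin_nonker.
have res_irr i : deg i = 1%N -> is_irr (res_char H (chi i)).
  rewrite chiE; move: (irr_rep_urep i); move: (irr_rep i).
  move: (deg i) => d s us d1; subst d; rewrite -character_res.
  by exists 1%N, (res_rep s); split=> //; [exact: res_urep|exact: simple_rep1].
pose rst i : Irr C hT := odflt (triv C hT) [pick j | chi j == res_char H (chi i)].
have rstE i : deg i = 1%N -> chi (rst i) = res_char H (chi i).
  move=> /res_irr/irr_chi[j jE]; rewrite /rst; case: pickP => [k /eqP//|/(_ j)].
  by rewrite jE eqxx.
pose f i := (rst i, chi i x == 1).
have sq1 i : Re i -> deg i = 1%N -> forall g, chi i g = 1 \/ chi i g = -1.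
  move=> /asboolP Ri d1 g; have := chi_lin_norm g d1.
  rewrite (has_form_real Ri) -expr2 => /eqP; rewrite sqrf_eq1.
  by case/orP=> /eqP; [left|right].
have f_inj : {in [pred i | Re i && (deg i == 1%N)] &, injective f}.
  move=> i j /andP[Ri /eqP di] /andP[Rj /eqP dj] [rij xij].
  have xE : chi i x = chi j x.
    move: xij; have [->|->] := sq1 _ Ri di x; have [->|->] := sq1 _ Rj dj x => //.
      by rewrite eqxx => /esym/eqP.
    by rewrite eqxx => /eqP.
  have hE g : g \in H -> chi i g = chi j g.
    move=> gH; have := congr1 (fun f : {ffun hT -> C} => f (subg H g)) (rstE i di).
    by rewrite rij rstE // !ffunE subgK.
  apply/chi_inj/ffunP=> g; have [/hE//|gH] := boolP (g \in H).
  rewrite -[g](mulKVg x) (chi_lin_mul _ _ di) (chi_lin_mul _ _ dj) xE hE //.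
  have nK y : y \notin H -> chi a y = -1.
    by rewrite inE; have [->|[-> _]] := lin_val y; rewrite ?eqxx.
  have xV : chi a x^-1%g = -1.
    by apply: nK; rewrite groupV.
  by rewrite inE (chi_lin_mul _ _ da) xV (nK g gH) mulrNN mulr1.
rewrite /nb_real_lin -(card_in_imset f_inj).
apply: leq_trans (_ : #|finset.setX [set j : Irr C hT | irr_form false j] [set:
  bool]| <= _)%N.
  apply/subset_leq_card/fintype.subsetP=> y /imsetP[i /andP[Ri /eqP di] ->].
  rewrite finset.in_setX !finset.inE andbT /f /=; apply/asboolP; rewrite rstE //.
  by apply: res_form; apply/asboolP.
rewrite cardsX cardsT card_bool -[4%N]/(2 * 2)%N leq_mul2r /=.
rewrite cardsE abelian_real_count; last exact: QH_abelian.
apply: (@card_involutions C _ QH); [exact: res_urep|by move=> ?; exact: dQ|].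
by move=> g h /Q_inj/val_inj.
Qed.

Lemma dicyclic_involutions : #|[set g : gT | (g * g == 1)%g]| = 2%N.
Proof.
apply/eqP; rewrite eqn_leq (card_involutions uQ dQ Q_inj) /=.
have [x xH] := lin_nonker.
have Qz : Q (x * x)%g = - 1%:M.
  apply: (qc_eq0 uQ dQ); move: xH; rewrite inE.
  by have [->|[_ ->]] := lin_val x; rewrite ?eqxx.
have z1 : (x * x)%g != 1%g.
  apply/eqP => h; move: Qz; rewrite h urep1 // => /(congr1 (fun A : 'M_2 => A 0 0)).
  rewrite !mxE eqxx mulr1n => /eqP; rewrite -addr_eq0.
  by rewrite (pnatr_eq0 C 2).
apply: leq_trans (_ : #|[set 1%g; (x * x)%g]| <= _)%N.
  by rewrite cards2 eq_sym z1.
apply/subset_leq_card/fintype.subsetP=> g; rewrite !inE => /orP[]/eqP->.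
  by rewrite mulg1.
apply/eqP/Q_inj; rewrite (proj1 uQ) Qz mulNmx mulmxN opprK mulmx1.
by rewrite urep1.
Qed.

(** Let r and p count the orthogonal characters of degree 1 and 2, and q' the symplectic ones, all
    of degree 2. The Frobenius-Schur count r + 2p = 2q' + 2 and 0 < r <= 4 leave r = 2, p = q' or r
    = 4, q' = p + 1. In the second case the extra factor comes from (1 + y)^4 - (1 - y)^4 = 8 y (1 +
    y^2). *)
Lemma dicyclic_odd_part : odd_part_identity (@deg C gT) Re Qu.
Proof.
move=> A y; pose p := #|[pred i | Re i && (deg i == 2%N)]|;
  pose r := nb_real_lin (@deg C gT) Re.
have d12 i : deg i = 1%N \/ deg i = 2%N.
  by have := dicyclic_deg i; have := deg_gt0 i; lia.
have Q2 i : Qu i -> deg i = 2%N.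
  by move=> Qi; have [/deg1_not_quat h|//] := d12 i; rewrite h in Qi.
pose q' := #|Qu|.
have eqp : [pred i | Re i && (deg i != 1%N)] =i [pred i | Re i && (deg i == 2%N)].
  by move=> i; rewrite !inE; congr (_ && _); have [->|->] := d12 i.
have prodR z : realprod (@deg C gT) Re z = (1 + z) ^+ r * (1 + z ^+ 2) ^+ p :> A.
  rewrite /realprod (bigID (fun i => deg i == 1%N)) /=; congr (_ * _).
    by rewrite (eq_bigr (fun=> 1 + z)) ?prodr_const // => i /andP[_ /eqP->].
  rewrite (eq_bigr (fun=> 1 + z ^+ 2)) => [|i /andP[_]];
    last by have [->|->] := d12 i.
  by rewrite prodr_const (eq_card eqp).
have prodQ : quatprod (@deg C gT) Qu y = (1 + y ^+ 2) ^+ q'.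
  by rewrite /quatprod (eq_bigr (fun=> 1 + y ^+ 2)) ?prodr_const // => i /Q2->.
have cnt : (r + p * 2 = q' * 2 + 2)%N.
  have e : (\sum_(i | Qu i) deg i = q' * 2)%N.
    by rewrite (eq_bigr (fun=> 2%N)) ?sum_nat_const.
  have := fs_count C gT; rewrite dicyclic_involutions e => <-.
  rewrite (bigID (fun i => deg i == 1%N)) /=; congr (_ + _)%N.
    rewrite (eq_bigr (fun=> 1%N)) => [|i /andP[_ /eqP->] //].
    by rewrite sum_nat_const muln1.
  rewrite (eq_bigr (fun=> 2%N)) => [|i /andP[_]]; last by have [->|->] := d12 i.
  by rewrite sum_nat_const (eq_card eqp).
have r_gt0 : (0 < r)%N.
  by apply/card_gt0P; exists (triv C gT); rewrite !inE triv_form deg_triv.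
rewrite !prodR prodQ -[nb_real_lin _ _]/r.
have : (r = 2 /\ p = q' \/ r = 4 /\ q' = p.+1)%N.
  by move: cnt r_gt0 dicyclic_nb_real_lin; rewrite -[nb_real_lin _ _]/r; clear; lia.
rewrite sqrrN => -[[-> ->]|[-> ->]].
  by set u := (1 + y ^+ 2) ^+ q'; clearbody u; ring.
by rewrite [_ ^+ p.+1]exprS; set u := (1 + y ^+ 2) ^+ p; clearbody u; ring.
Qed.

End Dicyclic.

Section Main.
Variables (C : numClosedFieldType) (gT : finGroupType) (Q : gT -> 'M[C]_2).
Hypothesis uQ : urep Q.
Hypothesis dQ : forall g, \det (Q g) = 1.
Hypothesis Q_inj : injective Q.

Theorem su2_odd_part : odd_part_identity (@deg C gT) (irr_form false) (irr_form
  true).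
Proof.
have [sQ|nsQ] := pselect (simple_rep Q); last first.
  exact: (abelian_odd_part uQ dQ Q_inj (not_simple_abelian uQ Q_inj nsQ)).
have [[a [a_nb da a_nt]]|no] := pselect (exists a : Irr C gT,
    [/\ a \in nbr uQ (std_irr uQ sQ), deg a = 1%N & a != triv C gT]).
  exact: (dicyclic_odd_part dQ Q_inj a_nb da a_nt).
apply: (primitive_odd_part dQ Q_inj (sQ := sQ)) => a a_nb da; apply/eqP.
by apply: contrapT => /negP a_nt; apply: no; exists a.
Qed.

End Main.

(** * Counting structured representations *)

Section Multiplicities.
Variables (C : numClosedFieldType) (gT : finGroupType).
Local Notation irr := (Irr C gT).
Implicit Types (i j : irr) (e : bool) (E : {set irr}).
Local Notation deg := (@deg C gT).

Definition sym_mult (c : irr -> nat) : Prop :=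
  (forall i, c (dual i) = c i) /\ (forall i, dual i = i -> ~~ odd (c i)).

(** The rank in the enumeration selects one member of each dual pair; on self-dual characters the
    even value is halved. *)
Lemma sym_multP c : sym_mult c -> exists h : irr -> nat,
  forall i, c i = (h i + h (dual i))%N.
Proof.
move=> [cd ce]; pose rk i : nat := enum_rank i.
exists (fun i => if dual i == i then (c i)./2
                 else if (rk i < rk (dual i))%N then c i else 0%N) => i.
rewrite dualK [i == _]eq_sym cd; case: eqP => [di|ndi].
  by rewrite addnn -[LHS]odd_double_half (negPf (ce i di)).
case: (ltngtP (rk i)) => [||/val_inj/enum_rank_inj /esym/ndi//].
  by rewrite addn0.
by rewrite add0n.
Qed.

Definition multchar (c : irr -> nat) E : {ffun gT -> C} :=
  \sum_i chi i *+ (c i + (i \in E)).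

Lemma multcharE c h E : (forall i, c i = (h i + h (dual i))%N) ->
  multchar c E = \sum_(i in E) chi i + \sum_i (chi i + chi (dual i)) *+ h i.
Proof.
move=> cE; rewrite /multchar; under eq_bigr do rewrite mulrnDr cE mulrnDr.
rewrite !big_split /= addrC; congr (_ + _).
  rewrite [RHS]big_mkcond /=; apply: eq_bigr => i _.
  by case: (i \in E); rewrite ?mulr0n ?mulr1n.
under [RHS]eq_bigr do rewrite mulrnDl; rewrite big_split /=; congr (_ + _).
rewrite [LHS](reindex_inj (inv_inj (@dualK C gT))); apply: eq_bigr => i _.
by rewrite dualK.
Qed.

Lemma has_form_sum e I (s : seq I) (P : pred I) (F : I -> {ffun gT -> C}) :
  (forall k, P k -> has_form e (F k)) -> has_form e (\sum_(i <- s | P i) F i).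
Proof.
by move=> FP; apply: big_ind FP; [exact: has_form0|move=> x y; apply: has_formD].
Qed.

Lemma has_form_muln e phi n : has_form e phi ->
  has_form e (phi *+ n : {ffun gT -> C}).
Proof.
move=> Fp; elim: n => [|n IHn]; first by rewrite mulr0n; apply: has_form0.
by rewrite mulrS; apply: has_formD.
Qed.

Lemma multchar_form e c E : sym_mult c -> (forall i, i \in E -> irr_form e i) ->
  has_form e (multchar c E).
Proof.
move=> /sym_multP[h hE] EF; rewrite (multcharE _ hE); apply: has_formD.
  by apply: has_form_sum => i /EF/asboolP.
apply: has_form_sum => i _; apply: has_form_muln.
have -> : chi (dual i) = [ffun g => (chi i g)^*].
  by apply/ffunP=> g; rewrite ffunE chi_dual.
exact/has_form_double/chi_char.
Qed.

Lemma cfdot_multchar c E i : cfdot (multchar c E) (chi i) = (c i + (i \in E))%:R.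
Proof. exact: cfdot_sum_chi. Qed.

Definition weight (c : irr -> nat) := (\sum_i deg i * c i)%N.
Definition set_weight E := (\sum_(i in E) deg i)%N.

Lemma multchar1 c E : multchar c E 1%g = (weight c + set_weight E)%:R.
Proof.
rewrite sum_ffunE natrD !natr_sum /set_weight [X in _ = _ + X]big_mkcond /=.
rewrite -big_split /=; apply: eq_bigr => i _;
  rewrite ffunMnE chi1 mulrnDr natrM mulr_natr.
by case: (i \in E); rewrite ?mulr0n ?mulr1n.
Qed.

Lemma weight_even c : sym_mult c -> exists t, weight c = t.*2.
Proof.
move=> /sym_multP[h hE]; exists (\sum_i deg i * h i)%N; rewrite /weight.
under eq_bigr do rewrite hE mulnDr; rewrite big_split /= -addnn; congr (_ + _)%N.
rewrite [LHS](reindex_inj (inv_inj (@dualK C gT))); apply: eq_bigr => i _.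
by rewrite dualK deg_dual.
Qed.

Lemma irr_form_dual e i : irr_form e (dual i) = irr_form e i.
Proof.
have H k : irr_form e k -> irr_form e (dual k).
  by move=> Fk; have /eqP-> // : dual k == k; rewrite dual_fix; case: (e) Fk => ->;
    rewrite ?orbT.
by apply/idP/idP => /H //; rewrite dualK.
Qed.

(** Parity separates [E] from [c]: [E] collects the characters of sign [e] with odd multiplicity,
    and those of the opposite sign have even multiplicity by [has_form_even]. *)
Lemma form_multchar e phi : has_form e phi -> exists c E,
  [/\ sym_mult c, forall i, i \in E -> irr_form e i & phi = multchar c E].
Proof.
move=> Fp; have [m mE] := character_decomp (has_form_char Fp).
have mdot i : cfdot phi (chi i) = (m i)%:R by rewrite mE cfdot_sum_chi.
have md i : m (dual i) = m i.
  apply/eqP; rewrite -(@eqr_nat C) -!mdot; apply/eqP.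
  transitivity (cfdot phi (chi i))^*; last by rewrite mdot conjC_nat.
  rewrite /cfdot rmorphM fmorphV rmorph_nat rmorph_sum; congr (_ * _).
  by apply: eq_bigr => g _; rewrite rmorphM /= (has_form_real Fp) chi_dual.
have mo i : irr_form (~~ e) i -> ~~ odd (m i).
  by move=> /asboolP Fi; apply: has_form_even Fp (chi_irr i) Fi (mdot i).
exists (fun i => m i - (irr_form e i && odd (m i)))%N,
  [set i | irr_form e i && odd (m i)].
split.
- split=> i; first by rewrite md irr_form_dual.
  move=> di; have [Fi|nFi] := boolP (irr_form e i) => /=.
    rewrite oddB ?oddb ?addbb //.
    by case: (m i) => // k; case: odd.
  rewrite subn0; apply: mo; move/eqP: di; rewrite dual_fix.
  by case: (e) nFi => /= /negPf ->; rewrite ?orbF.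
- by move=> i; rewrite inE => /andP[].
- rewrite mE; apply: eq_bigr => i _; congr (_ *+ _); rewrite inE subnK //.
  by case: (irr_form e i) => //=; case: (m i) => // k; case: odd.
Qed.

Lemma multchar_inj e c c' E E' :
  sym_mult c -> sym_mult c' -> (forall i, i \in E -> irr_form e i) ->
  (forall i, i \in E' -> irr_form e i) -> multchar c E = multchar c' E' ->
  c =1 c' /\ E = E'.
Proof.
move=> [_ ce] [_ ce'] EF EF' eqm.
have H i : (c i + (i \in E) = c' i + (i \in E'))%N.
  by apply/eqP; rewrite -(@eqr_nat C) -!cfdot_multchar eqm.
have HE i : (i \in E) = (i \in E').
  have [iE|iE] := boolP (i \in E); have [iE'|iE'] := boolP (i \in E') => //.
    have /eqP di : dual i == i by rewrite dual_fix; case: (e) (EF i iE) => ->;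
      rewrite ?orbT.
    have := congr1 odd (H i); rewrite !oddD (negPf (ce i di)) (negPf (ce' i di)).
    by rewrite iE (negPf iE').
  have /eqP di : dual i == i by rewrite dual_fix; case: (e) (EF' i iE') => ->;
    rewrite ?orbT.
  have := congr1 odd (H i); rewrite !oddD (negPf (ce i di)) (negPf (ce' i di)).
  by rewrite iE' (negPf iE).
split; last by apply/setP.
by move=> i; have := H i; rewrite HE => /addIn.
Qed.

Definition irr_det i g := \det (irr_rep i g).

Lemma det_of_character n m (r : gT -> 'M[C]_n) (s : gT -> 'M_m) g :
  urep r -> urep s -> character r = character s -> \det (r g) = \det (s g).
Proof.
move=> ur us rs; have [P [P1 P2 Pi]] := same_character_iso ur us rs.
have nm : n = m by apply/eqP; rewrite -(@eqr_nat C) -(character1 ur) rs character1.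
subst m; have : s g = P *m r g *m P^h by rewrite Pi -mulmxA P2 mulmx1.
by move=> ->; rewrite det_mulmx mulrC -det_mulmx mulmxA P1 mul1mx.
Qed.

Lemma irr_detM i g h : irr_det i (g * h)%g = irr_det i g * irr_det i h.
Proof. by rewrite /irr_det (proj1 (irr_rep_urep i)) det_mulmx. Qed.

Lemma irr_det_dual i g : irr_det (dual i) g = (irr_det i g)^*.
Proof.
rewrite /irr_det -det_map_mx; apply: (@det_of_character _ _ _ (fun g =>
  (irr_rep i g)^cj)).
- exact: irr_rep_urep.
- exact/urep_conj/irr_rep_urep.
- apply/ffunP=> x; rewrite -chiE chi_dual chiE [RHS]ffunE trace_map_mx.
  by rewrite ffunE.
Qed.

Lemma irr_det_norm i g : irr_det i g * (irr_det i g)^* = 1.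
Proof.
rewrite /irr_det -det_map_mx -[\det (_^cj)]det_tr map_trmx -det_mulmx.
by rewrite (proj2 (irr_rep_urep i)) det1.
Qed.

(** The part coming from [c] is a sum of pairs [chi i + chi (dual i)], whose determinants are
    conjugate of modulus 1 and cancel; only [E] contributes. *)
Lemma det_multchar c E n (r : gT -> 'M[C]_n) g : sym_mult c -> urep r ->
  character r = multchar c E -> \det (r g) = \prod_(i in E) irr_det i g.
Proof.
move=> sc ur rE; have [h hE] := sym_multP sc; rewrite (multcharE _ hE) in rE.
pose K (phi : {ffun gT -> C}) (D : C) :=
  exists n (s : gT -> 'M_n), [/\ urep s, character s = phi & \det (s g) = D].
have K0 : K 0 1.
  exists 0%N, (fun=> 0); split; last by rewrite det_mx00.
    by split=> [x y|x]; apply/matrixP=> -[].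
  by apply/ffunP=> x; rewrite !ffunE /mxtrace big_ord0.
have KD phi psi D D' : K phi D -> K psi D' -> K (phi + psi) (D * D').
  move=> [n1 [s1 [us1 <- <-]]] [n2 [s2 [us2 <- <-]]].
  exists (n1 + n2)%N, (fun x => block_mx (s1 x) 0 0 (s2 x)); split.
  - exact: block_urep.
  - exact: character_block.
  - by rewrite det_ublock.
have Kchi i : K (chi i) (irr_det i g).
  by exists (deg i), (irr_rep i); split; rewrite ?chiE //; exact: irr_rep_urep.
have Kn phi m : K phi 1 -> K (phi *+ m) 1.
  move=> K1; elim: m => [|m IHm]; first by rewrite mulr0n.
  by rewrite mulrS -[1]mulr1; apply: (KD).
have KE : K (character r) (\prod_(i in E) irr_det i g).
  rewrite rE -[X in K _ X]mulr1; apply: (KD).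
    by apply: (big_ind2 K) => // *; apply: (KD).
  apply: (big_ind (fun phi => K phi 1)) => // [x y Kx Ky|i _].
    by rewrite -[1]mulr1; apply: (KD).
  by apply: Kn; rewrite -(irr_det_norm i g) -irr_det_dual; apply: (KD).
by have [m [s [us /esym /(det_of_character g ur us) -> ->]]] := KE.
Qed.

End Multiplicities.

(** * Generating functions of sets by total degree *)

Section Subsets.
Variables (I : finType) (d : I -> nat) (P : pred I).

Lemma prod_subsets (A : comNzRingType) (x : A) :
  \prod_(i | P i) (1 + x ^+ d i) =
  \sum_(E : {set I} | E \subset P) x ^+ (\sum_(i in E) d i).
Proof.
pose F i := if P i then x ^+ d i else 0.
transitivity (\prod_i (F i + 1)).
  rewrite big_mkcond; apply: eq_bigr => i _; rewrite /F.
  by case: (P i); rewrite ?add0r // addrC.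
rewrite bigA_distr [RHS]big_mkcond /=; apply: eq_bigr => E _.
rewrite -big_mkcond /=; case: ifPn => [/fintype.subsetP EP|/subsetPn[i iE nP]].
  by rewrite expr_sum; apply: eq_bigr => i /EP; rewrite /F unfold_in => ->.
by rewrite (bigD1 i) //= /F; move: nP; rewrite unfold_in => /negPf->; rewrite mul0r.
Qed.

Definition nb_subsets k := #|[set E : {set I} | (E \subset P) && (\sum_(i in E) d i
  == k)%N]|.

Lemma coef_prod_subsets (b : bool) k :
  (\prod_(i | P i) (1 + ((-1) ^+ b *: 'X) ^+ d i) : {poly int})`_k =
  (-1) ^+ (b * k) * (nb_subsets k)%:R.
Proof.
rewrite prod_subsets coef_sum /nb_subsets -sum1_card natr_sum mulr_sumr.
rewrite big_mkcond [RHS]big_mkcond /=; apply: eq_bigr => E _; rewrite inE.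
case: (E \subset P) => //=; rewrite exprZn coefZ coefXn eq_sym.
case: eqP => [->|_]; last by rewrite mulr0.
by rewrite -exprM.
Qed.
End Subsets.

(** * Twists by real linear characters and the condition on determinants *)

Section Count.
Variables (C : numClosedFieldType) (gT : finGroupType).
Local Notation irr := (Irr C gT).
Implicit Types (i j l : irr) (e : bool) (E : {set irr}).
Local Notation deg := (@deg C gT).

(** The coefficient of X^(2s+1) in the identity: on the left it is doubled because the exponent is
    odd, and the common factor 2 cancels over the integers. *)
Lemma nb_subsets_odd s : odd_part_identity deg (irr_form false) (irr_form true) ->
  nb_subsets deg (irr_form (C := C) (gT := gT) false) s.*2.+1 =
  (nb_real_lin deg (irr_form (C := C) (gT :=
    gT) false) * nb_subsets deg (irr_form (C := C) (gT := gT) true) s.*2)%N.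
Proof.
move=> /(_ {poly int} 'X) H; apply/eqP; rewrite -(@eqr_nat int) natrM.
have cR k : (realprod deg (irr_form false) ('X : {poly int}))`_k = (nb_subsets deg
  (irr_form false) k)%:R.
  by have := coef_prod_subsets deg (irr_form false) false k;
    rewrite mul0n expr0 scale1r mul1r.
have cRN k : (realprod deg (irr_form false) (- 'X : {poly int}))`_k =
    (-1) ^+ k * (nb_subsets deg (irr_form false) k)%:R.
  by have := coef_prod_subsets deg (irr_form false) true k;
    rewrite mul1n expr1 scaleN1r.
have cQ k : (quatprod deg (irr_form true) ('X : {poly int}))`_k = (nb_subsets deg
  (irr_form true) k)%:R.
  by have := coef_prod_subsets deg (irr_form true) false k;
    rewrite mul0n expr0 scale1r mul1r.
have := congr1 (fun p : {poly int} => p`_s.*2.+1) H.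
rewrite coefB cR cRN -natrM -!mulrA mulr_natl coefMn coefXM cQ /=.
rewrite -signr_odd /= odd_double expr1 mulN1r opprK -mulr2n.
by rewrite mulnC mulrnA => /(pmulrnI (isT : 0 < 2)%N) ->; rewrite mulr_natl.
Qed.

Local Notation L := [pred l | irr_form false l && (deg l == 1%N)].

Lemma lin_sq l g : l \in L -> chi l g * chi l g = 1.
Proof.
move=> /andP[/asboolP Fl /eqP dl].
by rewrite -[RHS](chi_lin_norm g dl) (has_form_real Fl).
Qed.

Lemma twist_irr l i : l \in L -> is_irr (chi l * chi i).
Proof.
move=> lL; have [/asboolP Fl /eqP dl] := andP lL.
have ur := irr_rep_urep i.
exists (deg i), (fun g => chi l g *: irr_rep i g); split.
- exact: deg_gt0.
- split=> [g h|g].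
    rewrite chi_lin_mul // (proj1 ur) -scalemxAl -scalemxAr scalerA.
    by [].
  rewrite adjmxZ -scalemxAl -scalemxAr scalerA chi_lin_norm // scale1r.
  exact: (proj2 ur).
- move=> X Xi; apply: (@irr_rep_simple _ _ i) => g.
  have c0 : chi l g != 0.
    by apply: contra_eq_neq (lin_sq g lL) => ->; rewrite mul0r eq_sym oner_eq0.
  by apply: (scalerI c0); rewrite scalemxAr Xi -scalemxAl.
- by apply/ffunP=> g; rewrite [LHS]ffunE [in LHS](chiE i) !ffunE mxtraceZ.
Qed.

(** The default [i] is never reached for [l] in [L], where the product is irreducible. *)
Definition twist l i : irr := odflt i [pick j | chi j == chi l * chi i].

Lemma chi_twist l i : l \in L -> chi (twist l i) = chi l * chi i.
Proof.
move=> lL; have [j jE] := irr_chi (@twist_irr l i lL); rewrite /twist.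
by case: pickP => [k /eqP//|/(_ j)]; rewrite jE eqxx.
Qed.

Lemma twistK l : l \in L -> involutive (twist l).
Proof.
move=> lL i; apply/chi_inj/ffunP=> g; rewrite chi_twist // ffunE chi_twist //.
by rewrite ffunE mulrA lin_sq // mul1r.
Qed.

Lemma deg_twist l i : l \in L -> deg (twist l i) = deg i.
Proof.
move=> lL; have [_ /eqP dl] := andP lL.
by apply/eqP; rewrite -(@eqr_nat C) -!chi1 chi_twist // ffunE (chi1 l) dl mul1r.
Qed.

Lemma irr_form_twist l i : l \in L -> irr_form false i -> irr_form false (twist l i).
Proof.
move=> lL /asboolP Fi; apply/asboolP; rewrite chi_twist //.
by have [/asboolP Fl _] := andP lL; apply: (has_formM Fl Fi).
Qed.

Lemma irr_det_twist l i g : l \in L ->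
  irr_det (twist l i) g = chi l g ^+ deg i * irr_det i g.
Proof.
move=> lL; have [_ /eqP dl] := andP lL; rewrite /irr_det -detZ.
apply: (@det_of_character _ _ _ _ _ (fun g => chi l g *: irr_rep i g)).
- exact: irr_rep_urep.
- have ur := irr_rep_urep i; split=> [x h|x].
    by rewrite chi_lin_mul // (proj1 ur) -scalemxAl -scalemxAr scalerA.
  rewrite adjmxZ -scalemxAl -scalemxAr scalerA chi_lin_norm // scale1r.
  exact: (proj2 ur).
- rewrite -chiE chi_twist //.
  by apply/ffunP=> x; rewrite [LHS]ffunE [in LHS](chiE i) !ffunE mxtraceZ.
Qed.

Definition set_det E g := \prod_(i in E) irr_det i g.
Local Notation SW E := (\sum_(i in E) deg i)%N.

(** The twist contributes [chi l g] to the power of the total degree; this is odd and [chi l g]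
    squares to 1, so one factor remains. *)
Lemma set_det_twist l E g : l \in L -> odd (SW E) ->
  set_det (twist l @: E) g = chi l g * set_det E g.
Proof.
move=> lL oE; rewrite /set_det big_imset /=; last first.
  by move=> i j _ _; apply: inv_inj; exact: twistK.
under eq_bigr do rewrite irr_det_twist //.
rewrite big_split /= prodrXr -[SW E]odd_double_half oE exprS -muln2 mulnC exprM.
by rewrite expr2 lin_sq // expr1n mulr1.
Qed.

Lemma SW_twist l E : l \in L -> SW (twist l @: E) = SW E.
Proof.
move=> lL; rewrite big_imset /=; last first.
  by move=> i j _ _; apply: inv_inj; exact: twistK.
by apply: eq_bigr => i _; rewrite deg_twist.
Qed.

Lemma sub_twist l E : l \in L -> E \subset irr_form (C := C) (gT := gT) false ->
  twist l @: E \subset irr_form (C := C) (gT := gT) false.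
Proof.
move=> lL /fintype.subsetP EF; apply/fintype.subsetP=> j /imsetP[i /EF Fi ->].
exact: irr_form_twist.
Qed.

Lemma twist_setK l E : l \in L -> twist l @: (twist l @: E) = E.
Proof.
move=> lL; rewrite -imset_comp -[RHS]imset_id; apply: eq_imset => i /=.
exact: twistK.
Qed.

(** Orthogonal characters are self-dual, so each determinant is real of modulus 1; the product over
    [E] is a homomorphism to {1, -1}. *)
Lemma set_det_lin E : E \subset irr_form (C := C) (gT := gT) false ->
  exists2 l, l \in L & forall g, set_det E g = chi l g.
Proof.
move=> /fintype.subsetP EF.
have sq g : set_det E g * set_det E g = 1.
  rewrite -big_split /= big1 // => i /EF Fi.
  have /eqP di : dual i == i by rewrite dual_fix (Fi : irr_form false i).
  by rewrite -[X in _ * irr_det X _]di irr_det_dual irr_det_norm.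
have re g : (set_det E g)^* = set_det E g.
  rewrite rmorph_prod; apply: eq_bigr => i /EF Fi.
  have /eqP di : dual i == i by rewrite dual_fix (Fi : irr_form false i).
  by rewrite /= -irr_det_dual di.
pose s g : 'M[C]_1 := (set_det E g)%:M.
have us : urep s.
  split=> [g h|g].
    rewrite /s -scalar_mxM; congr _%:M; rewrite -big_split /=.
    by apply: eq_bigr => i _; rewrite irr_detM.
  by rewrite /s tr_scalar_mx map_scalar_mx /= re -scalar_mxM sq.
have [|l lE] := @irr_chi _ _ (character s).
  by exists 1%N, s; split=> //; exact: simple_rep1.
exists l; last by move=> g; rewrite -lE ffunE mxtrace_scalar.
apply/andP; split; last by rewrite -(@eqr_nat C) -chi1 -lE character1.
apply/asboolP; exists 1%N, s, 1%:M; rewrite -lE; split=> //.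
split=> //; rewrite ?adjmx1 ?conjmx1 ?mulmx1 // => g.
by rewrite mulmx1 mul1mx /s map_scalar_mx /= re.
Qed.

Definition unimodular E := [forall g, set_det E g == 1].

Definition nb_unimodular_subsets k :=
  #|[set E : {set irr} | [&& E \subset irr_form (C := C) (gT := gT) false,
  unimodular E & SW E == k]]|.

(** Twisting a set of odd total degree by its own determinant makes it unimodular. Conversely the
    determinant of a twisted unimodular set recovers [l], and twisting again recovers the set. *)
Lemma nb_subsets_twist k : odd k ->
  nb_subsets deg (irr_form (C := C) (gT :=
    gT) false) k = (#|L| * nb_unimodular_subsets k)%N.
Proof.
move=> ok; rewrite /nb_subsets /nb_unimodular_subsets; set A := [set E | _ & _];
  set B := [set E | _].
pose f (p : irr * {set irr}) := twist p.1 @: p.2.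
have <- : f @: finset.setX [set l | l \in L] B = A.
  apply/setP=> E; apply/imsetP/idP => [[[l F] /=]|].
    rewrite finset.in_setX !finset.in_set /f /= =>
      /andP[lL /and3P[FS F1 /eqP FW]] ->.
    by rewrite sub_twist //= SW_twist // FW.
  rewrite finset.in_set => /andP[ES /eqP EW]; have [l lL lE] := set_det_lin ES.
  exists (l, twist l @: E); last by rewrite /f /= twist_setK.
  rewrite finset.in_setX !finset.in_set /= lL sub_twist //= SW_twist // EW eqxx
    andbT.
  apply/forallP=> g; rewrite set_det_twist ?EW // lE lin_sq //.
rewrite card_in_imset ?cardsX ?cardsE // => -[l F] [l' F'].
rewrite !finset.in_setX !finset.in_set /f /= => /andP[lL /and3P[FS F1 /eqP FW]].
move=> /andP[l'L /and3P[F'S F'1 /eqP F'W]] e.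
have ll' : l = l'.
  apply/chi_inj/ffunP=> g.
  have := set_det_twist g lL (E := F); rewrite FW => /(_ ok).
  have := set_det_twist g l'L (E := F'); rewrite F'W => /(_ ok).
  have /forallP/(_ g)/eqP -> := F1; have /forallP/(_ g)/eqP -> := F'1.
  by rewrite e !mulr1 => -> ->.
by subst l'; rewrite -[F](twist_setK F lL) e twist_setK.
Qed.

Lemma nb_unimodular_subsets_odd s : odd_part_identity deg (irr_form false) (irr_form
  true) ->
  nb_unimodular_subsets s.*2.+1 = nb_subsets deg (irr_form (C := C) (gT :=
    gT) true) s.*2.
Proof.
move=> /(nb_subsets_odd s); rewrite nb_subsets_twist /= ?odd_double // /nb_real_lin.
move/eqP; rewrite eqn_pmul2l => [/eqP//|].
by apply/card_gt0P; exists (triv C gT); rewrite !inE triv_form deg_triv.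
Qed.

Section Parametrization.
Variable B : nat.
Local Notation T := {ffun irr -> 'I_B}.

Definition csym (c : T) : bool :=
  [forall i, (c (dual i) == c i) && ((dual i == i) ==> ~~ odd (c i))].

Lemma csymP (c : T) : reflect (sym_mult (fun i => c i)) (csym c).
Proof.
apply: (iffP forallP) => [H|[H1 H2] i].
  split=> [i|i di]; first by have /andP[/eqP->] := H i.
  by have /andP[_ /implyP] := H i; apply; apply/eqP.
rewrite (_ : c (dual i) = c i) ?eqxx; last exact/val_inj/H1.
by apply/implyP => /eqP; apply: H2.
Qed.

(** The bound [B] makes the space of multiplicity functions finite; it is taken larger than the
    dimension [N], which bounds every multiplicity. *)
Definition mult_params (R : pred {set irr}) N := [set p : T * {set irr} |
  [&& csym p.1, R p.2 & weight (fun i => p.1 i) + SW p.2 == N]%N].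

Lemma card_mult_params R N : #|mult_params R N| =
  (\sum_(c : T | csym c && (weight (fun i => c i) <= N))
     #|[set E : {set irr} | R E & SW E == N - weight (fun i => c i)]|)%N.
Proof.
rewrite -sum1_card; under [RHS]eq_bigr do rewrite -sum1_card.
rewrite pair_big_dep /=; apply: eq_bigl => -[c E]; rewrite !inE /=.
case: (csym c) => //=; case: (R E); rewrite ?andbF //=.
move: (weight _) (SW E) => w s.
by apply/eqP/andP => [<-|[h /eqP ->]]; rewrite ?leq_addr ?addKn ?eqxx ?subnKC.
Qed.

End Parametrization.

Lemma card_mult_params_eq B n : odd_part_identity deg (irr_form false) (irr_form
  true) ->
  #|@mult_params B (fun E => E \subset irr_form true) n.*2| =
  #|@mult_params B (fun E => (E \subset irr_form false) && unimodular E) n.*2.+1|.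
Proof.
move=> H; rewrite !card_mult_params;
  apply: eq_big => [c|c /andP[/csymP/weight_even[t ->] le]].
  (* The weight is even, so being at most 2n and being at most 2n+1 are equivalent. *)
  case: csymP => //= /weight_even[t ->]; rewrite -!mul2n; lia.
rewrite leq_double in le; rewrite subSn ?leq_double // -doubleB.
rewrite -[RHS](_ : nb_unimodular_subsets (n - t).*2.+1 = _);
  last by apply: eq_card => E; rewrite !inE andbA.
exact/esym/nb_unimodular_subsets_odd.
Qed.

End Count.

(** * Conjugacy classes of homomorphisms *)

Lemma card_image_classes (T : finType) (U : choiceType) (P : {set T}) (f : T -> U)
    (A : set U) :
  {in P &, injective f} -> (forall y, A y <-> exists2 x, x \in P & y = f x) ->
  finite_set A /\ #|` fset_set A|%fset = #|P|.
Proof.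
move=> f_inj AE; pose F := [fset y in [seq f x | x in P]]%fset.
have -> : A = [set` F]%classic.
  apply/seteqP; split=> y /=.
    by move/AE=> [x xP ->]; rewrite in_fsetE; apply/mapP; exists x;
      rewrite ?mem_enum.
  by rewrite in_fsetE => /mapP[x]; rewrite mem_enum => xP ->; apply/AE; exists x.
split; first exact: finite_fset.
rewrite set_fsetK card_fseq undup_id ?size_map -?cardE //.
by rewrite map_inj_in_uniq ?enum_uniq // => x y; rewrite !mem_enum; apply: f_inj.
Qed.

(** * A finite subgroup as a finite group type *)

Section FsetGroup.
Variables (H : groupType) (Gamma : {fset H}).

(** The closure proof is an argument of the type so that the group structure can be attached to it
    as an instance. *)
Definition fgroup of group_closed (mem Gamma) : Type := Gamma.

Hypothesis gc : group_closed (mem Gamma).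
Local Notation gT := (fgroup gc).
HB.instance Definition _ := Finite.on gT.

Fact fgroup_one_subproof : (1%g : H) \in Gamma.
Proof. exact: (proj1 gc). Qed.
Fact fgroup_mul_subproof (x y : gT) : (val x * val y)%g \in Gamma.
Proof. exact: (group_closedM gc (fsvalP x) (fsvalP y)). Qed.
Fact fgroup_inv_subproof (x : gT) : (val x)^-1%g \in Gamma.
Proof. exact: (group_closedV gc (fsvalP x)). Qed.
Definition fgroup_one : gT := FSetSub fgroup_one_subproof.
Definition fgroup_mul (x y : gT) : gT := FSetSub (fgroup_mul_subproof x y).
Definition fgroup_inv (x : gT) : gT := FSetSub (fgroup_inv_subproof x).
Fact fgroup_mulA : associative fgroup_mul.
Proof. by move=> x y z; apply/val_inj; rewrite /= mulgA. Qed.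
Fact fgroup_mul1 : left_id fgroup_one fgroup_mul.
Proof. by move=> x; apply/val_inj; rewrite /= mul1g. Qed.
Fact fgroup_mulV : left_inverse fgroup_one fgroup_inv fgroup_mul.
Proof. by move=> x; apply/val_inj; rewrite /= mulVg. Qed.
HB.instance Definition _ := Finite_isGroup.Build gT fgroup_mulA fgroup_mul1
  fgroup_mulV.

Definition fgroup_val (x : gT) : H := val x.
Lemma fgroup_valM (x y : gT) : fgroup_val (x * y)%g = (fgroup_val x * fgroup_val
  y)%g.
Proof. by []. Qed.
Lemma fgroup_val_inj : injective fgroup_val.
Proof. exact: val_inj. Qed.
Lemma fgroup_val_in x : fgroup_val x \in Gamma.
Proof. exact: fsvalP. Qed.
Lemma fgroup_val_surj h : h \in Gamma -> exists x, fgroup_val x = h.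
Proof. by move=> hG; exists (FSetSub hG). Qed.
End FsetGroup.

Section StandardForm.
Variables (C : numClosedFieldType) (gT : finGroupType) (e : bool) (N : nat).
Variable J0 : 'M[C]_N.
Hypothesis J01 : J0 *m J0^h = 1%:M.
Hypothesis J0e : J0 *m J0^cj = ((-1) ^+ nat_of_bool e)%:M.

Lemma standard_form (phi : {ffun gT -> C}) : has_form e phi -> phi 1%g = N%:R ->
  exists r : gT -> 'M[C]_N, preserves_form e r J0 /\ character r = phi.
Proof.
case=> n [r [J [[ur J1 Je Jr] ->]]]; rewrite character1 // => /eqP.
rewrite eqr_nat => /eqP nN; subst n.
(* For the trivial action, [form_isometry] says that two structures of the same sign and dimension
   are isometric; the resulting [U] carries [J] to [J0]. *)
pose t (g : gT) := 1%:M : 'M[C]_N.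
have ut : urep t by split=> [g h|g]; rewrite /t ?adjmx1 mulmx1.
have Ft K : K *m K^h = 1%:M -> K *m K^cj = ((-1) ^+ nat_of_bool e)%:M ->
  preserves_form e t K.
  by move=> K1 Ke; split=> // g; rewrite /t conjmx1 mulmx1 mul1mx.
have [||U [U1 _ UJ]] := form_isometry (Ft _ J1 Je) (Ft _ J01 J0e) (P := 1%:M).
- by rewrite adjmx1 mulmx1.
- by move=> g; rewrite /t.
have U2 := mulmx1C U1.
exists (fun g => U *m r g *m U^h); split; last first.
  apply/ffunP=> g; rewrite !ffunE mxtrace_mulC mulmxA U2 mul1mx //.
split=> //.
- split=> [g h|g].
    by rewrite (proj1 ur) !mulmxA -(mulmxA _ U^h U) U2 mulmx1.
  by rewrite !adjmxM adjmxK !mulmxA -(mulmxA _ U^h U) U2 mulmx1 -(mulmxA U) (proj2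
    ur) mulmx1.
- move=> g; have UhJ : U^h *m J0 = J *m (U^h)^cj.
    have UT : U^cj *m U^h^cj = 1%:M by rewrite -conjmxM U1 conjmx1.
    by rewrite -[LHS]mulmx1 -UT !mulmxA -(mulmxA U^h) -UJ mulmxA U2 mul1mx.
  rewrite -mulmxA UhJ !conjmxM !mulmxA -(mulmxA U) Jr.

  by rewrite !mulmxA UJ.
Qed.
End StandardForm.

(** * Classes of homomorphisms into a group of isometries *)

Section Target.
Variables (C : numClosedFieldType) (H : groupType) (Gamma : {fset H}).
Hypothesis gc : group_closed (mem Gamma).
Local Notation gT := (fgroup gc).
Local Notation irr := (Irr C gT).
Variables (G : groupType) (e : bool) (N : nat) (mx : G -> 'M[C]_N) (J0 : 'M[C]_N).
Variables (D : pred 'M[C]_N) (RD : pred {set irr}).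
Hypothesis J01 : J0 *m J0^h = 1%:M.
Hypothesis J0e : J0 *m J0^cj = ((-1) ^+ nat_of_bool e)%:M.
Hypothesis mxM : forall x y, mx (x * y)%g = mx x *m mx y.
Hypothesis mx_unitary : forall x, mx x *m (mx x)^h = 1%:M.
Hypothesis mxJ : forall x, mx x *m J0 = J0 *m (mx x)^cj.
Hypothesis mx_inj : injective mx.
Hypothesis D_mx : forall x, D (mx x).
Hypothesis mx_surj : forall U, U *m U^h = 1%:M -> U *m J0 = J0 *m U^cj -> D U ->
  exists x, mx x = U.
Hypothesis mx_proj_surj : forall U, U *m U^h = 1%:M -> U *m J0 = J0 *m U^cj ->
  exists x (s : C), s != 0 /\ mx x = s *: U.
Hypothesis RD_P : forall (c : irr -> nat) (E : {set irr}) (r : gT -> 'M[C]_N),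
  sym_mult c -> (forall i, i \in E -> irr_form e i) -> urep r ->
  character r = multchar c E -> RD E <-> (forall g, D (r g)).

Definition hom_rep (f : H -> G) (g : gT) := mx (f (fgroup_val g)).

Lemma hom_rep_formed f : is_hom Gamma f -> preserves_form e (hom_rep f) J0.
Proof.
move=> fM; split=> [|//|//|g]; last exact: mxJ.
split=> [g h|g]; last exact: mx_unitary.
by rewrite /hom_rep fgroup_valM fM ?fgroup_val_in // mxM.
Qed.

(** Equal characters give an isometry compatible with [J0]. It comes from an element of [G] only up
    to a scalar, which conjugation does not see. *)
Lemma hom_conj_char f1 f2 : is_hom Gamma f1 -> is_hom Gamma f2 ->
  hom_conj Gamma f1 f2 <-> character (hom_rep f1) = character (hom_rep f2).
Proof.
move=> f1M f2M; have F1 := hom_rep_formed f1M; have F2 := hom_rep_formed f2M.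
have [ur1 _ _ _] := F1; have [ur2 _ _ _] := F2.
split=> [[x xE]|ce].
  apply: (@intertwines_iso_char _ _ _ _ _ _ (mx x)); last first.
  - by move=> g; rewrite /hom_rep xE ?fgroup_val_in // -!mxM mulgKV.
  - exact: mx_unitary.
  - exact/mulmx1C/mx_unitary.
have [P [P1 P2 Pi]] := same_character_iso ur1 ur2 ce.
have [U [U1 Ui UJ]] := form_isometry F1 F2 P2 Pi.
have [x [s [s0 xU]]] := mx_proj_surj U1 UJ.
exists x => h /(fgroup_val_surj gc)[g <-]; apply/(mulIg x); rewrite mulgKV.
by apply: mx_inj; rewrite !mxM xU -scalemxAl -scalemxAr Ui.
Qed.

Lemma hom_class_eq f1 f2 : is_hom Gamma f1 -> is_hom Gamma f2 ->
  hom_class Gamma f1 = hom_class Gamma f2 <->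
    character (hom_rep f1) = character (hom_rep f2).
Proof.
move=> f1M f2M; split=> [e12|e12].
  apply/hom_conj_char => //.
  have : hom_class Gamma f2 f2 by split=> //; apply/hom_conj_char.
  by rewrite -e12 => -[].
apply/seteqP; split=> f [fM /hom_conj_char fc]; split=> //;
  apply/hom_conj_char => //.
  by rewrite -e12 fc.
by rewrite e12 fc.
Qed.

Lemma hom_of_rep (r : gT -> 'M[C]_N) : preserves_form e r J0 -> (forall g,
  D (r g)) ->
  exists f : H -> G, is_hom Gamma f /\ forall g, hom_rep f g = r g.
Proof.
move=> [ur _ _ Jr] Dr.
have [F FE] : {F : gT -> G & forall g, mx (F g) = r g}.
  apply: (boolp.choice (P := fun g x => mx x = r g)) => g; apply: mx_surj => //;
    exact: (proj2 ur).
(* The value 1 outside [Gamma] is arbitrary, since [is_hom] only concerns [Gamma]. *)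
pose f h : G := if insub h is Some g then F g else 1%g.
have fE g : f (fgroup_val g) = F g by rewrite /f (valK (g : fset_sub_type Gamma)).
exists f; split; last by move=> g; rewrite /hom_rep fE FE.
move=> x y /(fgroup_val_surj gc)[g <-] /(fgroup_val_surj gc)[h <-].
by apply: mx_inj; rewrite -fgroup_valM !fE mxM !FE (proj1 ur).
Qed.

Lemma hom_classes_count B : (N < B)%N ->
  let P := mult_params B (fun E : {set irr} => (E \subset irr_form e) && RD E) N in
  finite_set (hom_classes Gamma G) /\ nb_hom Gamma G = #|P|.
Proof.
move=> NB P; have PP p : p \in P -> [/\ sym_mult (fun i => p.1 i),
    forall i, i \in p.2 -> irr_form e i, RD p.2
    & (weight (fun i => p.1 i) + set_weight p.2 = N)%N].
  rewrite inE => /and3P[/csymP sc /andP[/fintype.subsetP ES RE] /eqP wE].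
  by split=> // i /ES.
have [F FE] : {F : {ffun irr -> 'I_B} * {set irr} -> H -> G & forall p, p \in P ->
    is_hom Gamma (F p) /\ character (hom_rep (F p)) = multchar (fun i => p.1 i) p.2}.
  apply: (boolp.choice (P := fun p f => p \in P -> is_hom Gamma f /\
    character (hom_rep f) = multchar (fun i => p.1 i) p.2)) => p.
  have [pP|pP] := boolP (p \in P); last by exists (fun=> 1%g).
  have [sc EF RE wE] := PP _ pP.
  have [|r [Fr rE]] := standard_form J01 J0e (multchar_form sc EF).
    by rewrite multchar1 wE.
  have [ur _ _ _] := Fr.
  have [f [fM fr]] := hom_of_rep Fr ((RD_P sc EF ur rE).1 RE).
  by exists f; split=> //; rewrite -rE; apply/ffunP=> g; rewrite !ffunE fr.
apply: (card_image_classes (f := fun p => hom_class Gamma (F p))).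
- move=> p p' pP p'P; have [pM pE] := FE _ pP; have [p'M p'E] := FE _ p'P.
  move/(hom_class_eq pM p'M); rewrite pE p'E => eqm.
  have [sc EF _ _] := PP _ pP; have [sc' EF' _ _] := PP _ p'P.
  have [cc EE] := multchar_inj sc sc' EF EF' eqm.
  case: p p' cc EE {pP p'P pM pE p'M p'E eqm sc EF sc' EF'} =>
    [c E] [c' E'] /= cc ->.
  by congr (_, _); apply/ffunP=> i; apply/val_inj/cc.
- move=> y; split=> [[f fM <-]|[p pP ->]]; last first.
    by exists (F p) => //; have [] := FE _ pP.
  have Ff := hom_rep_formed fM; have [ur _ _ _] := Ff.
  have [c [E [sc EF cE]]] := @form_multchar _ _ e (character (hom_rep f)) (ex_intro
    _ N
     (ex_intro _ (hom_rep f) (ex_intro _ J0 (conj Ff erefl)))).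
  have wE : (weight c + set_weight E = N)%N.
    by apply/eqP; rewrite -(@eqr_nat C) -multchar1 -cE character1.
  (* Degrees are positive, so [c i] is at most [weight c], hence at most [N]. *)
  have cN i : (c i < B)%N.
    apply: leq_ltn_trans NB; rewrite -wE /weight (bigD1 i) //= -addnA;
      apply: leq_trans (leq_addr _ _).
    by rewrite leq_pmull // deg_gt0.
  pose c' : {ffun irr -> 'I_B} := [ffun i => Ordinal (cN i)].
  have c'E : (fun i => nat_of_ord (c' i)) = c.
    by apply/funext => i; rewrite ffunE.
  have pP : (c', E) \in P.
    rewrite inE /=; apply/and3P; split; [|apply/andP; split|].
    - by apply/csymP; rewrite c'E.
    - by apply/fintype.subsetP => i; apply: EF.
    - by apply/(RD_P sc EF ur cE) => g; apply: D_mx.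
    - by rewrite c'E wE.
  exists (c', E) => //; apply/(hom_class_eq fM); first by have [] := FE _ pP.
  by have [_ ->] := FE _ pP; rewrite /= c'E.
Qed.

End Target.

(** * Quaternionic matrices as complex matrices *)

Section Quaternions.
Variable R : realType.
Local Notation C := (R[i])%C.

(** The coordinate z in q = z + w j, with [quat_snd] giving w. Moving j past a complex number
    conjugates it, hence the conjugates in the product formulas. *)
Definition quat_fst (q : quaternion R) : C := (quat_re q +i* quat_i q)%C.
Definition quat_snd (q : quaternion R) : C := (quat_j q +i* quat_k q)%C.

Lemma quat_fstD p q : quat_fst (p + q) = quat_fst p + quat_fst q.
Proof. by case: p q => ? ? ? ? []. Qed.
Lemma quat_sndD p q : quat_snd (p + q) = quat_snd p + quat_snd q.
Proof. by case: p q => ? ? ? ? []. Qed.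
Lemma quat_fst0 : quat_fst 0 = 0. Proof. by []. Qed.
Lemma quat_snd0 : quat_snd 0 = 0. Proof. by []. Qed.
Lemma conjE (a b : R) : ((a +i* b)%C)^* = (a -i* b)%C :> C. Proof. by []. Qed.

Lemma quat_fstM p q : quat_fst (p * q) = quat_fst p * quat_fst q - quat_snd p *
  (quat_snd q)^*.
Proof.
case: p q => a b c d [a' b' c' d']; rewrite /quat_fst /quat_snd /= !conjE.
by apply/eqP; rewrite eq_complex /=; apply/andP; split; apply/eqP; ring.
Qed.
Lemma quat_sndM p q : quat_snd (p * q) = quat_fst p * quat_snd q + quat_snd p *
  (quat_fst q)^*.
Proof.
case: p q => a b c d [a' b' c' d']; rewrite /quat_fst /quat_snd /= !conjE.
by apply/eqP; rewrite eq_complex /=; apply/andP; split; apply/eqP; ring.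
Qed.
Lemma quat_fst_conj q : quat_fst (conj_quat q) = (quat_fst q)^*. Proof. by case: q.
  Qed.
Lemma quat_snd_conj q : quat_snd (conj_quat q) = - quat_snd q. Proof. by case: q.
  Qed.

Variable n : nat.
(* The image of Z + W j under H -> M_2(C). *)
Definition Sp_cmx (A : 'M[quaternion R]_n) : 'M[C]_(n + n) :=
  block_mx (map_mx quat_fst A) (map_mx quat_snd A) (- (map_mx quat_snd A)^cj)
    (map_mx quat_fst A)^cj.

Lemma quat_fst_mulmx (A B : 'M[quaternion R]_n) : map_mx quat_fst (A *m B) =
  map_mx quat_fst A *m map_mx quat_fst B - map_mx quat_snd A *m (map_mx quat_snd
    B)^cj.
Proof.
apply/matrixP => i j; rewrite !mxE (big_morph quat_fst quat_fstD quat_fst0) -sumrB.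
by apply: eq_bigr => k _; rewrite quat_fstM !mxE.
Qed.
Lemma quat_snd_mulmx (A B : 'M[quaternion R]_n) : map_mx quat_snd (A *m B) =
  map_mx quat_fst A *m map_mx quat_snd B + map_mx quat_snd A *m (map_mx quat_fst
    B)^cj.
Proof.
apply/matrixP => i j; rewrite !mxE (big_morph quat_snd quat_sndD quat_snd0)
  -big_split /=.
by apply: eq_bigr => k _; rewrite quat_sndM !mxE.
Qed.

Lemma Sp_cmxM A B : Sp_cmx (A *m B) = Sp_cmx A *m Sp_cmx B.
Proof.
rewrite /Sp_cmx mulmx_block quat_fst_mulmx quat_snd_mulmx; congr block_mx.
- by rewrite mulmxN.
- rewrite map_mxD !conjmxM conjmxK opprD mulNmx mulmxN; exact: addrC.
- by rewrite map_mxB !conjmxM conjmxK mulNmx addrC.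
Qed.

Lemma Sp_cmx_inj : injective Sp_cmx.
Proof.
move=> A B /eq_block_mx[/matrixP zE /matrixP wE _ _].
apply/matrixP=> i j; have := zE i j; have := wE i j; rewrite !mxE.
by case: (A i j) (B i j) => a b c d [a' b' c' d'] /= [-> ->] [-> ->].
Qed.

Lemma Sp_cmx_adj A : Sp_cmx (adj_quat A) = (Sp_cmx A)^h.
Proof.
have zE : map_mx quat_fst (adj_quat A) = (map_mx quat_fst A)^h.
  by apply/matrixP=> i j; rewrite !mxE quat_fst_conj.
have wE : map_mx quat_snd (adj_quat A) = - (map_mx quat_snd A)^T.
  by apply/matrixP=> i j; rewrite !mxE quat_snd_conj.
rewrite /Sp_cmx zE wE tr_block_mx map_block_mx; congr block_mx.
- by rewrite linearN map_mxN /= -adjmxE conjmxK.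
- by rewrite map_mxN opprK.
- by rewrite conjmxK -adjmxE conjmxK.
Qed.

Definition symp_mx : 'M[C]_(n + n) := block_mx 0 1%:M (- 1%:M) 0.

Lemma symp_mx_unitary : symp_mx *m symp_mx^h = 1%:M.
Proof.
rewrite /symp_mx tr_block_mx map_block_mx !trmx0 !map_mx0 mulmx_block.
rewrite !mul0mx !mulmx0 !addr0 !add0r adjmx1 mulmx1 linearN map_mxN /= adjmx1.
by rewrite mulNmx mulmxN opprK mulmx1 -scalar_mx_block.
Qed.

Lemma symp_mx_cj : symp_mx *m symp_mx^cj = ((-1) ^+ nat_of_bool true)%:M.
Proof.
rewrite /symp_mx map_block_mx !map_mx0 map_mxN conjmx1 mulmx_block.
rewrite !mul0mx !mulmx0 !addr0 !add0r mulmx1 mul1mx expr1.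
by rewrite -raddfN -scalar_mx_block.
Qed.

Lemma Sp_cmx_symp A : Sp_cmx A *m symp_mx = symp_mx *m (Sp_cmx A)^cj.
Proof.
rewrite /Sp_cmx /symp_mx map_block_mx map_mxN !conjmxK !mulmx_block.
rewrite !mul0mx !mulmx0 !addr0 !add0r !mulmx1 !mul1mx !mulmxN !mulNmx mulmx1 !mul1mx.
by rewrite mulmx1.
Qed.

(** The block equations express the lower blocks by the upper ones exactly as in [Sp_cmx], and the
    quaternion entries are read off the upper blocks. *)
Lemma symp_commE U : U *m symp_mx = symp_mx *m U^cj -> exists A, U = Sp_cmx A.
Proof.
rewrite -[U]submxK; move: (ulsubmx U) (ursubmx U) (dlsubmx U) (drsubmx U).
move=> a b c d; rewrite /symp_mx map_block_mx !mulmx_block.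
rewrite !mul0mx !mulmx0 !addr0 !add0r !mulmx1 !mulmxN !mulNmx !mul1mx mulmx1.
move/eq_block_mx => [bE aE _ _].
exists (\matrix_(i, j) Quaternion (complex.Re (a i j)) (complex.Im (a i j))
   (complex.Re (b i j)) (complex.Im (b i j))).
have zE : map_mx quat_fst (\matrix_(i,
  j) Quaternion (complex.Re (a i j)) (complex.Im (a i j))
   (complex.Re (b i j)) (complex.Im (b i j))) = a.
  by apply/matrixP=> i j; rewrite !mxE /quat_fst /=; case: (a i j).
have wE : map_mx quat_snd (\matrix_(i,
  j) Quaternion (complex.Re (a i j)) (complex.Im (a i j))
   (complex.Re (b i j)) (complex.Im (b i j))) = b.
  by apply/matrixP=> i j; rewrite !mxE /quat_snd /=; case: (b i j).
rewrite /Sp_cmx zE wE; congr block_mx.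
  by rewrite -[c]conjmxK -bE map_mxN.
by rewrite aE conjmxK.
Qed.

Lemma Sp_cmx1 : Sp_cmx 1%:M = 1%:M.
Proof.
rewrite /Sp_cmx (_ : map_mx quat_fst 1%:M = 1%:M); last first.
  by apply/matrixP=> i j; rewrite !mxE; case: (i == j).
rewrite (_ : map_mx quat_snd 1%:M = 0); last first.
  by apply/matrixP=> i j; rewrite !mxE; case: (i == j).
by rewrite map_mx0 oppr0 conjmx1 -scalar_mx_block.
Qed.

Lemma Sp_unitary (A : Sp R n) : Sp_cmx A *m (Sp_cmx A)^h = 1%:M.
Proof. by case: A => A /= /andP[_ /eqP AA];
  rewrite -Sp_cmx_adj -Sp_cmxM AA Sp_cmx1. Qed.

Lemma Sp_cmx_surj U : U *m U^h = 1%:M -> U *m symp_mx = symp_mx *m U^cj ->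
  exists A : Sp R n, Sp_cmx A = U.
Proof.
move=> UU /symp_commE[A UE]; rewrite UE in UU *.
suff SA : is_Sp A by exists (MkSp SA).
by rewrite /is_Sp -!(inj_eq Sp_cmx_inj) !Sp_cmxM Sp_cmx_adj Sp_cmx1 (mulmx1C UU) UU
  eqxx.
Qed.

End Quaternions.

(** * Real orthogonal matrices as complex matrices *)

Section Orthogonal.
Variables (R : realType) (N : nat).
Local Notation C := (R[i])%C.

Definition SO_cmx (A : 'M[R]_N) : 'M[C]_N := map_mx (real_complex R) A.

Lemma SO_cmx_inj : injective SO_cmx.
Proof. by move=> A B; apply: map_mx_inj. Qed.

Lemma SO_cmx_cj A : (SO_cmx A)^cj = SO_cmx A.
Proof.
by apply/matrixP=> i j; rewrite !mxE; apply/eqP; rewrite eq_complex /= oppr0 !eqxx.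
Qed.

Lemma real_mx_surj U : U^cj = U -> exists A, U = SO_cmx A.
Proof.
move=> /matrixP UE; exists (map_mx (@complex.Re R) U); apply/matrixP=> i j.
have := UE i j; rewrite !mxE; case: (U i j) => a b /= /eqP;
  rewrite eq_complex /= => /andP[_].
by rewrite eq_sym -addr_eq0 -mulr2n mulrn_eq0 /= => /eqP->.
Qed.

Lemma SO_cmx_unitary (A : SO R N) : SO_cmx A *m (SO_cmx A)^h = 1%:M.
Proof.
case: A => A /= /andP[/eqP AA _]; rewrite adjmxE SO_cmx_cj /SO_cmx map_trmx.
by rewrite -map_mxM AA map_mx1.
Qed.

Lemma SO_cmx_surj U : U *m U^h = 1%:M -> U^cj = U -> \det U = 1 ->
  exists A : SO R N, SO_cmx A = U.
Proof.
move=> UU /real_mx_surj[A UE] dU; rewrite UE in UU dU *.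
suff SA : is_SO A by exists (MkSO SA).
apply/andP; split.
  apply/eqP/SO_cmx_inj; rewrite /SO_cmx map_mxM map_mx1 -map_trmx -UU.
  by rewrite adjmxE SO_cmx_cj.
by apply/eqP; move: dU; rewrite /SO_cmx det_map_mx => /(congr1 (@complex.Re R)).
Qed.

(** The determinant is 1 or -1, and in odd dimension [- U] has the opposite one, so [U] or [- U] is
    special orthogonal. *)
Lemma SO_cmx_proj_surj U : odd N -> U *m U^h = 1%:M -> U^cj = U ->
  exists (A : SO R N) (s : C), s != 0 /\ SO_cmx A = s *: U.
Proof.
move=> oN UU Ur; have dd : \det U * \det U = 1.
  by have := congr1 determinant UU; rewrite det_mulmx adjmxE Ur det_tr det1.
have real_id (V : 'M[C]_N) : V^cj = V -> V *m V^h = 1%:M -> \det V = 1 ->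
    exists A : SO R N, SO_cmx A = V by move=> *; apply: SO_cmx_surj.
have : \det U ^+ 2 = 1 by rewrite expr2.
move/eqP; rewrite sqrf_eq1 => /orP[]/eqP dU.
  by have [A AE] := real_id U Ur UU dU; exists A, 1; rewrite oner_eq0 scale1r.
have [|||A AE] := real_id (- U).
- by rewrite map_mxN Ur.
- by rewrite linearN map_mxN /= mulNmx mulmxN opprK.
- by rewrite -scaleN1r detZ dU -signr_odd oN mulrNN mulr1.
by exists A, (-1); rewrite oppr_eq0 oner_eq0 AE scaleN1r.
Qed.
End Orthogonal.

(** * The two counts and their comparison *)

Section Final.
Variables (R : realType) (Gamma : {fset SU R 2}).
Hypothesis gc : group_closed (mem Gamma).
Local Notation gT := (fgroup gc).
Local Notation C := (R[i])%C.

Definition std_rep (g : gT) : 'M[C]_2 := fgroup_val g.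

Lemma std_rep_urep : urep std_rep.
Proof.
split=> [g h|g]; first by [].
rewrite /std_rep; case: (fgroup_val g) => A /= /andP[/unitarymxP AA _].
by rewrite AA.
Qed.

Lemma std_rep_det g : \det (std_rep g) = 1.
Proof. by rewrite /std_rep; case: (fgroup_val g) => A /= /andP[_ /eqP]. Qed.

Lemma std_rep_inj : injective std_rep.
Proof. by move=> g h /val_inj/fgroup_val_inj. Qed.

Local Notation irr_form := (@irr_form C gT).

Lemma Sp_count n B : (n + n < B)%N ->
  finite_set (hom_classes Gamma (Sp R n)) /\
  nb_hom Gamma (Sp R n) = #|mult_params B (fun E =>
    E \subset irr_form true) (n + n)%N|.
Proof.
move=> nB.
have [||||||||||fin ->] := @hom_classes_count C _ Gamma gc (Sp R n) true (n + n)%N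
  (@Sp_cmx R n) (symp_mx R n) predT predT _ _ _ _ _ _ _ _ _ _ B nB.
- exact: symp_mx_unitary.
- exact: symp_mx_cj.
- by move=> A A'; apply: Sp_cmxM.
- exact: Sp_unitary.
- by move=> A; apply: Sp_cmx_symp.
- by move=> A A' /Sp_cmx_inj/val_inj.
- by [].
- by move=> U UU UJ _; apply: Sp_cmx_surj.
- move=> U UU UJ; have [A AE] := Sp_cmx_surj UU UJ.
  by exists A, 1; rewrite oner_eq0 scale1r.
- by [].
split=> //; apply: eq_card => p; rewrite !inE.
by rewrite andbT.
Qed.

(** For the structure [1%:M], compatible unitary matrices are the real orthogonal ones; by
    [det_multchar] the condition on determinants becomes [unimodular E]. *)
Lemma SO_count n B : (2 * n + 1 < B)%N ->
  finite_set (hom_classes Gamma (SO R (2 * n + 1))) /\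
  nb_hom Gamma (SO R (2 * n + 1)) =
  #|mult_params B (fun E => (E \subset irr_form false) && unimodular E) (2 * n +
    1)%N|.
Proof.
move=> nB; have oN : odd (2 * n + 1) by rewrite addn1 /= mul2n odd_double.
apply: (@hom_classes_count C _ Gamma gc (SO R (2 * n + 1)) false (2 * n + 1)%N
  (@SO_cmx R (2 * n + 1)%N) 1%:M (fun U => \det U == 1) (@unimodular C gT)
  _ _ _ _ _ _ _ _ _ _ B nB).
- by rewrite adjmx1 mulmx1.
- by rewrite conjmx1 mulmx1.
- by move=> A A'; rewrite /SO_cmx /= map_mxM.
- exact: SO_cmx_unitary.
- by move=> A; rewrite mulmx1 mul1mx SO_cmx_cj.
- by move=> A A' /SO_cmx_inj/val_inj.
- by case=> A /= /andP[_ /eqP dA]; rewrite /SO_cmx det_map_mx dA.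
- move=> U UU; rewrite mulmx1 mul1mx => Ur /eqP dU.
  exact: (SO_cmx_surj UU (esym Ur) dU).
- move=> U UU; rewrite mulmx1 mul1mx => Ur.
  exact: (SO_cmx_proj_surj oN UU (esym Ur)).
- move=> c E r sc EF ur rE; split=> [/forallP dE g|dr].
    by rewrite (det_multchar g sc ur rE); exact: dE.
  by apply/forallP=> g; rewrite /set_det -(det_multchar g sc ur rE); exact: dr.
Qed.

End Final.

Local Close Scope ring_scope.

(* The two finiteness claims say that both sides are genuine numbers. *)
Theorem theorem4p1 (R : realType) (n : nat) (n_gt0 : (0 < n)%N)
    (Gamma : {fset SU R 2}) (Gamma_group : group_closed (mem Gamma)) :
  [/\ finite_set (hom_classes Gamma (Sp R n)),
      finite_set (hom_classes Gamma (SO R (2 * n + 1)))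
    & nb_hom Gamma (Sp R n) = nb_hom Gamma (SO R (2 * n + 1))].
Proof.
(* The bound 2n+2 exceeds both dimensions 2n and 2n+1; using the same one twice makes both counts
   range over the same multiplicity functions. *)
have [finSp ->] := @Sp_count R Gamma Gamma_group n (2 * n + 2) ltac:(lia).
have [finSO ->] := @SO_count R Gamma Gamma_group n (2 * n + 2) ltac:(lia).
split=> //; rewrite addnn addn1 mul2n; apply: card_mult_params_eq.
apply: su2_odd_part; [exact: std_rep_urep|exact: std_rep_det|exact: std_rep_inj].
Qed.
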